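(* Let $p\equiv q\equiv 5\bmod 8$ be primes with $\left(\frac{p}{q}\right)=-1$, and assume that $k=\mathbb{Q}(\sqrt{-pq})$ has $2$-class group $[4,2]$. Write $p=a^2+b^2$ and $q=c^2+d^2$ with $a$ and $c$ odd, and set $\pi=a+bi$ and $\rho=c+di$. If $\left[\frac{\pi}{\rho}\right]=+1$, then the equation $$A^2-\pi\rho B^2-\pi'\rho'\Gamma^2=0$$ has a nontrivial solution $(A,B,\Gamma)=(\alpha,\beta,\gamma)$ in $\mathbb{Z}[i]$. Setting $\mu=\alpha+\beta\sqrt{\pi\rho}$, the extension $K=k(\sqrt{pq},\sqrt{\pi\rho},\sqrt{\mu})$ is a $C_8$-extension of $k$, which is ramified at $2$. In addition, $\alpha$ and $\beta$ can be chosen in such a way that $L=k(\sqrt{pq},\sqrt{\pi\rho},\sqrt{\pi\mu})$ is an unramified $\operatorname{M}_4(2)$-extension of $k$.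
   Context: Here $i=\sqrt{-1}$, the numbers $a,b,c,d$ are integers, $\pi'=a-bi$ and $\rho'=c-di$ are the complex conjugates of $\pi$ and $\rho$, and $\left[\frac{\cdot}{\cdot}\right]$ is the quadratic residue symbol in the Gaussian integers $\mathbb{Z}[i]$. The $2$-class group is the $2$-Sylow subgroup of the ideal class group, and $[4,2]$ denotes $C_4\times C_2$, where $C_n$ is the cyclic group of order $n$. A $G$-extension is a normal extension with Galois group isomorphic to $G$. $\operatorname{M}_4(2)=\langle\sigma,\tau:\sigma^8=\tau^2=1,\ \tau\sigma\tau=\sigma^5\rangle$ is the modular group of order $16$. Nontrivial means that $\alpha,\beta,\gamma$ are not all zero.
   Formalization: L is taken to be k(√p, √q, √(πρ), √(πμ)), since the printed k(√(pq), √(πρ), √(πμ)) has degree at most 8 over k; and the claims on K are made for one suitably chosen solution (the same as for L), as they fail for some nontrivial solutions. *)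

(* Defs.v *)
(* All number fields are subfields of algC. *)
From HB Require Import structures.
From mathcomp Require Import all_boot all_order all_algebra.
From mathcomp Require Import all_fingroup all_solvable all_field.
From mathcomp Require Import boolp classical_sets.

Set Implicit Arguments.
Unset Strict Implicit.
Unset Printing Implicit Defensive.

Import Order.TTheory GRing.Theory Num.Theory.
Local Open Scope classical_set_scope.
Local Open Scope ring_scope.

Definition legendre (x : int) (q : nat) : int :=
  if (q%:Z %| x)%Z then 0
  else if [exists z : 'I_q, (q%:Z %| x - z%:Z ^+ 2)%Z] then 1 else -1.

Definition gaussInt : set algC :=
  [set z | exists a b : int, z = a%:~R + b%:~R * 'i].

Definition gauss_dvd (r x : algC) : Prop := exists2 z, gaussInt z & x = z * r.

(* The symbol [x / r], for a prime r of Z[i] not dividing 2. *)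
Definition gauss_symbol (x r : algC) : int :=
  if `[< gauss_dvd r x >] then 0
  else if `[< exists2 z, gaussInt z & gauss_dvd r (x - z ^+ 2) >] then 1
  else -1.

Definition subfield_set (E : set algC) : Prop :=
  [/\ E 1, forall x y, E x -> E y -> E (x - y)
         & forall x y, E x -> E y -> E (x / y)].

Definition adjoin (E : set algC) (s : seq algC) : set algC :=
  smallest subfield_set (E `|` [set` s]).

Definition ratC : set algC := [set` Crat].

Definition int_ring (E : set algC) : set algC := [set x | E x /\ x \in Aint].

Section Ideals.

Variable O : set algC.

Definition is_ideal (I : set algC) : Prop :=
  [/\ I `<=` O, I 0, forall x y, I x -> I y -> I (x + y)
    & forall r x, O r -> I x -> I (r * x)].

Definition nz_ideal (I : set algC) : Prop :=
  is_ideal I /\ exists2 x, I x & x != 0.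

Definition nz_prime_ideal (P : set algC) : Prop :=
  [/\ nz_ideal P, ~ P 1
    & forall x y, O x -> O y -> P (x * y) -> P x \/ P y].

Definition ideal_prod (I J : set algC) : set algC :=
  [set z | exists2 s : seq (algC * algC),
             (forall u, u \in s -> I u.1 /\ J u.2)
           & z = \sum_(u <- s) u.1 * u.2].

Definition ideal_exp (I : set algC) (n : nat) : set algC :=
  iter n (ideal_prod I) O.

Definition ideal_equiv (I J : set algC) : Prop :=
  exists x y, [/\ O x, O y, x != 0, y != 0
                & [set x * u | u in I] = [set y * u | u in J]].

(* [G] is isomorphic to the ideal class group of [O]: [cl] is a surjective
   multiplicative map on the nonzero ideals whose fibres are the ideal
   classes. *)
Definition is_class_group (gT : finGroupType) (G : {group gT}) : Prop :=
  exists cl : set algC -> gT,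
    [/\ forall I, nz_ideal I -> cl I \in G,
        forall g, g \in G -> exists2 I, nz_ideal I & cl I = g,
        forall I J, nz_ideal I -> nz_ideal J ->
          cl (ideal_prod I J) = (cl I * cl J)%g
      & forall I J, nz_ideal I -> nz_ideal J ->
          (cl I = cl J <-> ideal_equiv I J)].

End Ideals.

Definition two_class_group_isog (k : set algC)
    (hT : finGroupType) (H : {group hT}) : Prop :=
  exists (gT : finGroupType) (Cl S : {group gT}),
    [/\ is_class_group (int_ring k) Cl, (2.-Sylow(Cl) S)%g & (S \isog H)%g].

(* [K/k] is a normal extension of number fields with group [G]. MathComp's
   Galois theory lives inside a finite splitting field [Om] of Q, here embedded
   in algC; neither side depends on the choice of [Om] and [phi]. *)
Definition galois_extension (k K : set algC)
    (gT : finGroupType) (G : {group gT}) : Prop :=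
  exists (Om : splittingFieldType rat) (phi : {rmorphism Om -> algC})
         (k0 K0 : {subfield Om}),
    [/\ phi @` [set` k0] = k, phi @` [set` K0] = K,
        galois k0 K0 & ('Gal(K0 / k0) \isog G)%g].

(* [P] is a prime of [K], lying above the prime [P `&` int_ring k] of [k]. *)
Definition ramification_index (k K P : set algC) (e : nat) : Prop :=
  let O := int_ring K in
  let pO := ideal_prod (P `&` int_ring k) O in
  pO `<=` ideal_exp O P e /\ ~ (pO `<=` ideal_exp O P e.+1).

Definition ramified_above (k K : set algC) (l : nat) : Prop :=
  exists P e, [/\ nz_prime_ideal (int_ring K) P, P l%:R,
                  ramification_index k K P e & (1 < e)%N].

(* Every embedding of a number field in algC extends to an endomorphism of
   algC, so the second clause says that no real place of [k] becomes complex
   in [K]. *)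
Definition unramified (k K : set algC) : Prop :=
  (forall P, nz_prime_ideal (int_ring K) P -> ramification_index k K P 1) /\
  (forall sigma : {rmorphism algC -> algC},
     (forall x, k x -> sigma x \is Num.real) ->
     forall x, K x -> sigma x \is Num.real).

(* MathComp's 'Mod_16 has the presentation of M_4(2). *)
Lemma M42_presentation :
  ('Mod_(16%N) \isog Grp (s : t : s ^+ 8, t ^+ 2, t * s * t = s ^+ 5))%g.
Proof.
move=> rT H; rewrite (@Grp_modular_group 2 4) //.
rewrite /Presentation.hom; cbn -[natexp mul conjg].
apply: eq_existsb => -[x y] /=.
congr (_ && (_ && _)).
have [y2|//] := eqVneq (y ^+ 2)%g 1%g; rewrite !andTb conjgE.
suff -> : (y^-1)%g = y by rewrite mulgA.
by apply: (mulgI y); rewrite mulgV -y2 expgS expg1.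
Qed.

(* Main.v *)
Require Import Defs.
From HB Require Import structures.
From mathcomp Require Import all_boot all_order all_algebra.
From mathcomp Require Import all_fingroup all_solvable all_field.
From mathcomp Require Import boolp classical_sets.
From mathcomp Require Import zify ring lra.

(** Write [w = sqrt (- p q)] and [sg * pi * rho = e + 4 f i], where the sign [sg] makes [e] congruent
    to 1 modulo 4, so that [e = 1 - 4 c1], and let [s0] be a square root of this number.

    The conic. The symbol [[pi / rho] = 1] translates into the statement that [4 f] is a
    square modulo [p] and [q] ([nonres_p_f], [nonres_q_f]). Legendre's theorem ([legendre_conic]) then
    gives a point on [X ^ 2 + |4 f| T ^ 2 = p q Y ^ 2], which amounts to a Gaussian integer [be]
    with the imaginary part of [(e + 4 f i) be ^ 2] equal to a square up to sign. The difference of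
    [(e + 4 f i) be ^ 2] and its conjugate is then the square of an element
    [alpha = 2 t (1 + s i)]: this is the required solution, with [gamma] the conjugate of [be]
    up to a unit ([conic_solution], [mu_al_sqr]).

    Galois groups. Let [nu ^ 2 = mu] or [nu ^ 2 = pi * mu]. An automorphism [sigma] of the
    extension that moves [i] sends [s0] to a square root of the conjugate, and [sigma ^ 2]
    negates [s0]. As [mu * sigma mu] is a square in the field ([mu_sg_mu]), the extension is normal;
    as [(nu * sigma ^ 2 nu) ^ 2] is the square of an element that [sigma ^ 2] negates,
    [sigma ^ 4] negates [nu]. So [sigma] has order 8. The field [K] has degree 8
    over [k], and [L] has degree 16, with a second automorphism that moves [sqrt p] only, up to
    a sign on [nu] ([mu_field_C8], [mu_field_M42]).

    The role of the class group. The class group hypothesis implies that [c1 + f] is odd ([class_group_42_jacobi], [order_eight_parity]). Indeed, otherwise a solution of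
    [p X ^ 2 + q Y ^ 2 = 2 n ^ 2] has [n] congruent to 1 modulo 4, which makes the class of
    norm [n] a square [u ^ 2] up to classes of order 2; then [u ^ 4] is the inverse of the class of
    norm [2 p], which has order 2, and the class group has the element [u] of order 8
    ([order_eight_data], [order_eight_class]).

    Ramification. Localized at a prime [P], the primes below [P] in the successive quadratic
    extensions are principal; the generator found in [k] remains one in a quadratic extension
    as long as some integer differs from its conjugate by a unit at [P] ([loc_gen_quad]), and a
    generator that survives to the top means that [P] is unramified. At odd primes such an integer is
    a square root that is a unit: [pi * mu] may be replaced, up to squares, by its products with
    several factors that have no common prime ([mu_factors_coprime]). At 2 it is half the sum of [nu]
    and [h] where [pi * mu] is congruent to [+- h ^ 2] modulo 4; the congruence holds because
    [c1 + f] is odd and [pi] is [+- (1 + 2 i)] modulo 4 ([gauss_mod4]). The same congruence shows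
    that [mu] is [+- (1 + 2 i) h ^ 2] modulo 4, and then [K] is generated at 2 by a root of an
    Eisenstein polynomial ([eisen_ramified]). *)

Set Implicit Arguments.
Unset Strict Implicit.
Unset Printing Implicit Defensive.

Import Order.TTheory GRing.Theory Num.Theory.
Local Open Scope ring_scope.

(** * Legendre's theorem on ternary quadratic forms *)

Lemma PoszX (m n : nat) : ((m ^ n)%N : int) = m%:Z ^+ n.
Proof. by elim: n => // n IH; rewrite expnS PoszM IH exprS. Qed.

Lemma nat_sqrt_exists (n : nat) : exists r, (r ^ 2 <= n < r.+1 ^ 2)%N.
Proof.
elim: n => [|n [r /andP[h1 h2]]]; first by exists 0%N.
case: (ltnP n.+1 (r.+1 ^ 2)) => h; first by exists r; rewrite h (leq_trans h1).
by exists r.+1; rewrite h /=; nia.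
Qed.

Lemma dvdz_sub_modz (a : nat) (x y : int) : (0 < a)%N ->
  (inord `|(x %% a)%Z| : 'I_a.-1.+1) = inord `|(y %% a)%Z| -> (a %| x - y)%Z.
Proof.
move=> a0 h; rewrite -eqz_mod_dvd; apply/eqP.
have a0' : (a : int) != 0 by rewrite -lt0n.
have hb z : (`|(z %% a)%Z| < a.-1.+1)%N.
  by rewrite prednK // -ltz_nat gez0_abs ?modz_ge0 ?ltz_pmod.
have := congr1 val h; rewrite /= !inordK ?hb // => /(congr1 Posz).
by rewrite !gez0_abs ?modz_ge0.
Qed.

Lemma sqr_sub_ord_le (r m : nat) (i j : 'I_r.+1) : (r ^ 2 <= m)%N ->
  (i%:Z - j%:Z) ^+ 2 <= m%:Z.
Proof.
move=> h; have := ltn_ord i; have := ltn_ord j; move: (nat_of_ord i) (nat_of_ord j).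
move=> {i j} i j; rewrite !ltnS => hi hj.
apply: (@le_trans _ _ ((r ^ 2)%N%:Z)); last by rewrite lez_nat.
rewrite PoszX -(real_normK (num_real (_ - _))) lerXn2r ?nnegrE //.
by case/orP: (leq_total i j) => ij; lia.
Qed.

Lemma coprime_dvdz_mul (a b : nat) (m : int) : coprime a b ->
  (a %| m)%Z -> (b %| m)%Z -> ((a * b)%N %| m)%Z.
Proof. by move=> cab; rewrite !dvdzE /= Gauss_dvd // => -> ->. Qed.

(** Legendre's theorem by the pigeonhole principle: the congruences cut out a lattice of index
    [a * b * c], and the box [x ^ 2 <= b * c], [y ^ 2 <= a * c], [z ^ 2 <= a * b] has more
    points, so that a nonzero lattice point gives [a * x ^ 2 + b * y ^ 2 - c * z ^ 2] a multiple
    of [a * b * c] which can only be [0] or [a * b * c]; in the latter case an explicit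
    transformation yields a zero. *)
Lemma legendre_conic (a b c : nat) (u v w : int) :
    (0 < a)%N -> (0 < b)%N -> (0 < c)%N ->
    coprime a b -> coprime b c -> coprime a c ->
    (a %| u ^+ 2 - b%:Z * c%:Z)%Z -> (b %| v ^+ 2 - a%:Z * c%:Z)%Z ->
    (c %| w ^+ 2 + a%:Z * b%:Z)%Z ->
    (forall n, (n ^ 2)%N != (a * b)%N) -> (forall n, (n ^ 2)%N != (b * c)%N) ->
  exists x y z : int, [|| x != 0, y != 0 | z != 0] /\
    a%:Z * x ^+ 2 + b%:Z * y ^+ 2 = c%:Z * z ^+ 2.
Proof.
move=> a0 b0 c0 cab cbc cac ha hb hc nab nbc.
have [r /andP[r1 r2]] := nat_sqrt_exists (b * c).
have [s /andP[s1 s2]] := nat_sqrt_exists (a * c).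
have [t /andP[t1 t2]] := nat_sqrt_exists (a * b).
pose T := ('I_r.+1 * 'I_s.+1 * 'I_t.+1)%type.
pose U := ('I_a.-1.+1 * 'I_b.-1.+1 * 'I_c.-1.+1)%type.
pose f (k : T) : U :=
  (inord `|((b%:Z * k.1.2%:Z - u * k.2%:Z) %% a)%Z|,
   inord `|((a%:Z * k.1.1%:Z - v * k.2%:Z) %% b)%Z|,
   inord `|((a%:Z * k.1.1%:Z - w * k.1.2%:Z) %% c)%Z|).
have : ~~ injectiveb f.
  apply/negP => /injectiveP /leq_card; rewrite !card_prod !card_ord !prednK //.
  apply/negP; rewrite -ltnNge -ltn_sqr.
  have -> : ((a * b * c) ^ 2 = (b * c) * (a * c) * (a * b))%N by rewrite !expnS expn0; ring.
  have -> : ((r.+1 * s.+1 * t.+1) ^ 2 = r.+1 ^ 2 * s.+1 ^ 2 * t.+1 ^ 2)%N by rewrite !expnMn.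
  by apply: ltn_mul; first apply: ltn_mul.
move=> /injectivePn[[[x1 y1] z1]] [[[x2 y2] z2]] hneq hf.
have := congr1 (fun k => k.1.1) hf => /dvdz_sub_modz-/(_ a0) /= ka.
have := congr1 (fun k => k.1.2) hf => /dvdz_sub_modz-/(_ b0) /= kb.
have := congr1 (fun k => k.2) hf => /dvdz_sub_modz-/(_ c0) /= kc.
pose x : int := x1%:Z - x2%:Z; pose y : int := y1%:Z - y2%:Z; pose z : int := z1%:Z - z2%:Z.
have nz : [|| x != 0, y != 0 | z != 0].
  apply: contra_neqT hneq; rewrite !negb_or !negbK !subr_eq0 !eqz_nat.
  by case/and3P => /eqP/val_inj -> /eqP/val_inj -> /eqP/val_inj ->.
have bx : x ^+ 2 <= (b * c)%N%:Z by apply: sqr_sub_ord_le r1.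
have by_ : y ^+ 2 <= (a * c)%N%:Z by apply: sqr_sub_ord_le s1.
have bz : z ^+ 2 <= (a * b)%N%:Z by apply: sqr_sub_ord_le t1.
have kab : (a%:Z %| b%:Z * y - u * z)%Z by rewrite (_ : _ - _ = (b%:Z * y1%:Z - u * z1%:Z) - (b%:Z * y2%:Z - u * z2%:Z)) // /y /z; ring.
have kbb : (b%:Z %| a%:Z * x - v * z)%Z by rewrite (_ : _ - _ = (a%:Z * x1%:Z - v * z1%:Z) - (a%:Z * x2%:Z - v * z2%:Z)) // /x /z; ring.
have kcb : (c%:Z %| a%:Z * x - w * y)%Z by rewrite (_ : _ - _ = (a%:Z * x1%:Z - w * y1%:Z) - (a%:Z * x2%:Z - w * y2%:Z)) // /x /y; ring.
pose Q := a%:Z * x ^+ 2 + b%:Z * y ^+ 2 - c%:Z * z ^+ 2.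
have dQa : (a%:Z %| Q)%Z.
  have : (a%:Z %| b%:Z * (b%:Z * y ^+ 2 - c%:Z * z ^+ 2))%Z.
    rewrite (_ : _ * _ = (b%:Z * y - u * z) * (b%:Z * y + u * z) + z ^+ 2 * (u ^+ 2 - b%:Z * c%:Z)); last by ring.
    by apply: rpredD; [exact: dvdz_mulr|exact: dvdz_mull].
  rewrite Gauss_dvdzr ?coprimezE //= => h.
  by rewrite /Q -addrA; apply: rpredD => //; exact: dvdz_mulr.
have dQb : (b%:Z %| Q)%Z.
  have : (b%:Z %| a%:Z * (a%:Z * x ^+ 2 - c%:Z * z ^+ 2))%Z.
    rewrite (_ : _ * _ = (a%:Z * x - v * z) * (a%:Z * x + v * z) + z ^+ 2 * (v ^+ 2 - a%:Z * c%:Z)); last by ring.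
    by apply: rpredD; [exact: dvdz_mulr|exact: dvdz_mull].
  rewrite Gauss_dvdzr ?coprimezE /= 1?coprime_sym // => h.
  by rewrite /Q addrAC; apply: rpredD => //; exact: dvdz_mulr.
have dQc : (c%:Z %| Q)%Z.
  have : (c%:Z %| a%:Z * (a%:Z * x ^+ 2 + b%:Z * y ^+ 2))%Z.
    rewrite (_ : _ * _ = (a%:Z * x - w * y) * (a%:Z * x + w * y) + y ^+ 2 * (w ^+ 2 + a%:Z * b%:Z)); last by ring.
    by apply: rpredD; [exact: dvdz_mulr|exact: dvdz_mull].
  rewrite Gauss_dvdzr ?coprimezE /= 1?coprime_sym // => h.
  by rewrite /Q; apply: rpredB => //; exact: dvdz_mulr.
have [k Qk] : exists k : int, Q = k * (a * b * c)%N%:Z.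
  apply/dvdzP; rewrite coprime_dvdz_mul ?coprime_dvdz_mul // coprimeMl.
  by rewrite cac cbc.
have nzab : z ^+ 2 != (a * b)%N%:Z.
  apply: contraNneq (nab `|z|%N) => h; rewrite -eqz_nat PoszX.
  by rewrite -h abszE real_normK ?num_real.
have nxbc : x ^+ 2 != (b * c)%N%:Z.
  apply: contraNneq (nbc `|x|%N) => h; rewrite -eqz_nat PoszX.
  by rewrite -h abszE real_normK ?num_real.
have x0 := sqr_ge0 x; have y0 := sqr_ge0 y; have z0 := sqr_ge0 z.
have {}bx : x ^+ 2 < (b * c)%N%:Z by rewrite lt_neqAle nxbc.
have {}bz : z ^+ 2 < (a * b)%N%:Z by rewrite lt_neqAle nzab.
have abc0 : 0 < (a * b * c)%N%:Z by rewrite ltz_nat !muln_gt0 a0 b0.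
have az : a%:Z * x ^+ 2 < (a * b * c)%N%:Z by rewrite -mulnA PoszM ltr_pM2l.
have bz' : b%:Z * y ^+ 2 <= (a * b * c)%N%:Z.
  by rewrite (mulnC a) -mulnA PoszM ler_pM2l.
have cz : c%:Z * z ^+ 2 < (a * b * c)%N%:Z by rewrite mulnC PoszM ltr_pM2l.
have az0 : 0 <= a%:Z * x ^+ 2 by rewrite mulr_ge0.
have bz0 : 0 <= b%:Z * y ^+ 2 by rewrite mulr_ge0.
have cz0 : 0 <= c%:Z * z ^+ 2 by rewrite mulr_ge0.
have k1 : (-1 < k).
  by rewrite -(ltr_pM2r abc0) -Qk mulN1r /Q; clear - az0 bz0 cz; lra.
have k2 : (k < 2).
  by rewrite -(ltr_pM2r abc0) -Qk /Q; clear - az bz' cz0; lra.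
have [k0|k0] : k = 0 \/ k = 1 by clear - k1 k2; lia.
  by exists x, y, z; split=> //; move: Qk; rewrite k0 mul0r /Q => /eqP; rewrite subr_eq0 => /eqP.
exists (x * z + b%:Z * y), (y * z - a%:Z * x), (z ^+ 2 + (a * b)%N%:Z); split.
  apply/or3P; apply: Or33; apply: lt0r_neq0; rewrite ltr_wpDl // ltz_nat muln_gt0 a0 //.
have h : a%:Z * x ^+ 2 + b%:Z * y ^+ 2 = c%:Z * (z ^+ 2 + a%:Z * b%:Z).
  by move: Qk; rewrite k0 mul1r /Q !PoszM => /(canRL (subrK _)) ->; ring.
rewrite PoszM.
transitivity ((a%:Z * x ^+ 2 + b%:Z * y ^+ 2) * (z ^+ 2 + a%:Z * b%:Z)); first by ring.
by rewrite h; ring.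
Qed.

(** * Quadratic residues and reciprocity *)

Lemma natr_pchar_eq1 (R : nzRingType) (l n : nat) : l \in [pchar R] -> (0 < n)%N ->
  (n%:R == 1 :> R) = (l %| n.-1)%N.
Proof.
move=> cR n0; rewrite (dvdn_pcharf cR) -subr_eq0 -{1}(prednK n0).
by rewrite mulrS addrAC subrr add0r.
Qed.

(** Roots of unity of every order prime to [l] exist in finite fields of characteristic [l]. *)
Lemma primitive_root_in_pchar (l k m : nat) : prime l -> (0 < k)%N ->
  (m %| (l ^ k).-1)%N -> exists (F : finFieldType) (z : F),
    l \in [pchar F] /\ m.-primitive_root z.
Proof.
move=> pl k0 hm; have [F pF cF] := pPrimePowerField pl k0.
exists F.
have /cyclicP[x Gx] : cyclic [set: {unit F}]%G by exact: field_unit_group_cyclic.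
have hx : #[x]%g = (l ^ k).-1 by rewrite orderE -Gx card_finField_unit cF.
have lk1 : (1 < l ^ k)%N by rewrite -(exp1n k) ltn_exp2r // prime_gt1.
have [j hj] := dvdnP hm.
have pr : #[x]%g.-primitive_root (val x).
  rewrite /primitive_root_of_unity order_gt0; apply/eqfunP => i.
  apply/idP/eqP; last first.
    by move=> ->; rewrite unity_rootE -FinRing.val_unitX expg_order.
  rewrite unity_rootE -FinRing.val_unitX -[1]/(val (1%g : {unit F})) (inj_eq val_inj) -order_dvdn => h.
  by apply/eqP; rewrite eqn_leq ltn_ord /= dvdn_leq.
exists (val x ^+ j); split=> //.
have j0 : (0 < j)%N.
  by case: j hj lk1 => [|//]; case: (l ^ k)%N => [|[|n]].
have m0 : (0 < m)%N.
  by case: m hj lk1 {hm} => [|//]; rewrite muln0; case: (l ^ k)%N => [|[|n]].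
have -> : m = (#[x]%g %/ gcdn j #[x]%g)%N.
  by rewrite hx hj; rewrite (gcdn_idPl (dvdn_mulr _ _)) // mulKn.
exact: exp_prim_root.
Qed.

(** Quadratic nonresidues, read as a homomorphism to [bool] under [addb]. *)
Definition nonres (l : nat) (m : int) : bool :=
  ~~ [exists z : 'F_l, z ^+ 2 == m%:~R].

Section Residues.
Variables (l : nat) (pl : prime l) (ol : odd l).

Let l_half : l = (l.-1./2.*2).+1.
Proof. by move: ol; clear; lia. Qed.

Lemma half_Fp_gt0 : (0 < l.-1./2)%N.
Proof. by case: l pl ol => [|[|[|n]]]. Qed.

Lemma Fp_int_eq0 (m : int) : (m%:~R == 0 :> 'F_l) = (l %| m)%Z.
Proof. by rewrite (dvdz_pcharf (pchar_Fp pl)). Qed.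

Lemma Fp_two_neq0 : 2%:R != 0 :> 'F_l.
Proof.
rewrite -(dvdn_pcharf (pchar_Fp pl)).
by rewrite dvdn_prime2 //; apply: contraL ol => /eqP ->.
Qed.

Lemma Fp_half_sqr (x : 'F_l) : x != 0 -> (x ^+ l.-1./2) ^+ 2 = 1.
Proof.
move=> x0; rewrite -exprM muln2.
have h := expf_card x; rewrite card_Fp // in h.
by apply: (mulfI x0); rewrite mulr1 -exprS -[RHS]h; congr (_ ^+ _); exact: esym l_half.
Qed.

Lemma Euler_criterion (x : 'F_l) : x != 0 ->
  [exists z : 'F_l, z ^+ 2 == x] = (x ^+ l.-1./2 == 1).
Proof.
move=> x0; apply/existsP/idP => [[z /eqP hz]|hx].
  rewrite -hz -exprM mulnC exprM Fp_half_sqr //.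
  by apply: contraNneq x0 => z0; rewrite -hz z0 expr0n.
have fcyc : cyclic [set: {unit 'F_l}]%G by exact: field_unit_group_cyclic.
have /cyclicP[g Gg] := fcyc.
have xu : x \is a GRing.unit by rewrite unitfE.
have : Sub x xu \in <[g]>%g by rewrite -Gg inE.
case/cycleP => j hj.
have xj : x = val g ^+ j by rewrite -FinRing.val_unitX -hj.
have og : #[g]%g = l.-1.
  by rewrite orderE -Gg card_finField_unit card_Fp.
have : (g ^+ (j * l.-1./2) == 1)%g.
  by apply/eqP/val_inj; rewrite FinRing.val_unitX exprM -xj; apply/eqP.
have e : l.-1 = (2 * l.-1./2)%N by rewrite {1}l_half /= mul2n.
rewrite -order_dvdn og {1}e dvdn_pmul2r ?half_Fp_gt0 // => /dvdnP[i ji].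
by exists (val g ^+ i); rewrite xj ji exprM.
Qed.

Lemma nonresE (m : int) : ~~ (l %| m)%Z -> nonres l m = (m%:~R ^+ l.-1./2 != 1 :> 'F_l).
Proof. by move=> h; rewrite /nonres Euler_criterion // Fp_int_eq0. Qed.

Lemma nonres_sign (m : int) : ~~ (l %| m)%Z ->
  m%:~R ^+ l.-1./2 = (-1) ^+ nonres l m :> 'F_l.
Proof.
move=> h; rewrite nonresE //.
have := @Fp_half_sqr m%:~R; rewrite Fp_int_eq0 => /(_ h)/eqP.
rewrite sqrf_eq1 => /orP[] /eqP ->; rewrite ?eqxx ?expr0 //.
have -> // : -1 != 1 :> 'F_l.
by rewrite eq_sym -subr_eq0 opprK; apply: Fp_two_neq0.
Qed.

Lemma sign_Fp_inj (b1 b2 : bool) : (-1) ^+ b1 = (-1) ^+ b2 :> 'F_l -> b1 = b2.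
Proof.
have h : -1 != 1 :> 'F_l by rewrite eq_sym -subr_eq0 opprK; apply: Fp_two_neq0.
by case: b1 b2 => [] [] //= /eqP; rewrite ?(negbTE h) // eq_sym (negbTE h).
Qed.

Lemma nonresM (m n : int) : ~~ (l %| m)%Z -> ~~ (l %| n)%Z ->
  nonres l (m * n) = nonres l m (+) nonres l n.
Proof.
move=> hm hn; apply: sign_Fp_inj.
rewrite -nonres_sign; last first.
  by rewrite -Fp_int_eq0 rmorphM mulf_eq0 !Fp_int_eq0 negb_or hm.
by rewrite rmorphM exprMn !nonres_sign // signr_addb.
Qed.

Lemma nonres_sqr (m : int) : nonres l (m ^+ 2) = false.
Proof. by apply/negbF/existsP; exists m%:~R; rewrite rmorphXn. Qed.

Lemma nonresN1 : nonres l (-1) = (l %% 4 == 3)%N.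
Proof.
have hd : ~~ (l %| (-1 : int))%Z by rewrite dvdzE /= dvdn1; case: l pl => [|[]].
apply: sign_Fp_inj; rewrite -nonres_sign // rmorphN1.
suff -> : (l %% 4 == 3)%N = odd l.-1./2 by rewrite signr_odd.
by move: ol; clear; lia.
Qed.

(** The square root [z + z^-1] of [2], for [z] a primitive eighth root of unity, is fixed by
    the Frobenius exactly when [l] is [1] or [-1] modulo [8]. *)
Lemma nonres2 : nonres l 2 = ((l %% 8 == 3) || (l %% 8 == 5))%N.
Proof.
have hd : (8 %| (l ^ 2).-1)%N.
  have [n ln] : exists n, l = n.*2.+1 by exists l.-1./2; exact: l_half.
  have [j nj] : exists j, (n * n.+1 = j.*2)%N.
    by exists (n * n.+1)./2; rewrite even_halfK // oddM /=; case: (odd n).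
  by apply/dvdnP; exists j; rewrite ln; move: nj; clear; nia.
have [F [z [cF hz]]] := @primitive_root_in_pchar l 2 8 pl isT hd.
have z8 := prim_expr_order hz.
have z4 : z ^+ 4 = -1.
  apply/eqP; have : (z ^+ 4) ^+ 2 == 1 by rewrite -exprM z8.
  by rewrite sqrf_eq1 -(prim_order_dvd hz) /= .
have z0 : z != 0.
  by apply: contra_eq_neq z8 => /= ->; rewrite expr0n eq_sym oner_eq0.
have z5 : z ^+ 5 = - z by rewrite exprS z4 mulrN1.
have z7 : z ^+ 7 = - z ^+ 3 by rewrite -[7%N]/(3 + 4)%N exprD z4 mulrN1.
pose t := z - z ^+ 3.
have t2 : t ^+ 2 = 2%:R.
  rewrite /t sqrrB -!exprM -exprS z4 (_ : (3 * 2 = 4 + 2)%N) // exprD z4; ring.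
have two0 : 2%:R != 0 :> F.
  rewrite -(dvdn_pcharf cF).
  by rewrite dvdn_prime2 //; apply: contraL ol => /eqP ->.
have t0 : t != 0 by apply: contraNneq two0 => h; rewrite -t2 h expr0n.
have tl : t ^+ l = (-1) ^+ ((l %% 8 == 3) || (l %% 8 == 5))%N * t.
  rewrite /t -[LHS](pFrobenius_autE cF) rmorphB rmorphXn /= !pFrobenius_autE.
  have e8 j : z ^+ j = z ^+ (j %% 8) by rewrite {1}(divn_eq j 8) exprD mulnC exprM z8 expr1n mul1r.
  rewrite -exprM [z ^+ l]e8 [z ^+ (l * 3)]e8 -modnMml.
  have : (l %% 8 < 8)%N by rewrite ltn_mod.
  have : odd (l %% 8)%N by rewrite odd_mod.
  case: (l %% 8)%N => [|[|[|[|[|[|[|[|r]]]]]]]] //= _ _.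
  - by rewrite expr1 mul1r.
  - rewrite expr1 (_ : 9 %% 8 = 1)%N // expr1; ring.
  - rewrite expr1 (_ : 15 %% 8 = 7)%N // z5 z7; ring.
  - rewrite (_ : 21 %% 8 = 5)%N // z5 z7; ring.
have hd2 : ~~ (l %| (2 : int))%Z by rewrite -Fp_int_eq0 Fp_two_neq0.
have e1 : 2%:R ^+ l.-1./2 = (-1) ^+ ((l %% 8 == 3) || (l %% 8 == 5))%N :> F.
  apply: (mulIf t0); rewrite -t2 -exprM mulnC muln2 -tl -exprSr; congr (_ ^+ _).
  by rewrite {2}l_half.
have neq1 : -1 != 1 :> F by rewrite eq_sym -subr_eq0 opprK.
rewrite nonresE // -[(2 : int)%:~R]/(2%:R) -natrX.
have p2 : (0 < 2 ^ l.-1./2)%N by rewrite expn_gt0.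
rewrite (natr_pchar_eq1 (pchar_Fp pl) p2) -(natr_pchar_eq1 cF p2).
by rewrite natrX e1; case: (_ || _); rewrite /= ?expr1 ?expr0 ?eqxx.
Qed.
End Residues.

Section GaussSum.
Variables (p l : nat) (pp : prime p) (op : odd p) (pl : prime l) (ol : odd l).
Hypotheses (npl : l != p) (p1 : (p %% 4 = 1)%N).
Variables (F : finFieldType) (z : F).
Hypotheses (cF : l \in [pchar F]) (hz : p.-primitive_root z).

Let Fp_val (x : 'F_p) : (nat_of_ord x)%:Z%:~R = x :> 'F_p.
Proof. exact: natr_Zp. Qed.

Let nonres_eq (m n : int) : m%:~R = n%:~R :> 'F_p -> nonres p m = nonres p n.
Proof. by rewrite /nonres => ->. Qed.

Definition residue_char (x : 'F_p) : F :=
  if x == 0 then 0 else (-1) ^+ nonres p (nat_of_ord x)%:Z.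
Local Notation chi := residue_char.

Definition add_char (x : 'F_p) : F := z ^+ nat_of_ord x.
Local Notation e := add_char.

Definition gauss_sum : F := \sum_x chi x * e x.

Let val_Ndvd (x : 'F_p) : x != 0 -> ~~ (p %| (nat_of_ord x)%:Z)%Z.
Proof. by move=> x0; rewrite -(Fp_int_eq0 pp) Fp_val. Qed.

Lemma residue_charM x y : chi (x * y) = chi x * chi y.
Proof.
rewrite /chi mulf_eq0; case: eqP => [_|/eqP x0] /=; first by rewrite mul0r.
case: eqP => [_|/eqP y0] /=; first by rewrite mulr0.
rewrite -signr_addb -(nonresM pp op) ?val_Ndvd //; congr ((-1) ^+ nat_of_bool _).
by apply: nonres_eq; rewrite intrM; exact: (etrans (Fp_val _) (esym (congr2 *%R (Fp_val x) (Fp_val y)))).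
Qed.

Lemma residue_char_int (m : int) : ~~ (p %| m)%Z -> chi m%:~R = (-1) ^+ nonres p m.
Proof.
move=> hm; rewrite /chi Fp_int_eq0 // (negbTE hm); congr ((-1) ^+ nat_of_bool _).
by apply: nonres_eq; rewrite Fp_val.
Qed.

Lemma residue_char_sqr x : x != 0 -> chi x ^+ 2 = 1.
Proof. by move=> x0; rewrite /chi (negbTE x0) sqrr_sign. Qed.

Let two_neq0 : 2%:R != 0 :> F.
Proof. by rewrite -(dvdn_pcharf cF) dvdn_prime2 //; apply: contraL ol => /eqP ->. Qed.

Lemma sum_residue_char : \sum_x chi x = 0.
Proof.
have [a na] : exists a : 'F_p, ~~ [exists t : 'F_p, t ^+ 2 == a].
  apply/existsP; rewrite -negb_forall; apply/negP => /forallP h.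
  pose r (a : 'F_p) := xchoose (existsP (h a)).
  have hr a : r a ^+ 2 = a by apply/eqP; exact: (xchooseP (existsP (h a))).
  have ri : injective r by move=> a b ab; rewrite -(hr a) ab hr.
  have [r' _ rK] := injF_bij ri.
  have : r (r' 1) = r (r' (-1)).
    by congr r; rewrite -[LHS]hr -[RHS]hr !rK sqrrN.
  rewrite !rK => /eqP; rewrite -subr_eq0 opprK; apply/negP.
  exact: Fp_two_neq0.
have a0 : a != 0.
  apply: contraNneq na => ->; apply/existsP; exists 0; by rewrite expr0n.
have ca : chi a = -1 by rewrite /chi (negbTE a0) /nonres Fp_val na.
have : \sum_x chi x = chi a * \sum_x chi x.
  rewrite mulr_sumr (reindex_inj (mulfI a0)) /=.
  by apply: eq_bigr => x _; rewrite residue_charM.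
rewrite ca mulN1r => /eqP; rewrite -subr_eq0 opprK -mulr2n -mulr_natl.
by rewrite mulf_eq0 (negbTE two_neq0) => /eqP.
Qed.

Lemma add_charD x y : e (x + y) = e x * e y.
Proof.
rewrite /e -exprD -[in RHS](expr_mod _ (prim_expr_order hz)) /=.
by congr (z ^+ (_ %% _)%N); exact: Fp_cast.
Qed.

Lemma sum_add_char a : \sum_x e (x * a) = if a == 0 then p%:R else 0.
Proof.
case: eqP => [->|/eqP a0].
  under eq_bigr => x _ do rewrite mulr0 /e expr0.
  by rewrite sumr_const card_Fp.
have -> : \sum_x e (x * a) = \sum_x e x by rewrite [RHS](reindex_inj (mulIf a0)).
have : \sum_x e x = e 1 * \sum_x e x.
  rewrite mulr_sumr (reindex_inj (addrI 1)) /=.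
  by apply: eq_bigr => x _; rewrite add_charD.
move/eqP; rewrite -subr_eq0 -{1}[\sum_x _]mul1r -mulrBl mulf_eq0 => /orP[|/eqP //].
rewrite subr_eq0 eq_sym /e -(prim_order_dvd hz) /= Fp_cast //.
by rewrite modn_small ?prime_gt1 // dvdn1; move: (prime_gt1 pp) => /gtn_eqF ->.
Qed.

Lemma gauss_sum_sqr : gauss_sum ^+ 2 = p%:R.
Proof.
have -> : gauss_sum ^+ 2 = \sum_x \sum_u chi u * e (x * (1 + u)).
  rewrite expr2 /gauss_sum mulr_suml; apply: eq_bigr => x _; rewrite mulr_sumr.
  have [->|x0] := eqVneq x 0.
    rewrite big1 => [|y _]; last by rewrite /chi eqxx !mul0r.
    under eq_bigr => u _ do rewrite mul0r /e expr0 mulr1.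
    by rewrite sum_residue_char.
  rewrite (reindex_inj (mulfI x0)) /=; apply: eq_bigr => u _.
  rewrite mulrDr mulr1 add_charD residue_charM.
  rewrite -[RHS]mul1r -(residue_char_sqr x0); ring.
rewrite exchange_big /=.
under eq_bigr => u _ do rewrite -mulr_sumr sum_add_char.
rewrite (bigD1 (-1)) //= subrr eqxx big1 ?addr0; last first.
  by move=> u hu; rewrite addrC -[1]opprK subr_eq0 (negbTE hu) mulr0.
have h1 : ~~ (p %| (-1 : int))%Z by rewrite dvdzE /= dvdn1; case: p pp => [|[]].
by rewrite -[-1]/((-1)%:~R) residue_char_int // nonresN1 // p1 mul1r.
Qed.

Lemma gauss_sum_Frobenius : gauss_sum ^+ l = (-1) ^+ nonres p l * gauss_sum.
Proof.
have lp : ~~ (p %| l%:Z)%Z by rewrite dvdzE /= dvdn_prime2 // eq_sym.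
rewrite -(pFrobenius_autE cF) rmorph_sum /= -residue_char_int //.
have l0 : l%:Z%:~R != 0 :> 'F_p by rewrite Fp_int_eq0.
rewrite [in RHS]/gauss_sum [in RHS](reindex_inj (mulfI l0)) mulr_sumr /=.
apply: eq_bigr => x _; rewrite pFrobenius_autE exprMn residue_charM !mulrA -expr2.
rewrite (residue_char_sqr l0) mul1r; congr (_ * _).
  rewrite /chi; case: eqP => _; first by rewrite expr0n; case: (l) pl.
  by case: (nonres _ _); rewrite /= ?expr0 ?expr1n // expr1 -signr_odd ol.
rewrite /e -exprM -[RHS](expr_mod _ (prim_expr_order hz)) -[LHS](expr_mod _ (prim_expr_order hz)).
congr (_ ^+ _).
have -> : l%:Z%:~R * x = (l * nat_of_ord x)%:R by rewrite natrM -[x in LHS]natr_Zp.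
by rewrite val_Fp_nat // modn_mod mulnC.
Qed.
End GaussSum.

(** Quadratic reciprocity: the square of the Gauss sum of [p] is [p], and the
    Frobenius of a field of characteristic [l] multiplies that sum by the
    quadratic character of [l] modulo [p]. *)
Lemma quadratic_reciprocity (p l : nat) : prime p -> odd p -> prime l -> odd l ->
  l != p -> (p %% 4 = 1)%N -> nonres p l = nonres l p.
Proof.
move=> pp op pl ol npl p1.
have hd : (p %| (l ^ p.-1).-1)%N.
  have l0 := prime_gt0 pl.
  have cop : coprime p l by rewrite prime_coprime // dvdn_prime2 // eq_sym.
  rewrite -(Gauss_dvdr _ cop) -subn1 mulnBr muln1 -expnS prednK ?prime_gt0 //.
  by rewrite -eqn_mod_dvd ?fermat_little // -{1}(expn1 l) leq_pexp2l ?prime_gt0.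
have [|F [z [cF hz]]] := @primitive_root_in_pchar l p.-1 p pl _ hd.
  by case: p pp {p1 op npl hd} => [|[]].
have g2 := gauss_sum_sqr pp op pl ol p1 cF hz.
have gl := gauss_sum_Frobenius pp op pl ol npl cF hz.
set g := gauss_sum p z in g2 gl.
have p0 : p%:R != 0 :> F by rewrite -(dvdn_pcharf cF) dvdn_prime2.
have g0 : g != 0 by apply: contraNneq p0 => h; rewrite -g2 h expr0n.
have lh : l = (l.-1./2.*2).+1 by move: ol; clear; lia.
have e1 : p%:R ^+ l.-1./2 = (-1) ^+ nonres p l :> F.
  by apply: (mulIf g0); rewrite -g2 -exprM mulnC muln2 -gl -exprSr; congr (_ ^+ _).
have two0 : 2%:R != 0 :> F.
  by rewrite -(dvdn_pcharf cF) dvdn_prime2 //; apply: contraL ol => /eqP ->.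
have neq1 : -1 != 1 :> F by rewrite eq_sym -subr_eq0 opprK.
have hpl : ~~ (l %| p%:Z)%Z by rewrite dvdzE /= dvdn_prime2.
rewrite [RHS]nonresE // -[p%:Z%:~R]/(p%:R) -natrX.
have pe0 : (0 < p ^ l.-1./2)%N by rewrite expn_gt0 prime_gt0.
rewrite (natr_pchar_eq1 (pchar_Fp pl) pe0) -(natr_pchar_eq1 cF pe0).
by rewrite natrX e1; case: (nonres p l); rewrite /= ?expr1 ?expr0 ?eqxx.
Qed.

Lemma prime_mul_ind (P : nat -> Prop) : P 1%N ->
  (forall l m, prime l -> (0 < m)%N -> P m -> P (l * m)%N) ->
  forall n, (0 < n)%N -> P n.
Proof.
move=> P1 PM n; elim/ltn_ind: n => n IH n0.
have [n1|n1] := leqP n 1; first by have -> : n = 1%N by apply/eqP; rewrite eqn_leq n1.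
have pp := pdiv_prime n1; have [m nm] := dvdnP (pdiv_dvd n).
have m0 : (0 < m)%N by case: m nm n0 => // ->.
rewrite nm mulnC; apply: PM => //; apply: IH => //.
by rewrite nm ltn_Pmulr // prime_gt1.
Qed.

(** The Jacobi symbol, in the additive convention of [nonres]. *)
Definition jacobi (D : int) (N : nat) : bool :=
  odd (\sum_(l <- primes N) logn l N * nonres l D).

Lemma jacobi_widen (D : int) (N B : nat) : (0 < N <= B)%N ->
  jacobi D N = odd (\sum_(0 <= l < B.+1) logn l N * nonres l D).
Proof.
move=> /andP[N0 NB]; rewrite /jacobi; congr odd.
have hp : perm_eq (primes N) [seq l <- index_iota 0 B.+1 | l \in primes N].
  apply: uniq_perm; rewrite ?primes_uniq ?filter_uniq ?iota_uniq // => l.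
  rewrite mem_filter mem_index_iota; case hl: (l \in _) => //=.
  move: hl; rewrite mem_primes => /and3P[_ _ /dvdn_leq-/(_ N0) h].
  by rewrite ltnS (leq_trans h).
rewrite (perm_big _ hp) big_filter big_mkcond /=; apply: eq_bigr => l _.
by case: ifP => // /negbT; rewrite -logn_gt0 -eqn0Ngt => /eqP ->.
Qed.

Lemma jacobi_mulr (D : int) (M N : nat) : (0 < M)%N -> (0 < N)%N ->
  jacobi D (M * N) = jacobi D M (+) jacobi D N.
Proof.
move=> M0 N0.
have hM : (0 < M <= M * N)%N by rewrite M0 leq_pmulr.
have hN : (0 < N <= M * N)%N by rewrite N0 leq_pmull.
have hMN : (0 < M * N <= M * N)%N by rewrite muln_gt0 M0 N0 /=.
rewrite (jacobi_widen D hM) (jacobi_widen D hN) (jacobi_widen D hMN).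
rewrite -oddD -big_split /=; congr odd.
by apply: eq_bigr => l _; rewrite lognM // mulnDl.
Qed.

Lemma jacobi1 (D : int) : jacobi D 1 = false.
Proof. by rewrite /jacobi big_nil. Qed.

Lemma jacobi_prime (D : int) (l : nat) : prime l -> jacobi D l = nonres l D.
Proof.
move=> pl; rewrite /jacobi primes_prime // big_seq1 logn_prime // eqxx mul1n.
by case: (nonres l D).
Qed.

Lemma jacobi_mull (D1 D2 : int) (N : nat) : (0 < N)%N -> odd N ->
  coprime `|D1| N -> coprime `|D2| N ->
  jacobi (D1 * D2) N = jacobi D1 N (+) jacobi D2 N.
Proof.
move=> N0 oN c1 c2; rewrite /jacobi -oddD -big_split /=.
rewrite !(big_morph odd oddD (erefl _)) !big_seq; apply: eq_bigr => l.
rewrite mem_primes => /and3P[pl _ lN].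
have ol : odd l by apply: dvdn_odd lN oN.
have hD D : coprime `|D| N -> ~~ (l %| D)%Z.
  move=> c; rewrite dvdzE -prime_coprime // coprime_sym.
  exact: coprime_dvdr lN c.
rewrite (nonresM pl ol) ?hD // oddD !oddM !oddb.
by case: (odd _); case: (nonres l D1); case: (nonres l D2).
Qed.

Lemma jacobi_eq_false (D : int) (N : nat) :
  (forall l, prime l -> (l %| N)%N -> odd (logn l N) -> nonres l D = false) ->
  jacobi D N = false.
Proof.
move=> h; rewrite /jacobi (big_morph odd oddD (erefl _)) big_seq.
apply: big1 => l; rewrite mem_primes => /and3P[pl _ lN].
rewrite oddM; case o: (odd (logn l N)) => //=.
by rewrite h.
Qed.

Lemma jacobi_reciprocity (p N : nat) : prime p -> (p %% 4 = 1)%N ->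
  (0 < N)%N -> odd N -> coprime p N -> nonres p N = jacobi p N.
Proof.
move=> pp p1 N0.
have op : odd p by move: p1; clear; lia.
elim/prime_mul_ind: N / N0 => [_ _|l m pl m0 IH].
  by rewrite jacobi1; apply: (nonres_sqr p 1).
rewrite oddM coprimeMr => /andP[ol om] /andP[cl cm].
have npl : l != p by apply: contraTneq cl => ->; rewrite prime_coprime // dvdnn.
have hd n : coprime p n -> ~~ (p %| n%:Z)%Z by rewrite dvdzE -prime_coprime.
rewrite PoszM nonresM ?hd // IH // jacobi_mulr ?(prime_gt0 pl) //.
rewrite (jacobi_prime _ pl).
by rewrite (quadratic_reciprocity pp op pl ol npl p1).
Qed.

Lemma jacobiN1 (N : nat) : (0 < N)%N -> odd N -> jacobi (-1) N = (N %% 4 == 3)%N.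
Proof.
move=> N0; elim/prime_mul_ind: N / N0 => [_|l m pl m0 IH]; first by rewrite jacobi1.
rewrite oddM => /andP[ol om].
rewrite jacobi_mulr ?(prime_gt0 pl) // (jacobi_prime _ pl) IH // nonresN1 //.
rewrite -(modnMml l) -(modnMmr _ m).
have : (l %% 4 < 4)%N by rewrite ltn_mod.
have : (m %% 4 < 4)%N by rewrite ltn_mod.
have : odd (l %% 4)%N by rewrite odd_mod.
have : odd (m %% 4)%N by rewrite odd_mod.
by case: (l %% 4)%N => [|[|[|[|r]]]]; case: (m %% 4)%N => [|[|[|[|s]]]].
Qed.

Lemma jacobi2 (N : nat) : (0 < N)%N -> odd N ->
  jacobi 2 N = ((N %% 8 == 3) || (N %% 8 == 5))%N.
Proof.
move=> N0; elim/prime_mul_ind: N / N0 => [_|l m pl m0 IH]; first by rewrite jacobi1.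
rewrite oddM => /andP[ol om].
rewrite jacobi_mulr ?(prime_gt0 pl) // (jacobi_prime _ pl) IH // nonres2 //.
rewrite -(modnMml l) -(modnMmr _ m).
have : (l %% 8 < 8)%N by rewrite ltn_mod.
have : (m %% 8 < 8)%N by rewrite ltn_mod.
have : odd (l %% 8)%N by rewrite odd_mod.
have : odd (m %% 8)%N by rewrite odd_mod.
by case: (l %% 8)%N => [|[|[|[|[|[|[|[|r]]]]]]]]; case: (m %% 8)%N => [|[|[|[|[|[|[|[|s]]]]]]]].
Qed.

Lemma nonresN (p : nat) (m : int) : prime p -> (p %% 4 = 1)%N -> ~~ (p %| m)%Z ->
  nonres p (- m) = nonres p m.
Proof.
move=> pp p1 pm; have op : odd p by move: p1; clear; lia.
rewrite -mulN1r nonresM //; first by rewrite nonresN1 ?p1.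
by rewrite dvdzE /= dvdn1; case: p pp {p1 pm op} => [|[]].
Qed.

Lemma nonres_abs (p : nat) (m : int) : prime p -> (p %% 4 = 1)%N -> ~~ (p %| m)%Z ->
  nonres p `|m|%N = nonres p m.
Proof. by move=> pp p1 pm; case: (intP m) pm => // n pm; rewrite abszN nonresN. Qed.

Lemma nonres_mod (p : nat) (m n : int) : prime p -> (p %| m - n)%Z ->
  nonres p m = nonres p n.
Proof.
move=> pp; rewrite -Fp_int_eq0 // rmorphB subr_eq0 => /eqP e.
by rewrite /nonres e.
Qed.

Lemma nonres_false_intro (p : nat) (m y : int) : prime p -> (p %| m - y ^+ 2)%Z ->
  nonres p m = false.
Proof. by move=> pp h; rewrite (nonres_mod pp h) nonres_sqr. Qed.

Lemma nonres_sqrM (p : nat) (m y : int) : prime p -> odd p -> ~~ (p %| m)%Z ->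
  ~~ (p %| y)%Z -> nonres p (m * y ^+ 2) = nonres p m.
Proof.
move=> pp op hm hy; rewrite nonresM ?nonres_sqr ?addbF // -Fp_int_eq0 // rmorphXn /=.
by rewrite expf_eq0 /= Fp_int_eq0.
Qed.

(** * Residue symbols of sums of two squares *)

Lemma odd_part (m : int) : m != 0 -> exists k N : nat,
  [/\ `|m|%N = (2 ^ k * N)%N, odd N & (0 < N)%N].
Proof.
rewrite -absz_gt0; move: (absz m) => n {m}.
elim/ltn_ind: n => n IH n0; case o: (odd n); first by exists 0%N, n; rewrite mul1n.
have h : (0 < n./2 < n)%N by move: n0 o; clear; lia.
case/andP: h => h1 h2.
have [k [N [e oN N0]]] := IH _ h2 h1.
exists k.+1, N; split=> //; rewrite expnS -mulnA -e.
by move: o; clear; lia.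
Qed.

Lemma nonres_pow2 (p k : nat) (N : int) : prime p -> (p %% 8 = 5)%N -> ~~ (p %| N)%Z ->
  nonres p ((2 ^ k)%N%:Z * N) = odd k (+) nonres p N.
Proof.
move=> pp p5 hN; have op : odd p by move: p5; clear; lia.
have h2 : ~~ (p %| 2)%N by rewrite dvdn_prime2 //; apply: contraTneq op => ->.
elim: k => [|k IH]; first by rewrite mul1r.
rewrite expnS PoszM -mulrA nonresM // ?IH.
  by rewrite nonres2 // p5 /=; case: (odd k); case: (nonres p N).
rewrite -Fp_int_eq0 // intrM mulf_eq0 negb_or !Fp_int_eq0 // hN andbT.
by apply: contra h2; rewrite dvdzE /= Euclid_dvdX // => /andP[].
Qed.

Lemma int_parity (a : int) :
  (exists m, a = 2 * m /\ odd `|a| = false) \/ (exists m, a = 2 * m + 1 /\ odd `|a|).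
Proof.
case: (intP a) => [|n|n].
- by left; exists 0.
- have [o|o] := boolP (odd n).
    by left; exists (n.+1./2)%:Z; move: o; clear; lia.
  by right; exists (n./2)%:Z; move: o; clear; lia.
have [o|o] := boolP (odd n).
  by left; exists (- (n.+1./2)%:Z); move: o; clear; lia.
by right; exists (- (n./2)%:Z - 1); move: o; clear; lia.
Qed.

Lemma odd_int (a : int) : odd `|a| -> exists m, a = 2 * m + 1.
Proof. by case: (int_parity a) => [] [m [h ->]] // _; exists m. Qed.

Lemma odd_sqr_mod8 (a : int) : odd `|a| -> exists m, a ^+ 2 = 8 * m + 1.
Proof.
case/odd_int => m ->; case: (int_parity m) => [] [n [-> _]].
  by exists (2 * n ^+ 2 + n); ring.
by exists (2 * n ^+ 2 + 3 * n + 1); ring.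
Qed.

Lemma odd_abs_int (m : int) : odd `|2 * m + 1|.
Proof. by case: (int_parity (2 * m + 1)) => [] [n [h ->]] //; move: h; clear; lia. Qed.

Lemma sum_two_sqr_mod8 (p : nat) (a b : int) : (p %% 8 = 5)%N ->
  p%:Z = a ^+ 2 + b ^+ 2 -> odd `|a| -> exists m, b = 2 * m /\ odd `|m|.
Proof.
move=> p5 pab /odd_sqr_mod8[j aj]; rewrite aj in pab.
have [k pk] : exists k : int, p%:Z = 8 * k + 5 by exists (p %/ 8)%N%:Z; move: p5; clear; lia.
case: (int_parity b) => [] [m [bm _]]; rewrite bm in pab; last first.
  by exfalso; move: pab; rewrite pk sqrrD expr1n mulr1 exprMn mulr2n; clear; lia.
exists m; split=> //; case: (int_parity m) => [] [n [mn om]] //.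
by exfalso; move: pab; rewrite pk mn !exprMn; clear; lia.
Qed.

Lemma sum_two_sqr_ndvd (q : nat) (c d : int) : prime q -> q%:Z = c ^+ 2 + d ^+ 2 ->
  ~~ (q %| d)%Z.
Proof.
move=> pq qcd; apply/negP => /dvdzP[m dm].
have : (q %| c ^+ 2)%Z.
  have -> : c ^+ 2 = q%:Z - d ^+ 2 by rewrite qcd addrK.
  apply: rpredB; first exact: dvdzz.
  by rewrite dm exprMn; apply: dvdz_mull; exact: dvdz_exp.
rewrite dvdzE abszX /= Euclid_dvdX // andbT => hc.
have /dvdzP[n cn] : (q %| c)%Z by rewrite dvdzE.
have : q%:Z * (1 - q%:Z * (m ^+ 2 + n ^+ 2)) == 0.
  by apply/eqP; rewrite mulrBr mulr1 {1}qcd dm cn; ring.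
rewrite mulf_eq0 => /orP[/eqP h|]; first by move: (prime_gt0 pq); move: h; clear; lia.
rewrite subr_eq0 => /eqP h.
have : (q %| (1 : int))%Z by rewrite h dvdz_mulr.
by rewrite dvdzE /= dvdn1; move: (prime_gt1 pq) => /gtn_eqF ->.
Qed.

Section TwoPrimes.
Variables p q : nat.
Hypotheses (pp : prime p) (pq : prime q) (p5 : (p %% 8 = 5)%N) (q5 : (q %% 8 = 5)%N).

Let op : odd p. Proof. by move: p5; clear; lia. Qed.
Let oq : odd q. Proof. by move: q5; clear; lia. Qed.
Let p4 : (p %% 4 = 1)%N. Proof. by move: p5; clear; lia. Qed.
Let q4 : (q %% 4 = 1)%N. Proof. by move: q5; clear; lia. Qed.

(** The quadratic characters of [p] and [q] agree on [m] as soon as [p * q] is a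
    square modulo the odd primes of [m]: this is reciprocity for [p * q], in
    which [-1] and [2] do not intervene because [p * q = 1] modulo [8]. *)
Lemma nonres_pq_eq (m : int) : ~~ (p %| m)%Z -> ~~ (q %| m)%Z ->
  (forall l, prime l -> odd l -> (l %| m)%Z -> odd (logn l `|m|) ->
     nonres l (p * q)%N = false) ->
  nonres p m = nonres q m.
Proof.
move=> pm qm hl.
have m0 : m != 0 by apply: contraNneq pm => ->; rewrite dvdz0.
have [k [N [mN oN N0]]] := odd_part m0.
rewrite -(nonres_abs pp p4 pm) -(nonres_abs pq q4 qm) mN PoszM.
move: pm qm; rewrite !dvdzE mN /= => pm qm.
have pN : ~~ (p %| N)%N by apply: contra pm => /dvdn_mull ->.
have qN : ~~ (q %| N)%N by apply: contra qm => /dvdn_mull ->.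
rewrite !nonres_pow2 //; congr (_ (+) _).
rewrite !jacobi_reciprocity ?prime_coprime //.
suff /eqP : jacobi p N (+) jacobi q N = false.
  by case: (jacobi p N); case: (jacobi q N).
rewrite -jacobi_mull ?prime_coprime //.
apply: jacobi_eq_false => l pl lN ol.
apply: hl => //; first exact: dvdn_odd lN oN.
  by rewrite dvdzE mN /= dvdn_mull.
rewrite mN lognM ?expn_gt0 // lognX.
have -> : logn l 2 = 0%N.
  rewrite logn_prime //; case: eqP => // l2.
  by move: (dvdn_odd lN oN); rewrite l2.
by rewrite muln0.
Qed.
End TwoPrimes.

(** [d] is twice an odd number, and [2] is a nonresidue; as [q] is a square modulo the primes
    of [d], reciprocity makes the odd factor a residue. *)
Lemma nonres_even_leg (q : nat) (c d : int) : prime q -> (q %% 8 = 5)%N ->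
  q%:Z = c ^+ 2 + d ^+ 2 -> odd `|c| -> nonres q d.
Proof.
move=> pq q5 qcd oc.
have oq : odd q by move: q5; clear; lia.
have q4 : (q %% 4 = 1)%N by move: q5; clear; lia.
have [d1 [dd1 od1]] := sum_two_sqr_mod8 q5 qcd oc.
have d10 : d1 != 0 by apply: contraTneq od1 => ->.
have qd := sum_two_sqr_ndvd pq qcd.
have qd1 : ~~ (q %| d1)%Z by apply: contra qd; rewrite dd1; apply: dvdz_mull.
have q2 : ~~ (q %| (2:int))%Z.
  by rewrite dvdzE /= dvdn_prime2 //; apply: contraTneq oq => ->.
rewrite dd1 nonresM // nonres2 // q5 /= -nonres_abs //.
rewrite jacobi_reciprocity ?absz_gt0 ?prime_coprime //.
rewrite jacobi_eq_false // => l pl ld _.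
apply: (@nonres_false_intro _ _ c) => //; rewrite qcd addrAC subrr add0r.
by rewrite exprS dvdz_mulr // dd1 dvdz_mull.
Qed.

Lemma nonres_falseP (p : nat) (m : int) : prime p -> nonres p m = false ->
  exists y : int, (p %| y ^+ 2 - m)%Z.
Proof.
move=> pp /negbFE/existsP[z /eqP hz]; exists (nat_of_ord z)%:Z.
rewrite -Fp_int_eq0 // rmorphB rmorphXn /= subr_eq0 -hz; apply/eqP; congr (_ ^+ 2).
exact: natr_Zp.
Qed.

Lemma prime_neq_coprime (p q : nat) : prime p -> prime q -> p != q -> coprime p q.
Proof. by move=> pp pq npq; rewrite prime_coprime // dvdn_prime2. Qed.

Lemma sqrt_mod_pq (p q : nat) (m : int) : prime p -> prime q -> p != q ->
  nonres p m = false -> nonres q m = false -> exists w : int, ((p * q)%N %| w ^+ 2 - m)%Z.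
Proof.
move=> pp pq npq /(nonres_falseP pp)[y hy] /(nonres_falseP pq)[z hz].
have cpq := prime_neq_coprime pp pq npq.
have [u [v huv]] := Bezoutz p q.
have {}huv : u * p%:Z + v * q%:Z = 1 by rewrite huv; apply/eqP.
exists (z * (u * p%:Z) + y * (v * q%:Z)).
apply: coprime_dvdz_mul => //.
  rewrite (_ : _ - m = (y ^+ 2 - m) + p%:Z * (u * (z - y) * (z * (u * p%:Z) + y * (v * q%:Z) + y))); last first.
    have -> : v * q%:Z = 1 - u * p%:Z by rewrite -huv addrAC subrr add0r.
    ring.
  by apply: rpredD => //; apply: dvdz_mulr.
rewrite (_ : _ - m = (z ^+ 2 - m) + q%:Z * (v * (y - z) * (z * (u * p%:Z) + y * (v * q%:Z) + z))); last first.
  have -> : u * p%:Z = 1 - v * q%:Z by rewrite -huv addrK.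
  ring.
by apply: rpredD => //; apply: dvdz_mulr.
Qed.

Lemma dvdz_subr (l m n : int) : (l %| n)%Z -> (l %| m - n)%Z = (l %| m)%Z.
Proof. exact: rpredBr. Qed.

Lemma dvdz_subl (l m n : int) : (l %| m)%Z -> (l %| m - n)%Z = (l %| n)%Z.
Proof. exact: rpredBl. Qed.

Section FResidue.
Variables (p q : nat) (a b c d : int).
Hypotheses (pp : prime p) (pq : prime q) (p5 : (p %% 8 = 5)%N) (q5 : (q %% 8 = 5)%N).
Hypotheses (hpq : nonres q p) (pab : p%:Z = a ^+ 2 + b ^+ 2) (qcd : q%:Z = c ^+ 2 + d ^+ 2).
Hypotheses (oa : odd `|a|) (oc : odd `|c|).
Hypothesis hres : nonres q (d * (a * d - b * c)) = false.

Let op : odd p. Proof. by move: p5; clear; lia. Qed.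
Let oq : odd q. Proof. by move: q5; clear; lia. Qed.

Lemma p_neq_q : p != q.
Proof.
apply: contraTneq hpq => ->; rewrite (@nonres_false_intro q q 0) //.
by rewrite expr0n subr0.
Qed.

Let npq : ~~ (p %| q)%N. Proof. by rewrite dvdn_prime2 // p_neq_q. Qed.
Let nqp : ~~ (q %| p)%N. Proof. by rewrite dvdn_prime2 // eq_sym p_neq_q. Qed.

Lemma norm_product : (a * c - b * d) ^+ 2 + (a * d + b * c) ^+ 2 = (p * q)%N%:Z.
Proof. by rewrite PoszM pab qcd; ring. Qed.

Let key : (a * d + b * c) * (a * d - b * c) = p%:Z * d ^+ 2 - q%:Z * b ^+ 2.
Proof. by rewrite pab qcd; ring. Qed.

Lemma prime_dvdzM (l : nat) (m n : int) : prime l ->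
  (l %| m * n)%Z = (l %| m)%Z || (l %| n)%Z.
Proof. by move=> pl; rewrite !dvdzE abszM Euclid_dvdM. Qed.

Lemma prime_dvdz_sqr (l : nat) (m : int) : prime l -> (l %| m ^+ 2)%Z = (l %| m)%Z.
Proof. by move=> pl; rewrite expr2 prime_dvdzM // orbb. Qed.

Lemma q_ndvd_fg : ~~ (q %| (a * d + b * c) * (a * d - b * c))%Z.
Proof.
rewrite key (dvdz_subr _ (dvdz_mulr _ (dvdzz _))).
rewrite prime_dvdzM // prime_dvdz_sqr // negb_or (sum_two_sqr_ndvd pq qcd) andbT.
by rewrite dvdzE.
Qed.

Lemma p_ndvd_f : ~~ (p %| a * d + b * c)%Z.
Proof.
apply/negP => /(dvdz_mulr (a * d - b * c)); rewrite key.
rewrite (dvdz_subl _ (dvdz_mulr _ (dvdzz _))) prime_dvdzM // prime_dvdz_sqr //.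
by rewrite (negbTE (sum_two_sqr_ndvd pp pab)) orbF dvdzE; apply/negP.
Qed.

Lemma q_ndvd_f : ~~ (q %| a * d + b * c)%Z.
Proof. by apply: contra q_ndvd_fg => h; apply: dvdz_mulr. Qed.

(** Modulo [q] the product of [d * (a * d + b * c)] and [d * (a * d - b * c)] is [p] times a
    fourth power, hence a nonresidue, and so is [d]. *)
Lemma nonres_q_f : nonres q (a * d + b * c) = false.
Proof.
have qd := sum_two_sqr_ndvd pq qcd.
have := q_ndvd_fg; rewrite prime_dvdzM // negb_or => /andP[qf qg].
have qp : ~~ (q %| p%:Z)%Z by rewrite dvdzE.
have h : nonres q (d ^+ 2 * ((a * d + b * c) * (a * d - b * c))) = true.
  rewrite key (@nonres_mod q _ (p%:Z * (d ^+ 2) ^+ 2)) //; last first.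
    rewrite (_ : _ - _ = q%:Z * (- (d ^+ 2 * b ^+ 2))); last by ring.
    exact: dvdz_mulr.
  by rewrite nonres_sqrM // prime_dvdz_sqr.
have := nonresM pq oq (_ : ~~ (q %| d * (a * d + b * c))%Z) (_ : ~~ (q %| d * (a * d - b * c))%Z).
rewrite !prime_dvdzM // !negb_or qd qf qg => /(_ isT isT).
rewrite (_ : d * _ * _ = d ^+ 2 * ((a * d + b * c) * (a * d - b * c))); last by ring.
rewrite h hres addbF nonresM // (nonres_even_leg pq q5 qcd oc).
by case: (nonres q _).
Qed.

(** [p * q] is a sum of [(a * d + b * c) ^ 2] and a square, hence a square modulo the primes
    of [a * d + b * c]. *)
Lemma nonres_p_f : nonres p (a * d + b * c) = false.
Proof.
rewrite (nonres_pq_eq pp pq p5 q5 p_ndvd_f q_ndvd_f) ?nonres_q_f // => l pl ol lf _.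
apply: (@nonres_false_intro _ _ (a * c - b * d)) => //.
by rewrite -norm_product addrAC subrr add0r dvdz_exp.
Qed.
End FResidue.

(** * A rational point on the conic *)

Lemma dvdz_sqr_sqr (g t : int) : (g ^+ 2 %| t ^+ 2)%Z = (g %| t)%Z.
Proof. exact: dvdz_pexp2r. Qed.

Lemma nonsquare_prime_mul (p m : nat) : prime p -> ~~ (p %| m)%N ->
  forall n, (n ^ 2)%N != (p * m)%N.
Proof.
move=> pp pm n; apply/eqP => h.
have pn : (p %| n)%N.
  have : (p %| n ^ 2)%N by rewrite h dvdn_mulr.
  by rewrite Euclid_dvdX // andbT.
case/negP: pm; have [k nk] := dvdnP pn.
have : (p * (k ^ 2 * p) = p * m)%N by rewrite -h nk expnMn mulnCA mulnn.
by move/eqP; rewrite eqn_pmul2l ?prime_gt0 // => /eqP <-; rewrite dvdn_mull.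
Qed.

Section Conic.
Variables (p q : nat) (e f1 : int).
Hypotheses (pp : prime p) (pq : prime q) (p4 : (p %% 4 = 1)%N) (q4 : (q %% 4 = 1)%N).
Hypotheses (npq : p != q) (oe : odd `|e|).
Let f : int := 4 * f1.
Hypotheses (hef : e ^+ 2 + f ^+ 2 = (p * q)%N%:Z).
Hypotheses (pf : ~~ (p %| f)%Z) (qf : ~~ (q %| f)%Z).
Hypotheses (rpf : nonres p f = false) (rqf : nonres q f = false).

Let f0 : f != 0. Proof. by apply: contraNneq pf => ->; rewrite dvdz0. Qed.

Let nonsq_pq : forall n, (n ^ 2)%N != (p * q)%N.
Proof. by apply: nonsquare_prime_mul => //; rewrite dvdn_prime2. Qed.

(** Legendre's theorem for the conic [X ^ 2 + |f| T ^ 2 = p q Y ^ 2]; when [|f|] is a square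
    the point is given by [e ^ 2 + f ^ 2 = p * q]. *)
Lemma conic_norm : exists X T Y : int, ((X != 0) || (Y != 0)) /\
  X ^+ 2 + `|f| * T ^+ 2 = (p * q)%N%:Z * Y ^+ 2.
Proof.
have [sq|nsq] := boolP [exists s : 'I_(`|f|%N).+1, (s ^ 2)%N == `|f|%N].
  case/existsP: sq => s /eqP hs; exists e, (nat_of_ord s)%:Z, 1; rewrite orbT; split=> //.
  by rewrite -PoszX hs -hef abszE expr1n mulr1 -expr2 real_normK ?num_real.
have fN0 : (0 < `|f|)%N by rewrite absz_gt0.
have cpqf : coprime (p * q) `|f|.
  rewrite coprimeMl !prime_coprime //.
  by apply/andP; split; [move: pf | move: qf]; rewrite dvdzE.
have rN l : prime l -> (l %% 4 = 1)%N -> ~~ (l %| f)%Z -> nonres l f = false ->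
    nonres l (- `|f|%N%:Z) = false.
  by move=> pl l4 lf rf; rewrite nonresN // nonres_abs.
have [w hw] := sqrt_mod_pq pp pq npq (rN p pp p4 pf rpf) (rN q pq q4 qf rqf).
rewrite opprK in hw.
have pq0 : (0 < p * q)%N by rewrite muln_gt0 !prime_gt0.
have hb : (`|f|%N %| e ^+ 2 - 1%N%:Z * (p * q)%N%:Z)%Z.
  have -> : e ^+ 2 - 1%N%:Z * (p * q)%N%:Z = - (f ^+ 2) by rewrite -hef; ring.
  by rewrite dvdzE abszN abszX /= dvdn_exp.
have hc : ((p * q)%N %| w ^+ 2 + 1%N%:Z * `|f|%N%:Z)%Z by rewrite mul1r.
have n1 : forall n, (n ^ 2)%N != (1 * `|f|)%N.
  move=> n; rewrite mul1n; apply: contra nsq => /eqP h; apply/existsP.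
  have hn : (n < `|f|.+1)%N by rewrite ltnS -h -mulnn; case: (n) => // m; rewrite leq_pmull.
  by exists (Ordinal hn); rewrite /= h.
have n2 : forall n, (n ^ 2)%N != (`|f| * (p * q))%N.
  move=> n; rewrite mulnCA; apply: nonsquare_prime_mul => //.
  by rewrite Euclid_dvdM // negb_or (dvdn_prime2 pp pq) npq andbT; move: pf; rewrite dvdzE.
have c2 : coprime `|f| (p * q) by rewrite coprime_sym.
have ha : (1%N %| (0:int) ^+ 2 - `|f|%N%:Z * (p * q)%N%:Z)%Z by exact: dvd1z.
have [x [y [z [h1 h2]]]] :=
  legendre_conic (isT : (0 < 1)%N) fN0 pq0 (coprime1n _) c2 (coprime1n _) ha hb hc n1 n2.
exists x, y, z; rewrite mul1r abszE in h2; split=> //.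
apply: contraTT h1; rewrite !negb_or !negbK => /andP[/eqP x0 /eqP z0].
move: h2; rewrite x0 z0 expr0n /= mulr0 add0r => /eqP.
by rewrite mulf_eq0 normr_eq0 (negbTE f0) /= sqrf_eq0 => ->; rewrite eqxx.
Qed.

(** With [p * q = (e + f i) (e - f i)], the conic says that the imaginary part of
    [(e + f i) (x + y i) ^ 2] is a square up to sign. *)
Lemma conic_quadratic_form : exists x y t s : int,
  [/\ (x != 0) || (y != 0), s = 1 \/ s = -1
    & f * (x ^+ 2 - y ^+ 2) + 2 * e * x * y = s * t ^+ 2].
Proof.
have [X [T [Y [h0 h]]]] := conic_norm.
have [s s1 fs] : exists2 s : int, s = 1 \/ s = -1 & `|f| = s * f.
  have [f_ge0|f_lt0] := ger0P f; first by exists 1; [left | rewrite mul1r].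
  by exists (-1); [right | rewrite mulN1r].
exists (X - e * Y), (f * Y), (f * T), (- s); split.
- case: (eqVneq Y 0) h0 => [->|Y0 _]; last by rewrite mulf_neq0 ?orbT.
  by rewrite orbF mulr0 subr0 => ->.
- by case: s1 => ->; [right | left; rewrite opprK].
have -> : f * ((X - e * Y) ^+ 2 - (f * Y) ^+ 2) + 2 * e * (X - e * Y) * (f * Y) =
    f * (X ^+ 2 - (e ^+ 2 + f ^+ 2) * Y ^+ 2) by ring.
by rewrite hef -h fs; ring.
Qed.

Lemma conic_primitive : exists x y t s : int,
  [/\ coprimez x y, s = 1 \/ s = -1
    & f * (x ^+ 2 - y ^+ 2) + 2 * e * x * y = s * t ^+ 2].
Proof.
have [x [y [t [s [h0 s1 h]]]]] := conic_quadratic_form.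
pose g := gcdz x y.
have g0 : g != 0 by rewrite gcdz_eq0 negb_and.
have /dvdzP[x1 xg] := dvdz_gcdl x y; have /dvdzP[y1 yg] := dvdz_gcdr x y.
rewrite -/g in xg yg.
have ss : s * s = 1 by case: s1 => ->.
have [t1 tg] : exists t1, t = t1 * g.
  apply/dvdzP; rewrite -dvdz_sqr_sqr.
  have -> : t ^+ 2 = s * (s * t ^+ 2) by rewrite mulrA ss mul1r.
  apply: dvdz_mull; rewrite -h xg yg.
  apply/dvdzP; exists (f * (x1 ^+ 2 - y1 ^+ 2) + 2 * e * x1 * y1); ring.
exists x1, y1, t1, s; split=> //.
  have : g * gcdz x1 y1 = g.
    rewrite -[in g * _](gez0_abs (_ : 0 <= g)) // mulz_gcdr ![g * _]mulrC -xg -yg //.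
  by move/eqP; rewrite -{2}[g]mulr1 (inj_eq (mulfI g0)).
have g20 : g ^+ 2 != 0 by rewrite expf_neq0.
apply: (mulfI g20); rewrite (_ : g ^+ 2 * (s * _) = s * t ^+ 2); last by rewrite tg; ring.
by rewrite -h xg yg; ring.
Qed.

(** In a primitive solution one of the coordinates is even; multiplying [x + y i] by [i]
    makes it the second one. *)
Lemma conic_solution : exists x y t s : int,
  [/\ odd `|x|, coprimez x (2 * y), s = 1 \/ s = -1
    & s * t ^+ 2 = f1 * (x ^+ 2 - 4 * y ^+ 2) + e * x * y].
Proof.
have base x y t s : coprimez x y -> odd `|x| -> s = 1 \/ s = -1 ->
    f * (x ^+ 2 - y ^+ 2) + 2 * e * x * y = s * t ^+ 2 ->
  exists x y t s : int, [/\ odd `|x|, coprimez x (2 * y), s = 1 \/ s = -1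
    & s * t ^+ 2 = f1 * (x ^+ 2 - 4 * y ^+ 2) + e * x * y].
  move=> cxy ox s1 h.
  have [e1 ee] := odd_int oe; have [x1 xx] := odd_int ox.
  case: (int_parity t) => [] [t1 [tt _]]; last first.
    exfalso; move: h; rewrite tt /f ee xx; case: s1 => ->; clear; lia.
  case: (int_parity y) => [] [y1 [yy _]]; last first.
    exfalso; move: h; rewrite tt /f ee xx yy; case: s1 => ->; clear; lia.
  exists x, y1, t1, s; split=> //; first by rewrite -yy.
  have four : (4 : int) != 0 by [].
  apply: (mulfI four); rewrite (_ : 4 * (s * _) = s * t ^+ 2); last by rewrite tt; ring.
  by rewrite -h yy /f; ring.
have [x [y [t [s [cxy s1 h]]]]] := conic_primitive.
have [ox|nox] := boolP (odd `|x|); first exact: base cxy ox s1 h.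
apply: (@base (- y) x t (- s)).
- by rewrite coprimeNz coprimez_sym.
- rewrite abszN; apply: contraT => noy.
  have : (2 %| gcdn `|x| `|y|)%N by rewrite dvdn_gcd !dvdn2 nox.
  by move: cxy; rewrite coprimezE => /eqP ->.
- by case: s1 => ->; [right | left; rewrite opprK].
- by rewrite mulNr -h; ring.
Qed.
End Conic.

(** * Genus theory of Q(sqrt (-p q)) *)

Lemma coprimez_primeP (x y : int) :
  (forall l, prime l -> (l %| x)%Z -> (l %| y)%Z -> False) -> coprimez x y.
Proof.
move=> h; rewrite coprimezE /coprime; apply: contraT => g1.
have [l pl hl] : exists2 l, prime l & (l %| gcdn `|x| `|y|)%N.
  case: (gcdn _ _) g1 => [|[|n]] // _; first by exists 2.
  by exists (pdiv n.+2); rewrite ?pdiv_prime ?pdiv_dvd.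
by move: hl; rewrite dvdn_gcd => /andP[h1 h2]; case: (h l pl).
Qed.

Lemma nonres_ndvd (l : nat) (m : int) : prime l -> nonres l m -> ~~ (l %| m)%Z.
Proof.
move=> pl; apply: contraL => lm.
by rewrite (@nonres_false_intro l m 0) // expr0n subr0.
Qed.

(** A prime modulo which [D] is a nonresidue is inert: it divides [u ^ 2 - D * v ^ 2] only
    if it divides [u] and [v]. *)
Lemma norm_form_even_val (l : nat) (D u v : int) : prime l -> odd l -> nonres l D ->
  u ^+ 2 - D * v ^+ 2 != 0 -> ~~ odd (logn l (absz (u ^+ 2 - D * v ^+ 2)%R)).
Proof.
move=> pl ol rD.
have lD := nonres_ndvd pl rD.
have [k] : exists k, (absz (u ^+ 2 - D * v ^+ 2)%R <= k)%N by eexists.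
elim: k u v => [|k IH] u v hk N0.
  by move: N0; rewrite -absz_eq0 -leqn0 hk.
have [lN|lN] := boolP (l %| u ^+ 2 - D * v ^+ 2)%Z; last first.
  move: lN; rewrite dvdzE => lN; have -> // : logn l (absz (u ^+ 2 - D * v ^+ 2)%R) = 0%N.
  by rewrite lognE pl absz_gt0 N0 /= (negbTE lN).
have lv : (l %| v)%Z.
  apply: contraT => lv; move: rD.
  rewrite -(nonres_sqrM pl ol lD lv) (@nonres_mod _ _ (u ^+ 2)) ?nonres_sqr //.
  by rewrite -opprB rpredN.
have lu : (l %| u)%Z.
  rewrite -(prime_dvdz_sqr _ pl) -(subrK (D * v ^+ 2) (u ^+ 2)).
  by apply: rpredD => //; apply: dvdz_mull; rewrite prime_dvdz_sqr.
have /dvdzP[u1 uu] := lu; have /dvdzP[v1 vv] := lv.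
have e : u ^+ 2 - D * v ^+ 2 = l%:Z ^+ 2 * (u1 ^+ 2 - D * v1 ^+ 2) by rewrite uu vv; ring.
have N1 : u1 ^+ 2 - D * v1 ^+ 2 != 0.
  by apply: contraNneq N0 => h; rewrite e h mulr0.
have el : absz (u ^+ 2 - D * v ^+ 2)%R = (l ^ 2 * absz (u1 ^+ 2 - D * v1 ^+ 2)%R)%N.
  by rewrite e abszM abszX.
have l20 : (0 < l ^ 2)%N by rewrite expn_gt0 prime_gt0.
rewrite el lognM ?absz_gt0 // lognX oddD oddM /=; apply: IH => //.
rewrite -ltnS; apply: leq_trans hk; rewrite el ltn_Pmull ?absz_gt0 //.
by rewrite -(exp1n 2) ltn_exp2r // prime_gt1.
Qed.

Section GenusConic.
Variables (p q : nat) (a b c d : int).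
Hypotheses (pp : prime p) (pq : prime q) (p5 : (p %% 8 = 5)%N) (q5 : (q %% 8 = 5)%N).
Hypotheses (hpq : nonres q p) (pab : p%:Z = a ^+ 2 + b ^+ 2) (qcd : q%:Z = c ^+ 2 + d ^+ 2).
Hypotheses (oa : odd `|a|) (oc : odd `|c|).
Hypothesis hres : nonres q (d * (a * d - b * c)) = false.

Let op : odd p. Proof. by move: p5; clear; lia. Qed.
Let oq : odd q. Proof. by move: q5; clear; lia. Qed.
Let p4 : (p %% 4 = 1)%N. Proof. by move: p5; clear; lia. Qed.
Let q4 : (q %% 4 = 1)%N. Proof. by move: q5; clear; lia. Qed.
Let npq : p != q. Proof. exact: p_neq_q hpq. Qed.
Let npq' : ~~ (p %| q%:Z)%Z. Proof. by rewrite dvdzE /= dvdn_prime2. Qed.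
Let nqp' : ~~ (q %| p%:Z)%Z. Proof. by rewrite dvdzE /= dvdn_prime2 // eq_sym. Qed.
Let p2 : ~~ (p %| (2:int))%Z.
Proof. by rewrite dvdzE /= dvdn_prime2 //; apply: contraTneq op => ->. Qed.
Let q2 : ~~ (q %| (2:int))%Z.
Proof. by rewrite dvdzE /= dvdn_prime2 //; apply: contraTneq oq => ->. Qed.

(** The conic says that the class of norm [2 * p] is a square. Legendre's conditions hold since
    modulo [p] both [2] and [q] are nonresidues, and modulo [q] both [2] and [p]. *)
Lemma genus_conic_exists : exists X Y n : int, [|| X != 0, Y != 0 | n != 0] /\
  p%:Z * X ^+ 2 + q%:Z * Y ^+ 2 = 2%N%:Z * n ^+ 2.
Proof.
have hqp : nonres p q.
  by rewrite (quadratic_reciprocity pp op pq oq) // eq_sym.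
have [u hu] : exists u : int, (p %| u ^+ 2 - q%:Z * 2%N%:Z)%Z.
  by apply: nonres_falseP => //; rewrite nonresM // hqp nonres2 // p5.
have [v hv] : exists u : int, (q %| u ^+ 2 - p%:Z * 2%N%:Z)%Z.
  by apply: nonres_falseP => //; rewrite nonresM // hpq nonres2 // q5.
have hw : (2%N %| (1:int) ^+ 2 + p%:Z * q%:Z)%Z.
  by rewrite expr1n -PoszM -PoszD dvdzE /= dvdn2 oddD oddM op oq.
apply: (legendre_conic (prime_gt0 pp) (prime_gt0 pq) (isT : 0 < 2)%N) hu hv hw _ _.
- exact: prime_neq_coprime.
- by rewrite coprimen2.
- by rewrite coprimen2.
- by apply: nonsquare_prime_mul => //; rewrite dvdn_prime2.
- by apply: nonsquare_prime_mul => //; rewrite dvdn_prime2 //; apply: contraTneq oq => ->.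
Qed.

Lemma dvdz_sqr_of_mul (l : nat) (m n : int) : prime l ->
  (l %| m)%Z = false -> (l%:Z ^+ 2 %| m * n ^+ 2)%Z -> (l %| n)%Z.
Proof.
move=> pl lm h; have : (l %| m * n ^+ 2)%Z.
  by apply: dvdz_trans h; rewrite expr2 dvdz_mulr.
by rewrite prime_dvdzM // lm prime_dvdz_sqr.
Qed.

Lemma genus_conic_primitive : exists X Y n : int,
  [/\ p%:Z * X ^+ 2 + q%:Z * Y ^+ 2 = 2 * n ^+ 2,
      coprimez X Y, coprimez X n & coprimez Y n].
Proof.
have [X0 [Y0 [n0 [h0 h]]]] := genus_conic_exists.
pose g := gcdz X0 (gcdz Y0 n0).
have g0 : g != 0 by rewrite !gcdz_eq0 !negb_and.
have gX : (g %| X0)%Z by apply: dvdz_gcdl.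
have gYn : (g %| gcdz Y0 n0)%Z by apply: dvdz_gcdr.
have gY : (g %| Y0)%Z by apply: dvdz_trans gYn (dvdz_gcdl _ _).
have gn : (g %| n0)%Z by apply: dvdz_trans gYn (dvdz_gcdr _ _).
have /dvdzP[X XX] := gX; have /dvdzP[Y YY] := gY; have /dvdzP[n nn] := gn.
have {}h : p%:Z * X ^+ 2 + q%:Z * Y ^+ 2 = 2 * n ^+ 2.
  have g20 : g ^+ 2 != 0 by rewrite expf_neq0.
  apply: (mulfI g20); transitivity (p%:Z * X0 ^+ 2 + q%:Z * Y0 ^+ 2).
    by rewrite XX YY; ring.
  have {}h : p%:Z * X0 ^+ 2 + q%:Z * Y0 ^+ 2 = 2 * n0 ^+ 2 by exact: h.
  by rewrite h nn; ring.
have nog l : prime l -> (l %| X)%Z -> (l %| Y)%Z -> (l %| n)%Z -> False.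
  move=> pl /dvdzP[X1 X1e] /dvdzP[Y1 Y1e] /dvdzP[n1 n1e].
  have : (l%:Z * g %| g)%Z.
    change (l%:Z * g %| gcdz X0 (gcdz Y0 n0))%Z; rewrite !dvdz_gcd; apply/and3P.
    split; apply/dvdzP; [exists X1 | exists Y1 | exists n1]; rewrite mulrA.
    - by rewrite -X1e -XX.
    - by rewrite -Y1e -YY.
    - by rewrite -n1e -nn.
  rewrite -[X in (_ %| X)%Z]mul1r dvdz_mul2r // dvdzE /= dvdn1.
  by move: (prime_gt1 pl) => /gtn_eqF ->.
have sq l m : prime l -> (l %| m)%Z -> (l%:Z ^+ 2 %| m ^+ 2)%Z.
  by move=> _ lm; rewrite dvdz_sqr_sqr.
have hc l1 l2 : prime l1 -> prime l2 -> (l1 != l2)%N -> (l1 %| l2%:Z)%Z = false.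
  by move=> p1 p2' ne; rewrite dvdzE /= dvdn_prime2 //; apply: negbTE.
exists X, Y, n; split=> //; apply: coprimez_primeP => l pl l1 l2; apply: (nog l) => //.
- have h2 : (l%:Z ^+ 2 %| 2 * n ^+ 2)%Z.
    by rewrite -h; apply: rpredD; apply: dvdz_mull; apply: sq.
  have [l2e|ln2] := eqVneq l 2%N; last exact: dvdz_sqr_of_mul (hc _ _ pl _ ln2) h2.
  by move: h2; rewrite l2e expr2 dvdz_mul2l // (prime_dvdz_sqr n (isT : prime 2)).
- have h2 : (l%:Z ^+ 2 %| q%:Z * Y ^+ 2)%Z.
    rewrite (_ : _ * _ = 2 * n ^+ 2 - p%:Z * X ^+ 2); last by rewrite -h addrAC subrr add0r.
    by apply: rpredB; apply: dvdz_mull; apply: sq.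
  have [l2e|ln2] := eqVneq l q; last exact: dvdz_sqr_of_mul (hc _ _ pl pq ln2) h2.
  move: h2; rewrite l2e expr2 dvdz_mul2l; last by rewrite -l2e -lt0n prime_gt0.
  by rewrite prime_dvdz_sqr.
- have h2 : (l%:Z ^+ 2 %| p%:Z * X ^+ 2)%Z.
    rewrite (_ : _ * _ = 2 * n ^+ 2 - q%:Z * Y ^+ 2); last by rewrite -h addrK.
    by apply: rpredB; apply: dvdz_mull; apply: sq.
  have [l2e|ln2] := eqVneq l p; last exact: dvdz_sqr_of_mul (hc _ _ pl pp ln2) h2.
  move: h2; rewrite l2e expr2 dvdz_mul2l; last by rewrite -l2e -lt0n prime_gt0.
  by rewrite prime_dvdz_sqr.
Qed.
End GenusConic.

Section GenusReciprocity.
Variables (p q : nat) (a b c d : int).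
Hypotheses (pp : prime p) (pq : prime q) (p5 : (p %% 8 = 5)%N) (q5 : (q %% 8 = 5)%N).
Hypotheses (hpq : nonres q p) (pab : p%:Z = a ^+ 2 + b ^+ 2) (qcd : q%:Z = c ^+ 2 + d ^+ 2).
Hypotheses (oa : odd `|a|) (oc : odd `|c|).
Hypothesis hres : nonres q (d * (a * d - b * c)) = false.

Let op : odd p. Proof. by move: p5; clear; lia. Qed.
Let oq : odd q. Proof. by move: q5; clear; lia. Qed.
Let p4 : (p %% 4 = 1)%N. Proof. by move: p5; clear; lia. Qed.
Let q4 : (q %% 4 = 1)%N. Proof. by move: q5; clear; lia. Qed.
Let npq : p != q. Proof. exact: p_neq_q hpq. Qed.
Let npq' : (p %| q%:Z)%Z = false.
Proof. by rewrite dvdzE /= dvdn_prime2 //; apply/negbTE. Qed.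
Let nqp' : (q %| p%:Z)%Z = false.
Proof. by rewrite dvdzE /= dvdn_prime2 // eq_sym; apply/negbTE. Qed.
Let p2 : (p %| (2:int))%Z = false.
Proof. by rewrite dvdzE /= dvdn_prime2 //; apply/negbTE; apply: contraTneq op => ->. Qed.
Let q2 : (q %| (2:int))%Z = false.
Proof. by rewrite dvdzE /= dvdn_prime2 //; apply/negbTE; apply: contraTneq oq => ->. Qed.

Lemma coprimez_prime (l : nat) (x y : int) : prime l -> coprimez x y ->
  (l %| x)%Z -> (l %| y)%Z = false.
Proof.
move=> pl cxy lx; apply/negP => ly.
have : (l %| gcdz x y)%Z by rewrite dvdz_gcd lx.
by rewrite (eqP cxy) dvdzE /= dvdn1; move: (prime_gt1 pl) => /gtn_eqF ->.
Qed.

Section Solution.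
Variables X Y n : int.
Hypotheses (h : p%:Z * X ^+ 2 + q%:Z * Y ^+ 2 = 2 * n ^+ 2).
Hypotheses (cXY : coprimez X Y) (cXn : coprimez X n) (cYn : coprimez Y n).

Lemma genus_conic_p_ndvd_Y : (p %| Y)%Z = false.
Proof.
apply/negP => pY; have := coprimez_prime pp cYn pY.
suff -> : (p %| n)%Z by [].
have : (p %| 2 * n ^+ 2)%Z.
  by rewrite -h; apply: rpredD; [exact/dvdz_mulr/dvdzz | apply: dvdz_mull; rewrite prime_dvdz_sqr].
by rewrite prime_dvdzM // p2 prime_dvdz_sqr.
Qed.

Lemma genus_conic_q_ndvd_X : (q %| X)%Z = false.
Proof.
apply/negP => qX; have := coprimez_prime pq cXn qX.
suff -> : (q %| n)%Z by [].
have : (q %| 2 * n ^+ 2)%Z.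
  by rewrite -h; apply: rpredD; [apply: dvdz_mull; rewrite prime_dvdz_sqr | exact/dvdz_mulr/dvdzz].
by rewrite prime_dvdzM // q2 prime_dvdz_sqr.
Qed.

Lemma genus_conic_p_ndvd_n : (p %| n)%Z = false.
Proof.
apply/negP => pn; have := genus_conic_p_ndvd_Y.
have : (p %| q%:Z * Y ^+ 2)%Z.
  rewrite (_ : _ * _ = 2 * n ^+ 2 - p%:Z * X ^+ 2); last by rewrite -h addrAC subrr add0r.
  by apply: rpredB; [apply: dvdz_mull; rewrite prime_dvdz_sqr | exact/dvdz_mulr/dvdzz].
by rewrite prime_dvdzM // npq' prime_dvdz_sqr //= => ->.
Qed.

Lemma genus_conic_q_ndvd_n : (q %| n)%Z = false.
Proof.
apply/negP => qn; have := genus_conic_q_ndvd_X.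
have : (q %| p%:Z * X ^+ 2)%Z.
  rewrite (_ : _ * _ = 2 * n ^+ 2 - q%:Z * Y ^+ 2); last by rewrite -h addrK.
  by apply: rpredB; [apply: dvdz_mull; rewrite prime_dvdz_sqr | exact/dvdz_mulr/dvdzz].
by rewrite prime_dvdzM // nqp' prime_dvdz_sqr //= => ->.
Qed.

Lemma genus_conic_odd : [/\ odd `|X|, odd `|Y| & odd `|n|].
Proof.
have [p1 pe] : exists k : int, p%:Z = 8 * k + 5 by exists (p %/ 8)%N%:Z; move: p5; clear; lia.
have [q1 qe] : exists k : int, q%:Z = 8 * k + 5 by exists (q %/ 8)%N%:Z; move: q5; clear; lia.
have nev : ~~ (odd `|X| == false) || ~~ (odd `|Y| == false).
  rewrite -negb_and; apply/negP => /andP[/eqP oX /eqP oY].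
  have /= := coprimez_prime (isT : prime 2) cXY; rewrite !dvdzE /= !dvdn2 oX oY /=.
  by move/(_ isT).
have [oX|eX] := boolP (odd `|X|); have [oY|eY] := boolP (odd `|Y|); first last.
- by move: nev; rewrite (negbTE eX) (negbTE eY).
- exfalso; have [y1 ye] := odd_sqr_mod8 oY; case: (int_parity X) eX => [] [x1 [xe ox]]; rewrite ?ox // => _.
  by move: h; rewrite ye xe pe qe; clear; lia.
- exfalso; have [x1 xe] := odd_sqr_mod8 oX; case: (int_parity Y) eY => [] [y1 [ye oy]]; rewrite ?oy // => _.
  by move: h; rewrite ye xe pe qe; clear; lia.
split=> //; case: (int_parity n) => [] [n1 [ne on]] //; exfalso.
have [x1 xe] := odd_sqr_mod8 oX; have [y1 ye] := odd_sqr_mod8 oY.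
by move: h; rewrite ye xe pe qe ne; clear; lia.
Qed.

Lemma sum_diff_ndvd (l : nat) (u v : int) : prime l -> odd l -> l%:Z = u ^+ 2 + v ^+ 2 ->
  (l %| u - v)%Z = false.
Proof.
move=> pl ol luv; apply/negP => /(dvdz_mulr (u + v)) h1.
have l2 : (l %| (2:int))%Z = false.
  by rewrite dvdzE /= dvdn_prime2 //; apply/negbTE; apply: contraTneq ol => ->.
have : (l %| 2 * v ^+ 2)%Z.
  rewrite (_ : _ * _ = l%:Z - (u - v) * (u + v)); last by rewrite luv; ring.
  by apply: rpredB; rewrite ?dvdzz.
by rewrite prime_dvdzM // l2 prime_dvdz_sqr //= (negbTE (sum_two_sqr_ndvd pl luv)).
Qed.

(** [2 * l = (u - v) ^ 2 + (u + v) ^ 2], so that [2] and [l] have the same residue symbol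
    modulo the primes of [u - v]. *)
Lemma sum_diff_jacobi (l : nat) (u v : int) : prime l -> (l %% 4 = 1)%N -> odd `|u| ->
  l%:Z = u ^+ 2 + v ^+ 2 -> odd (absz (u - v)%R) ->
  nonres l (u - v) = jacobi 2 (absz (u - v)%R).
Proof.
move=> pl l4 ou luv ouv; have ol : odd l by move: l4; clear; lia.
have luv' := sum_diff_ndvd pl ol luv.
have uv0 : (0 < absz (u - v)%R)%N by case: (absz _) ouv.
have cl : coprime l (absz (u - v)%R) by rewrite prime_coprime // -[(_ %| _)%N]/(l%:Z %| u - v)%Z luv'.
rewrite -nonres_abs ?luv' // jacobi_reciprocity //.
have : jacobi (2 * l%:Z) (absz (u - v)%R) = false.
  apply: jacobi_eq_false => k pk ku _; apply: (@nonres_false_intro _ _ (u + v)) => //.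
  rewrite (_ : _ - _ = (u - v) * (u - v)); last by rewrite luv; ring.
  by apply: dvdz_mulr.
rewrite jacobi_mull //.
  by case: (jacobi 2 _); case: (jacobi l _).
by rewrite coprime2n.
Qed.

Lemma nonres_norm_form_prime (l : nat) (D u v : int) : prime l -> odd l ->
  ~~ (l %| D)%Z -> ~~ (l %| v)%Z -> (l %| u ^+ 2 - D * v ^+ 2)%Z -> nonres l D = false.
Proof.
move=> pl ol lD lv h1; rewrite -(nonres_sqrM pl ol lD lv).
by apply: (@nonres_false_intro _ _ u) => //; rewrite -opprB rpredN.
Qed.

(** [- p * q] is a square modulo [n], and [n] is prime to [p * q]: reciprocity turns this
    into a relation between the characters of [n]. *)
Lemma nonres_n_sum : nonres p n (+) nonres q n = (`|n| %% 4 == 3)%N.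
Proof.
have [_ _ on] := genus_conic_odd.
have n0 : (0 < `|n|)%N by case: (absz n) on.
have pn := genus_conic_p_ndvd_n; have qn := genus_conic_q_ndvd_n.
have cp : coprime p `|n| by rewrite prime_coprime // -[(_ %| _)%N]/(p%:Z %| n)%Z pn.
have cq : coprime q `|n| by rewrite prime_coprime // -[(_ %| _)%N]/(q%:Z %| n)%Z qn.
rewrite -(nonres_abs pp p4) ?pn // -(nonres_abs pq q4) ?qn //.
rewrite !jacobi_reciprocity // -jacobi_mull // -jacobiN1 //.
have : jacobi (-1 * (p%:Z * q%:Z)) `|n| = false.
  apply: jacobi_eq_false => l pl ln _.
  have ol : odd l by apply: dvdn_odd ln on.
  have lp : (l %| p%:Z)%Z = false.
    by rewrite dvdzE /= dvdn_prime2 //; apply: contraFF pn => /eqP <-.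
  have lq : (l %| q%:Z)%Z = false.
    by rewrite dvdzE /= dvdn_prime2 //; apply: contraFF qn => /eqP <-.
  have lY : (l %| Y)%Z = false by apply: (coprimez_prime pl (_ : coprimez n Y)); rewrite // coprimez_sym.
  apply: (@nonres_norm_form_prime _ _ (p%:Z * X) Y) => //; rewrite ?lY //.
    by rewrite mulN1r rpredN prime_dvdzM // lp lq.
  rewrite (_ : _ - _ = p%:Z * (p%:Z * X ^+ 2 + q%:Z * Y ^+ 2)); last by ring.
  by rewrite h expr2; do 2!apply: dvdz_mull; apply: dvdz_mull.
have cpq : coprime `|p%:Z * q%:Z| `|n| by rewrite abszM coprimeMl cp cq.
rewrite (jacobi_mull (D1 := -1)) ?cpq ?coprime1n //.
by case: (jacobi (-1) _); case: (jacobi (_ * _) _).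
Qed.

Let R := p%:Z * X + (a - b) * n.

Hypothesis qR : (q %| R)%Z = false.

Let pR : (p %| R)%Z = false.
Proof.
have -> : (p %| R)%Z = (p %| (a - b) * n)%Z.
  by apply: rpredDl; exact/dvdz_mulr/dvdzz.
by rewrite prime_dvdzM // (sum_diff_ndvd pp op pab) genus_conic_p_ndvd_n.
Qed.

(** [R * R'] is a norm from [Q (sqrt (p * q))]. An inert prime dividing [R] to an odd power
    would thus divide [R'], but [2 * p] and [2 * q] are squares modulo a common prime of [R]
    and [R']. *)
Lemma nonres_R_eq : nonres p R = nonres q R.
Proof.
apply: nonres_pq_eq => //; rewrite ?pR ?qR // => l pl ol lR oR.
apply/negbTE/negP => rD; have := nonres_ndvd pl rD.
rewrite PoszM prime_dvdzM // negb_or => /andP[/negbTE lp /negbTE lq].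
pose R' := p%:Z * X - (a - b) * n.
have l2 : (l %| (2:int))%Z = false.
  by rewrite dvdzE /= dvdn_prime2 //; apply/negbTE; apply: contraTneq ol => ->.
have RR : ((a + b) * n) ^+ 2 - (p * q)%N%:Z * Y ^+ 2 = R * R'.
  have -> : R * R' = p%:Z * (p%:Z * X ^+ 2) - ((a - b) * n) ^+ 2 by rewrite /R /R'; ring.
  have -> : p%:Z * X ^+ 2 = 2 * n ^+ 2 - q%:Z * Y ^+ 2 by rewrite -h addrK.
  by rewrite PoszM pab; ring.
have [lR'|lR'] := boolP (l %| R')%Z.
  have lX : (l %| X)%Z.
    have : (l %| 2 * (p%:Z * X))%Z.
      have -> : 2 * (p%:Z * X) = R + R' by rewrite /R /R'; ring.
      exact: rpredD.
    by rewrite !prime_dvdzM // l2 lp.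
  have ln : (l %| n)%Z = false by apply: coprimez_prime cXn lX.
  have lab : (l %| a - b)%Z.
    have : (l %| 2 * ((a - b) * n))%Z.
      have -> : 2 * ((a - b) * n) = R - R' by rewrite /R /R'; ring.
      exact: rpredB.
    by rewrite !prime_dvdzM // l2 ln orbF.
  have r2p : nonres l (2 * p%:Z) = false.
    apply: (@nonres_false_intro _ _ (a + b)) => //.
    rewrite (_ : _ - _ = (a - b) * (a - b)); first exact: dvdz_mulr.
    by rewrite pab; ring.
  have lY : (l %| Y)%Z = false by apply: coprimez_prime cXY lX.
  have r2q : nonres l (2 * q%:Z) = false.
    have l2q : ~~ (l %| 2 * q%:Z)%Z by rewrite prime_dvdzM // l2 lq.
    apply: (@nonres_norm_form_prime _ _ (2 * n) Y) => //; rewrite ?lY //.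
    rewrite (_ : _ - _ = X * (2 * p%:Z * X)); first exact: dvdz_mulr.
    have -> : (2 * n) ^+ 2 = 2 * (2 * n ^+ 2) by ring.
    by rewrite -h; ring.
  have : nonres l (2 * p%:Z * (2 * q%:Z)) = false.
    by rewrite nonresM ?r2p ?r2q // prime_dvdzM // l2 ?lp ?lq.
  rewrite (_ : _ * _ = p%:Z * q%:Z * 2 ^+ 2); last by ring.
  rewrite nonres_sqrM ?l2 //; last by rewrite prime_dvdzM // lp lq.
  by rewrite -PoszM rD.
have R0 : R != 0 by apply: contraFneq pR => ->; rewrite dvdz0.
have R'0 : R' != 0 by apply: contraNneq lR' => ->; rewrite dvdz0.
have := norm_form_even_val (u := (a + b) * n) (v := Y) pl ol rD.
rewrite RR mulf_neq0 // => /(_ isT); rewrite abszM lognM ?absz_gt0 // oddD oR.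
rewrite (_ : logn l `|R'| = 0%N) //.
by rewrite lognE pl absz_gt0 R'0 /= -[(_ %| _)%N]/(l%:Z %| R')%Z (negbTE lR').
Qed.

Lemma nonres_p_R : nonres p R = nonres p (a - b) (+) nonres p n.
Proof.
rewrite (nonres_mod (n := (a - b) * n)) //; last by rewrite /R addrK; exact/dvdz_mulr/dvdzz.
by rewrite nonresM // ?(sum_diff_ndvd pp op pab) ?genus_conic_p_ndvd_n.
Qed.

(** [c / d] is a square root of [- 1] modulo [q], with which [2 * n * R] becomes a square up to
    the factor [(d - c) * (a * d - b * c)]. *)
Lemma nonres_q_R : nonres q R = nonres q n (+) nonres q (c - d).
Proof.
have qd := negbTE (sum_two_sqr_ndvd pq qcd).
have := q_ndvd_fg pp pq hpq pab qcd; rewrite prime_dvdzM // negb_or => /andP[_ /negbTE qg].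
have qn := genus_conic_q_ndvd_n; have qcd' := sum_diff_ndvd pq oq qcd.
have qdc : (q %| d - c)%Z = false by rewrite -opprB rpredN.
pose G := (d - c) * (a * d - b * c).
have qG : (q %| G)%Z = false by rewrite prime_dvdzM // qdc qg.
have h1 : nonres q (2 * n * G * R * d ^+ 2) = false.
  apply: (@nonres_false_intro _ _ (n * G + d ^+ 2 * (p%:Z * X))) => //.
  have -> : 2 * n * G * R * d ^+ 2 - (n * G + d ^+ 2 * (p%:Z * X)) ^+ 2 =
      2 * n ^+ 2 * G * d ^+ 2 * (a - b) - n ^+ 2 * G ^+ 2 - d ^+ 4 * p%:Z * (p%:Z * X ^+ 2).
    by rewrite /R; ring.
  have -> : p%:Z * X ^+ 2 = 2 * n ^+ 2 - q%:Z * Y ^+ 2 by rewrite -h addrK.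
  apply/dvdzP; exists (n ^+ 2 * (q%:Z * b ^+ 2 - 2 * b ^+ 2 * d ^+ 2 - p%:Z * d ^+ 2 - 2 * b * G)
    + d ^+ 4 * p%:Z * Y ^+ 2).
  by rewrite /G pab qcd; ring.
move: h1; rewrite nonres_sqrM ?qd //; last by rewrite !prime_dvdzM // q2 qn qdc qg qR.
rewrite nonresM ?qR //; last by rewrite !prime_dvdzM // q2 qn qdc qg.
rewrite nonresM ?qG //; last by rewrite prime_dvdzM // q2 qn.
rewrite nonresM ?q2 ?qn // nonresM ?qdc ?qg //.
move: hres; rewrite nonresM ?qd ?qg // (nonres_even_leg pq q5 qcd oc) nonres2 // q5 /=.
rewrite -(nonresN pq q4 (m := d - c)) ?qdc // opprB.
by case: (nonres q n); case: (nonres q R); case: (nonres q (c - d)); case: (nonres q (_ - _)).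
Qed.
End Solution.
End GenusReciprocity.

Lemma squarefree_decomposition (n : nat) : (0 < n)%N -> exists m n1 : nat,
  n = (m ^ 2 * n1)%N /\ forall l, prime l -> ~~ (l ^ 2 %| n1)%N.
Proof.
elim/ltn_ind: n => n IH n0.
have [/existsP[[l _] /= /andP[pl /dvdnP[k nk]]]|nl] :=
  boolP [exists l : 'I_n.+1, prime l && (l ^ 2 %| n)%N].
  have k0 : (0 < k)%N by case: k nk n0 => // ->.
  have [|m [n1 [ke sf]]] := IH k _ k0.
    by rewrite nk ltn_Pmulr // -(exp1n 2) ltn_exp2r // prime_gt1.
  by exists (l * m)%N, n1; split=> //; rewrite nk ke expnMn; ring.
exists 1%N, n; split; first by rewrite mul1n.
move=> l pl; apply: contra nl => hl; apply/existsP.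
have ln : (l < n.+1)%N.
  by rewrite ltnS (leq_trans _ (dvdn_leq n0 hl)) // -mulnn leq_pmulr // prime_gt0.
by exists (Ordinal ln); rewrite /= pl.
Qed.

Lemma coprimez_inverse (x m : int) : coprimez x m -> exists y : int, (m %| x * y - 1)%Z.
Proof.
move=> cxm; have [u [v uv]] := Bezoutz x m; exists u.
rewrite (eqP cxm) in uv; rewrite (_ : x * u - 1 = m * (- v)); last by rewrite -uv; ring.
exact/dvdz_mulr/dvdzz.
Qed.

Section SquareClassConic.
Variables (p q : nat).
Hypotheses (pp : prime p) (pq : prime q) (p4 : (p %% 4 = 1)%N) (q4 : (q %% 4 = 1)%N).
Hypotheses (npq : p != q).
Variables (N : nat) (r : int).
Hypotheses (N0 : (0 < N)%N) (cN : coprime (p * q) N).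
Hypotheses (sN : forall l, prime l -> ~~ (l ^ 2 %| N)%N).
Hypotheses (rpN : nonres p N = false) (rqN : nonres q N = false).
Hypotheses (Nr : (N %| r ^+ 2 + (p * q)%N%:Z)%Z).

Let D : int := (p * q)%N.

(** The class of the form ideal [(N, r + w)] is a square: its genus characters are trivial,
    and Legendre's theorem exhibits [N * z ^ 2] as a primitive norm. *)
Lemma square_class_conic : exists x y z : int,
  [/\ x ^+ 2 + D * y ^+ 2 = N%:Z * z ^+ 2, coprimez y (N%:Z * z), coprimez z (2 * x) & z != 0].
Proof.
have [v hv] := sqrt_mod_pq pp pq npq rpN rqN.
have pq0 : (0 < p * q)%N by rewrite muln_gt0 !prime_gt0.
have hb : ((p * q)%N %| v ^+ 2 - 1%N%:Z * N%:Z)%Z by rewrite mul1r.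
have hc : (N %| r ^+ 2 + 1%N%:Z * (p * q)%N%:Z)%Z by rewrite mul1r.
have n1 : forall n, (n ^ 2)%N != (1 * (p * q))%N.
  by move=> n; rewrite mul1n; apply: nonsquare_prime_mul => //; rewrite dvdn_prime2.
have pN : ~~ (p %| N)%N by rewrite -prime_coprime //; apply: coprime_dvdl cN; apply: dvdn_mulr.
have qN : ~~ (q %| N)%N by rewrite -prime_coprime //; apply: coprime_dvdl cN; apply: dvdn_mull.
have n2 : forall n, (n ^ 2)%N != (p * q * N)%N.
  move=> n; rewrite -mulnA; apply: nonsquare_prime_mul => //.
  by rewrite Euclid_dvdM // negb_or (dvdn_prime2 pp pq) npq.
have ha : (1%N %| (0:int) ^+ 2 - (p * q)%N%:Z * N%:Z)%Z by exact: dvd1z.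
have [x0 [y0 [z0 [h0 h]]]] :=
  legendre_conic (isT : (0 < 1)%N) pq0 N0 (coprime1n _) cN (coprime1n _) ha hb hc n1 n2.
rewrite mul1r -/D in h.
pose g := gcdz x0 (gcdz y0 z0).
have g0 : g != 0 by rewrite !gcdz_eq0 !negb_and.
have gx : (g %| x0)%Z by apply: dvdz_gcdl.
have gyz : (g %| gcdz y0 z0)%Z by apply: dvdz_gcdr.
have gy : (g %| y0)%Z by apply: dvdz_trans gyz (dvdz_gcdl _ _).
have gz : (g %| z0)%Z by apply: dvdz_trans gyz (dvdz_gcdr _ _).
have /dvdzP[x xx] := gx; have /dvdzP[y yy] := gy; have /dvdzP[z zz] := gz.
have {}h : x ^+ 2 + D * y ^+ 2 = N%:Z * z ^+ 2.
  have g20 : g ^+ 2 != 0 by rewrite expf_neq0.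
  apply: (mulfI g20); transitivity (x0 ^+ 2 + D * y0 ^+ 2); first by rewrite xx yy; ring.
  by rewrite h zz; ring.
have nog l : prime l -> (l %| x)%Z -> (l %| y)%Z -> (l %| z)%Z -> False.
  move=> pl /dvdzP[x1 x1e] /dvdzP[y1 y1e] /dvdzP[z1 z1e].
  have : (l%:Z * g %| g)%Z.
    change (l%:Z * g %| gcdz x0 (gcdz y0 z0))%Z; rewrite !dvdz_gcd; apply/and3P.
    split; apply/dvdzP; [exists x1 | exists y1 | exists z1]; rewrite mulrA.
    - by rewrite -x1e -xx.
    - by rewrite -y1e -yy.
    - by rewrite -z1e -zz.
  rewrite -[X in (_ %| X)%Z]mul1r dvdz_mul2r // dvdzE /= dvdn1.
  by move: (prime_gt1 pl) => /gtn_eqF ->.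
have sq l m : (l%:Z %| m)%Z -> (l%:Z ^+ 2 %| m ^+ 2)%Z by move=> lm; rewrite dvdz_sqr_sqr.
have sqf (l : nat) (m k : int) : prime l -> (forall l : nat, prime l -> ~~ (l%:Z ^+ 2 %| m)%Z) ->
    (l%:Z ^+ 2 %| m * k ^+ 2)%Z -> (l %| k)%Z.
  move=> pl sm hm; apply: contraT => lk; case/negP: (sm l pl).
  have ck : coprimez (l%:Z ^+ 2) (k ^+ 2).
    by rewrite coprimezE !abszX coprimeXl // coprimeXr // prime_coprime.
  by rewrite (Gauss_dvdzl _ ck) in hm.
have sN' (l : nat) : prime l -> ~~ (l%:Z ^+ 2 %| N%:Z)%Z by move=> pl; rewrite -PoszX dvdzE sN.
have sD (l : nat) : prime l -> ~~ (l%:Z ^+ 2 %| D)%Z.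
  move=> pl; apply/negP => hl.
  have : (l %| D)%Z by apply: dvdz_trans hl; rewrite expr2 dvdz_mulr.
  rewrite dvdzE /= Euclid_dvdM // !dvdn_prime2 // => /orP[] /eqP le; move: hl.
    rewrite le expr2 /D PoszM dvdz_mul2l; last by rewrite -lt0n prime_gt0.
    by rewrite dvdzE /= dvdn_prime2 // (negbTE npq).
  rewrite le expr2 /D PoszM dvdz_mul2r; last by rewrite -lt0n prime_gt0.
  by rewrite dvdzE /= dvdn_prime2 // eq_sym (negbTE npq).
have cDN (l : nat) : prime l -> (l %| D)%Z -> (l %| N%:Z)%Z = false.
  rewrite !dvdzE /= => pl lD; apply/negbTE; rewrite -prime_coprime //.
  by apply: coprime_dvdl cN.
have two_not_dvd : (2%N %| z)%Z = false.
  apply/negP => z2; have := h; have /dvdzP[z' ze] := z2.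
  have oD : exists j, D = 4 * j + 1.
    exists ((p * q) %/ 4)%N%:Z; rewrite /D {1}(divn_eq (p * q) 4) -modnMml p4 mul1n q4 PoszD PoszM; ring.
  case: oD => j ->; rewrite ze.
  case: (int_parity x) => [] [x' [xe _]]; case: (int_parity y) => [] [y' [ye _]] h'.
  - apply: (nog 2%N) => //; [rewrite xe | rewrite ye]; exact/dvdz_mulr/dvdzz.
  - by move: h'; rewrite xe ye; clear; lia.
  - by move: h'; rewrite xe ye; clear; lia.
  - by move: h'; rewrite xe ye; clear; lia.
have xy_z l : prime l -> (l %| x)%Z -> (l %| y)%Z -> False.
  move=> pl lx ly; apply: (nog l) => //; apply: (sqf _ N%:Z) => //.
  by rewrite -h; apply: rpredD; [| apply: dvdz_mull]; apply: sq.
exists x, y, z; split=> //.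
- apply: coprimez_primeP => l pl ly lNz; apply: (xy_z l) => //.
  rewrite -prime_dvdz_sqr // -(addrK (D * y ^+ 2) (x ^+ 2)) h; apply: rpredB.
    by rewrite expr2 mulrA; apply: dvdz_mulr.
  by apply: dvdz_mull; rewrite prime_dvdz_sqr.
- apply: coprimez_primeP => l pl lz; rewrite prime_dvdzM // => /orP[l2|lx].
    by move: l2; rewrite dvdzE /= dvdn_prime2 // => /eqP le; move: lz; rewrite le two_not_dvd.
  apply: (nog l) => //; apply: (sqf _ D) => //.
  rewrite -(addKr (x ^+ 2) (D * _)) h addrC; apply: rpredB; last exact: sq.
  by apply: dvdz_mull; apply: sq.
- by apply: contraFneq two_not_dvd => ->; rewrite dvdz0.
Qed.
End SquareClassConic.

Section OrderEight.
Variables (p q : nat) (a b c d : int).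
Hypotheses (pp : prime p) (pq : prime q) (p5 : (p %% 8 = 5)%N) (q5 : (q %% 8 = 5)%N).
Hypotheses (hpq : nonres q p) (pab : p%:Z = a ^+ 2 + b ^+ 2) (qcd : q%:Z = c ^+ 2 + d ^+ 2).
Hypotheses (oa : odd `|a|) (oc : odd `|c|).
Hypothesis hres : nonres q (d * (a * d - b * c)) = false.

Let op : odd p. Proof. by move: p5; clear; lia. Qed.
Let oq : odd q. Proof. by move: q5; clear; lia. Qed.
Let p4 : (p %% 4 = 1)%N. Proof. by move: p5; clear; lia. Qed.
Let q4 : (q %% 4 = 1)%N. Proof. by move: q5; clear; lia. Qed.
Let npq : p != q. Proof. exact: p_neq_q hpq. Qed.

Lemma sum_two_sqr_odd_diff (l : nat) (u v : int) : (l %% 8 = 5)%N ->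
  l%:Z = u ^+ 2 + v ^+ 2 -> odd `|u| -> odd (absz (u - v)%R).
Proof.
move=> l5 luv ou; have [v1 [-> _]] := sum_two_sqr_mod8 l5 luv ou.
have [u1 ->] := odd_int ou.
by rewrite (_ : _ - _ = 2 * (u1 - v1) + 1); [exact: odd_abs_int | ring].
Qed.

(** The sign of [X] is chosen so that [q] does not divide [R]; combining the values of the
    two characters on [R] determines [n] modulo [4]. *)
Lemma genus_conic_mod4 : exists (X Y : int) (n : nat),
  [/\ p%:Z * X ^+ 2 + q%:Z * Y ^+ 2 = 2 * n%:Z ^+ 2,
      coprimez X Y, coprimez X n, coprimez Y n
    & (n %% 4 == 3)%N = jacobi 2 (absz (a - b)%R) (+) jacobi 2 (absz (c - d)%R)].
Proof.
have [X0 [Y [n0 [h0 cXY cXn cYn]]]] := genus_conic_primitive pp pq p5 q5 hpq.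
have {h0} h0 : p%:Z * X0 ^+ 2 + q%:Z * Y ^+ 2 = 2 * (`|n0|%N)%:Z ^+ 2.
  by rewrite h0 abszE real_normK ?num_real.
have cXn' : coprimez X0 `|n0|%N by [].
have cYn' : coprimez Y `|n0|%N by [].
move: (absz n0) h0 cXn' cYn' => n h0 {cXn cYn} cXn cYn.
have [X [h cXY' cXn' qR]] : exists X : int,
   [/\ p%:Z * X ^+ 2 + q%:Z * Y ^+ 2 = 2 * n%:Z ^+ 2, coprimez X Y, coprimez X n
     & (q %| p%:Z * X + (a - b) * n%:Z)%Z = false].
  have [qR|/negbTE qR] := boolP (q %| p%:Z * X0 + (a - b) * n%:Z)%Z; last by exists X0.
  exists (- X0); split; rewrite ?sqrrN ?coprimeNz //; apply/negP => qR'.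
  have q2 : (q %| (2:int))%Z = false.
    by rewrite dvdzE /= dvdn_prime2 //; apply/negbTE; apply: contraTneq oq => ->.
  have nqp' : (q %| p%:Z)%Z = false.
    by rewrite dvdzE /= dvdn_prime2 // eq_sym; apply/negbTE.
  have : (q %| 2 * p%:Z * X0)%Z.
    rewrite (_ : _ * _ = (p%:Z * X0 + (a - b) * n%:Z) - (p%:Z * - X0 + (a - b) * n%:Z)); last by ring.
    exact: rpredB.
  by rewrite !prime_dvdzM // q2 nqp' (genus_conic_q_ndvd_X pq q5 h0 cXn).
exists X, Y, n; split=> //.
have e1 := nonres_p_R pp pq p5 hpq pab h cYn.
have e2 := nonres_q_R pp pq q5 hpq pab qcd oc hres h cXn' qR.
have e3 := nonres_R_eq pp pq p5 q5 hpq pab h cXY' cXn' cYn qR.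
have e4 := nonres_n_sum pp pq p5 q5 hpq h cXY' cXn' cYn.
rewrite -(sum_diff_jacobi pp p4 oa pab) ?(sum_two_sqr_odd_diff p5 pab) //.
rewrite -(sum_diff_jacobi pq q4 oc qcd) ?(sum_two_sqr_odd_diff q5 qcd) //.
rewrite -[LHS]e4; move: e3; rewrite e1 e2.
by case: (nonres p n); case: (nonres q n); case: (nonres p _); case: (nonres q _).
Qed.

(** When [n = 1] modulo [4], both characters of its squarefree part [n1] agree, and [N] is
    [n1] or [2 * n1] according to their common value: the class of norm [N] is then a square,
    while [2 * p * n ^ 2] is a norm. *)
Lemma order_eight_data : jacobi 2 (absz (a - b)%R) (+) jacobi 2 (absz (c - d)%R) = false ->
  exists (n m n1 N : nat) (r X Y x y z : int),
  [/\ odd n, n = (m ^ 2 * n1)%N, coprime (p * q) n, coprime (p * q) N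
    & forall l, prime l -> ~~ (l ^ 2 %| N)%N] /\
  [/\ (p%:Z * X) ^+ 2 + (p * q)%N%:Z * Y ^+ 2 = (2 * p * n ^ 2)%N%:Z,
      coprimez Y (2 * p * n ^ 2)%N, ((2 * p * n ^ 2)%N %| p%:Z * X - r * Y)%Z
    & ((2 * p * n ^ 2)%N %| r ^+ 2 + (p * q)%N%:Z)%Z] /\
  [/\ N = n1 \/ N = (2 * n1)%N, (0 < N)%N, x ^+ 2 + (p * q)%N%:Z * y ^+ 2 = N%:Z * z ^+ 2,
      coprimez y (N%:Z * z) & coprimez z (2 * x)] /\ z != 0.
Proof.
have [X [Y [n [h cXY cXn cYn n3]]]] := genus_conic_mod4.
rewrite -n3 => {}n3.
have [oX oY on] := genus_conic_odd p5 q5 h cXY.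
have n0 : (0 < n)%N by case: (n) on.
have pn := genus_conic_p_ndvd_n pp pq p5 hpq h cYn.
have qn := genus_conic_q_ndvd_n pp pq q5 hpq h cXn.
have cn : coprime (p * q) n.
  by rewrite coprimeMl !prime_coprime // -[(p %| _)%N]/(p%:Z %| n%:Z)%Z pn -[(q %| _)%N]/(q%:Z %| n%:Z)%Z qn.
have [m [n1 [nm sf]]] := squarefree_decomposition n0.
have cY : coprimez Y (2 * p * n ^ 2)%N.
  have cYn' : coprime `|Y| n := cYn.
  rewrite coprimezE /= 2!coprimeMr coprimen2 oY (coprimeXr _ cYn') andbT /=.
  rewrite coprime_sym prime_coprime // -[(_ %| _)%N]/(p%:Z %| Y)%Z.
  by rewrite (genus_conic_p_ndvd_Y pp p5 h cYn).
have [Y' hY'] := coprimez_inverse cY.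
pose r := p%:Z * X * Y'.
have hr : ((2 * p * n ^ 2)%N %| p%:Z * X - r * Y)%Z.
  rewrite (_ : _ - _ = p%:Z * X * - (Y * Y' - 1)); last by rewrite /r; ring.
  by apply: dvdz_mull; rewrite rpredN.
have hN : (p%:Z * X) ^+ 2 + (p * q)%N%:Z * Y ^+ 2 = (2 * p * n ^ 2)%N%:Z.
  have -> : (2 * p * n ^ 2)%N%:Z = p%:Z * (2 * n%:Z ^+ 2) by rewrite !PoszM; ring.
  by rewrite -h PoszM; ring.
have hrD : ((2 * p * n ^ 2)%N %| r ^+ 2 + (p * q)%N%:Z)%Z.
  have cY2 : coprimez (2 * p * n ^ 2)%N (Y ^+ 2) by rewrite coprimezE abszX coprimeXr // coprime_sym.
  rewrite -(Gauss_dvdzr _ cY2).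
  rewrite (_ : Y ^+ 2 * _ = (p%:Z * X) ^+ 2 + (p * q)%N%:Z * Y ^+ 2 - (p%:Z * X - r * Y) * (p%:Z * X + r * Y)); last by ring.
  by apply: rpredB; [rewrite hN; exact: dvdzz | apply: dvdz_mulr].
have n1n : (n1 %| n)%N by rewrite nm dvdn_mull.
have on1 : odd n1 := dvdn_odd n1n on.
have n10 : (0 < n1)%N by case: (n1) on1.
have cn1 : coprime (p * q) n1 := coprime_dvdr n1n cn.
have mn : (m %| n)%N by rewrite nm -mulnn -mulnA dvdn_mulr.
have n4 : (n %% 4 == 3)%N = false by exact: n3.
have rn1 l : prime l -> odd l -> (l %| p * q)%N -> nonres l n1%:Z = nonres l n%:Z.
  move=> pl ol lpq; have lcop k : (k %| n)%N -> ~~ (l %| k%:Z)%Z.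
    move=> kn; rewrite dvdzE -prime_coprime //=.
    exact: coprime_dvdl lpq (coprime_dvdr kn cn).
  have e : n%:Z = n1%:Z * m%:Z ^+ 2 by rewrite nm !PoszM; ring.
  by rewrite e nonres_sqrM ?lcop.
have sumn := nonres_n_sum pp pq p5 q5 hpq h cXY cXn cYn.
rewrite -[RHS]/(n %% 4 == 3)%N n4 in sumn.
have [N [eN rpN rqN]] : exists N, [/\ N = n1 \/ N = (2 * n1)%N, nonres p N%:Z = false & nonres q N%:Z = false].
  have epq : nonres q n1%:Z = nonres p n1%:Z.
    rewrite (rn1 p pp op (dvdn_mulr _ (dvdnn p))) (rn1 q pq oq (dvdn_mull _ (dvdnn q))).
    by move: sumn; case: (nonres p n); case: (nonres q n).
  case rp: (nonres p n1%:Z); last by exists n1; rewrite epq; split=> //; left.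
  have l2 l : prime l -> (l %| p * q)%N -> odd l -> (l %% 8 = 5)%N -> nonres l (2 * n1)%N%:Z = ~~ nonres l n1%:Z.
    move=> pl lpq ol l5; rewrite PoszM (nonresM pl ol); first by rewrite (nonres2 pl ol) l5.
      by rewrite dvdzE /= dvdn_prime2 //; apply: contraTneq ol => ->.
    rewrite dvdzE /= -prime_coprime //; exact: coprime_dvdl lpq cn1.
  exists (2 * n1)%N; split; first by right.
    by rewrite (l2 p pp (dvdn_mulr _ (dvdnn p))) // rp.
  by rewrite (l2 q pq (dvdn_mull _ (dvdnn q))) // epq rp.
have N0 : (0 < N)%N by case: eN => ->; rewrite ?muln_gt0.
have cN : coprime (p * q) N.
  by case: eN => -> //; rewrite coprimeMr cn1 coprimen2 oddM op oq.
have sN l : prime l -> ~~ (l ^ 2 %| N)%N.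
  move=> pl; case: eN => ->; first exact: sf.
  have [l2|l2] := eqVneq l 2%N.
    by rewrite l2 (@dvdn_pmul2l 2 2) // dvdn2 on1.
  rewrite Gauss_dvdr ?sf // coprimeXl // prime_coprime // dvdn_prime2 //.
have Nr : (N %| r ^+ 2 + (p * q)%N%:Z)%Z.
  apply: dvdz_trans hrD; rewrite dvdzE /=.
  have d1 : (n1 %| n ^ 2)%N by rewrite -mulnn dvdn_mulr.
  case: eN => ->; first by rewrite dvdn_mull.
  by rewrite -mulnA dvdn_pmul2l // dvdn_mull.
have [x [y [z [h1 h2 h3 h4]]]] := square_class_conic pp pq p4 q4 npq N0 cN sN rpN rqN Nr.
by exists n, m, n1, N, r, X, Y, x, y, z.
Qed.
End OrderEight.

(** * Square roots twisted by an automorphism *)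

Section TwistedSquareRoot.
Variables (F : fieldType) (sg : {rmorphism F -> F}).
Variables (I W s0 nu P vp : F) (e f x y t s : int) (D : nat).
Hypotheses (I2 : I ^+ 2 = -1) (W2 : W ^+ 2 = - D%:R) (s1 : s ^+ 2 = 1).
Hypotheses (efD : e ^+ 2 + (4 * f) ^+ 2 = D%:Z)
  (st : s * t ^+ 2 = f * (x ^+ 2 - 4 * y ^+ 2) + e * x * y).
Hypothesis s02 : s0 ^+ 2 = e%:~R + 4 * f%:~R * I.
Local Notation al := (2 * t%:~R * (1 + s%:~R * I)).
Local Notation be := (x%:~R + 2 * y%:~R * I).
Local Notation be' := (x%:~R - 2 * y%:~R * I).
Local Notation mu := (al + be * s0).
Hypothesis nu2 : nu ^+ 2 = vp * mu.
Hypotheses (sgI : sg I = - I) (sgW : sg W = W) (sgP : sg P = P)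
  (sgvp : sg (sg vp) = vp) (vpP : vp * sg vp = P ^+ 2).
Hypotheses (two0 : 2 != 0 :> F) (D0 : D%:R != 0 :> F) (nu0 : nu != 0).

Local Notation s0' := (sg s0).
Local Notation g := (s%:~R * I * (be' * s0')).

Definition twisted_root : F := (al + be * s0 + g) / (1 + s%:~R * I).

Let sC : s%:~R ^+ 2 = 1 :> F. Proof. by rewrite -rmorphXn /= s1. Qed.

Let s02' : s0' ^+ 2 = e%:~R - 4 * f%:~R * I.
Proof. by rewrite -rmorphXn /= s02 rmorphD !rmorphM /= sgI !rmorph_int rmorph_nat mulrN. Qed.

Let D_F : e%:~R ^+ 2 + 16 * f%:~R ^+ 2 = D%:R :> F.
Proof.
rewrite -[D%:R]/(D%:Z%:~R) -efD !(rmorphD, rmorphM, rmorph_nat); ring.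
Qed.

Lemma sqrt_norm_sqr : (s0 * s0') ^+ 2 = D%:R.
Proof.
rewrite exprMn s02 s02' -D_F.
have -> : (e%:~R + 4 * f%:~R * I) * (e%:~R - 4 * f%:~R * I) = e%:~R ^+ 2 - 16 * f%:~R ^+ 2 * I ^+ 2 by ring.
by rewrite I2; ring.
Qed.

Lemma sg2_s0 : sg (sg s0) = - s0.
Proof.
have h : (s0 * s0') ^+ 2 = (I * W) ^+ 2 by rewrite sqrt_norm_sqr exprMn I2 W2; ring.
have n0 : s0 * s0' != 0 by rewrite -sqrf_eq0 sqrt_norm_sqr.
have hs : sg (s0 * s0') = - (s0 * s0').
  move/eqP: h; rewrite eqf_sqr => /orP[] /eqP ->; rewrite ?rmorphN rmorphM /= sgI sgW; ring.
have n0' : s0' != 0 by apply: contraNneq n0 => ->; rewrite mulr0.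
by apply: (mulfI n0'); move: hs; rewrite rmorphM /= => ->; ring.
Qed.

Let sgE := (rmorphD, rmorphB, rmorphM, rmorphN, rmorph1, rmorph_nat, rmorph_int).

Lemma sg_mu : sg mu = 2 * t%:~R * (1 - s%:~R * I) + be' * s0'.
Proof.
by rewrite !sgE /= sgI; ring.
Qed.

Lemma mu_al_sqr : al ^+ 2 = (e%:~R + 4 * f%:~R * I) * be ^+ 2 - (e%:~R - 4 * f%:~R * I) * be' ^+ 2.
Proof.
have stF : s%:~R * t%:~R ^+ 2 = f%:~R * (x%:~R ^+ 2 - 4 * y%:~R ^+ 2) + e%:~R * x%:~R * y%:~R :> F.
  transitivity ((s * t ^+ 2)%:~R : F); first by rewrite !sgE; ring.
  by rewrite st !sgE; ring.
have -> : al ^+ 2 = 8 * (s%:~R * t%:~R ^+ 2) * I + 4 * t%:~R ^+ 2 * (1 + s%:~R ^+ 2 * I ^+ 2) by ring.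
rewrite sC I2 stF.
have -> : (e%:~R + 4 * f%:~R * I) * be ^+ 2 - (e%:~R - 4 * f%:~R * I) * be' ^+ 2 =
   8 * I * (f%:~R * (x%:~R ^+ 2 + 4 * y%:~R ^+ 2 * I ^+ 2) + e%:~R * x%:~R * y%:~R) by ring.
by rewrite I2; ring.
Qed.

Let g_sqr : g ^+ 2 = - ((e%:~R - 4 * f%:~R * I) * be' ^+ 2).
Proof. by rewrite !exprMn sC I2 s02'; ring. Qed.

Lemma mu_b_sqr : (be * s0) ^+ 2 = (e%:~R + 4 * f%:~R * I) * be ^+ 2.
Proof. by rewrite exprMn s02; ring. Qed.

Let kappa0 : 1 + s%:~R * I != 0.
Proof.
rewrite -sqrf_eq0 (_ : _ ^+ 2 = 1 + s%:~R ^+ 2 * I ^+ 2 + 2 * s%:~R * I); last by ring.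
rewrite sC I2 mulrN1 subrr add0r !mulf_neq0 //.
  by rewrite -sqrf_eq0 sC oner_eq0.
by rewrite -sqrf_eq0 I2 oppr_eq0 oner_eq0.
Qed.

(** Both [mu] and its conjugate are, up to the same constant, the two factors of a
    point of the conic [al ^ 2 = (be * s0) ^ 2 + g ^ 2], so that their product is a square. *)
Lemma mu_sg_mu : mu * sg mu = twisted_root ^+ 2.
Proof.
have e1 : s%:~R * I * sg mu = al + g.
  rewrite sg_mu (_ : _ * _ = 2 * t%:~R * (s%:~R * I - s%:~R ^+ 2 * I ^+ 2) + g); last by ring.
  by rewrite sC I2; ring.
have sF0 : s%:~R != 0 :> F by rewrite -sqrf_eq0 sC oner_eq0.
have I0 : I != 0 by rewrite -sqrf_eq0 I2 oppr_eq0 oner_eq0.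
have k2 : (1 + s%:~R * I) ^+ 2 = 2 * (s%:~R * I).
  rewrite (_ : _ ^+ 2 = 1 + s%:~R ^+ 2 * I ^+ 2 + 2 * (s%:~R * I)); last by ring.
  by rewrite sC I2 mulrN1 subrr add0r.
have e2 : (al + be * s0 + g) ^+ 2 = 2 * (mu * (al + g)).
  rewrite (_ : _ ^+ 2 = 2 * (mu * (al + g)) + ((be * s0) ^+ 2 + g ^+ 2 - al ^+ 2)); last by ring.
  by rewrite mu_b_sqr g_sqr mu_al_sqr; ring.
rewrite /twisted_root expr_div_n k2 e2 -e1.
by field; rewrite ?two0 ?sF0 ?I0.
Qed.

Lemma nu_sg_nu : (nu * sg nu) ^+ 2 = (P * twisted_root) ^+ 2.
Proof.
rewrite [LHS]exprMn [RHS]exprMn -rmorphXn nu2 rmorphM -mu_sg_mu -vpP; ring.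
Qed.

Lemma sg4_nu : sg (sg (sg (sg nu))) = - nu.
Proof.
have sg2I : sg (sg I) = I by rewrite sgI rmorphN sgI opprK.
have sg2mu : sg (sg mu) = al - be * s0.
  by rewrite !sgE /= sg2I sg2_s0; ring.
have h : (nu * sg (sg nu)) ^+ 2 = (vp * g) ^+ 2.
  have sg2nu : sg (sg nu) ^+ 2 = vp * (al - be * s0).
    by rewrite -!rmorphXn nu2 [sg (vp * _)]rmorphM rmorphM sgvp sg2mu.
  rewrite [LHS]exprMn [RHS]exprMn nu2 sg2nu.
  have -> : vp * mu * (vp * (al - be * s0)) = vp ^+ 2 * (al ^+ 2 - (be * s0) ^+ 2) by ring.
  by rewrite mu_b_sqr mu_al_sqr g_sqr; ring.
have n2 : sg (sg nu) != 0 by rewrite !fmorph_eq0.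
have sgg : sg (sg (vp * g)) = - (vp * g).
  by rewrite !sgE /= sgvp sg2I sg2_s0 rmorphN; ring.
have hs : sg (sg (nu * sg (sg nu))) = - (nu * sg (sg nu)).
  move/eqP: h; rewrite eqf_sqr => /orP[] /eqP ->; first exact: sgg.
  by rewrite [sg (- _)]rmorphN rmorphN sgg.
by apply: (mulfI n2); move: hs; rewrite !rmorphM /= => ->; ring.
Qed.

Lemma sg4_s0 : sg (sg (sg (sg s0))) = s0.
Proof. by rewrite sg2_s0 !rmorphN sg2_s0 opprK. Qed.
End TwistedSquareRoot.

(** * Galois groups of the two extensions *)

Section GaloisAdjoin.
Variable L : splittingFieldType rat.
Implicit Types (K E : {subfield L}) (rs : seq L).

(** In characteristic zero only normality has to be checked, on the generators. *)
Lemma galois_adjoin_seq K rs :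
    (forall f : 'AEnd(L), kHom K {:L} f -> forall a, a \in rs -> f a \in <<K & rs>>%VS) ->
  galois K <<K & rs>>%AS.
Proof.
move=> h; apply/and3P; split; first exact: subv_adjoin_seq.
  by apply/separableP => a _; apply: pcharf0_separable => p; rewrite pchar_lalg; exact: pchar_num.
apply/forall_inP => f /[!(inE, kAutE)] /andP[homKf _].
rewrite -dimv_leqif_eq ?limg_dim_eq ?(eqP (AEnd_lker0 f)) ?capv0 //.
rewrite aimg_adjoin_seq; have [_ /fixedSpace_limg->] := andP homKf.
apply/Fadjoin_seqP; split; first exact: subv_adjoin_seq.
by move=> _ /mapP[a ars ->]; apply: h.
Qed.

Lemma dim_adjoin_sqrt K a : a ^+ 2 \in K -> (\dim <<K; a>> <= 2 * \dim K)%N.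
Proof.
move=> Ka; rewrite dim_Fadjoin leq_mul2r; apply/orP; right.
have h : minPoly K a %| 'X^2 - (a ^+ 2)%:P.
  apply: minPoly_dvdp; last by rewrite rootE !hornerE subrr.
  by rewrite rpredB ?rpredX ?polyOverX ?polyOverC.
have n0 : 'X^2 - (a ^+ 2)%:P != 0 :> {poly L} by rewrite monic_neq0 // monicXnsubC.
by have := dvdp_leq n0 h; rewrite size_minPoly size_XnsubC.
Qed.

Lemma gal_adjoin_seq_ext K rs (u v : gal_of <<K & rs>>) :
    u \in 'Gal(<<K & rs>> / K)%g -> v \in 'Gal(<<K & rs>> / K)%g ->
  (forall a, a \in rs -> u a = v a) -> u = v.
Proof.
move=> Gu Gv h; set E := <<K & rs>>%AS.
suff : (E <= fixedField [set (u * v^-1)%g])%VS.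
  move=> hE; have : (u * v^-1 == 1)%g.
    apply/gal_eqP => a Ea; rewrite gal_id.
    by have /fixedFieldP := subvP hE _ Ea; apply; rewrite ?inE.
  by move=> /eqP /(canRL (mulgKV _)); rewrite mul1g.
have sKE : (K <= E)%VS by exact: subv_adjoin_seq.
apply/Fadjoin_seqP; split.
  apply/subvP => a Ka; have Ea := subvP sKE _ Ka.
  apply/fixedFieldP => // z; rewrite inE => /eqP ->.
  by rewrite galM // (fixed_gal sKE Gu) // (fixed_gal sKE) // groupV.
move=> a ars; have Ea : a \in E := seqv_sub_adjoin _ ars.
apply/fixedFieldP => // z; rewrite inE => /eqP ->.
by rewrite galM // h // -galM // mulgV gal_id.
Qed.

Lemma gal_moving K E a : galois K E -> a \in E -> a \notin K ->
  exists2 u, u \in 'Gal(E / K)%g & u a != a.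
Proof.
move=> /galois_fixedField fKE Ea Ka.
have [/existsP[u /andP[Gu ua]]|nE] := boolP [exists u in 'Gal(E / K)%g, u a != a].
  by exists u.
case/negP: Ka; rewrite -fKE; apply/fixedFieldP => // u Gu.
by apply/eqP; apply: contraNT nE => ua; apply/existsP; exists u; rewrite Gu.
Qed.
End GaloisAdjoin.

Section MuField.
Variable L : splittingFieldType rat.
Variable k0 : {subfield L}.
Variables (I W s0 nu P : L) (e f x y t s va vb : int) (D p_ : nat).
Hypotheses (I2 : I ^+ 2 = -1) (Wk : W \in k0) (W2 : W ^+ 2 = - D%:R) (s1 : s ^+ 2 = 1).
Hypotheses (efD : e ^+ 2 + (4 * f) ^+ 2 = D%:Z) (D0 : (0 < D)%N)
  (st : s * t ^+ 2 = f * (x ^+ 2 - 4 * y ^+ 2) + e * x * y).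
Hypothesis s02 : s0 ^+ 2 = e%:~R + 4 * f%:~R * I.
Local Notation al := (2 * t%:~R * (1 + s%:~R * I)).
Local Notation be := (x%:~R + 2 * y%:~R * I).
Local Notation be' := (x%:~R - 2 * y%:~R * I).
Local Notation mu := (al + be * s0).
Local Notation vp := (va%:~R + vb%:~R * I).
Hypotheses (nu2 : nu ^+ 2 = vp * mu) (nu0 : nu != 0).
Hypotheses (vab : va ^+ 2 + vb ^+ 2 = p_%:Z) (P2 : P ^+ 2 = p_%:R) (p0 : (0 < p_)%N).
Local Notation rs := [:: P; I; s0; nu].
Local Notation E := <<k0 & rs>>%VS.

Let pc : [pchar L] =i pred0.
Proof. by move=> l; rewrite pchar_lalg; exact: pchar_num. Qed.
Let natL (n : nat) : (0 < n)%N -> n%:R != 0 :> L.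
Proof. by move=> n0; rewrite (iffLR (pcharf0P L) pc) -lt0n. Qed.
Let two0 : 2 != 0 :> L. Proof. exact: natL. Qed.
Let DL0 : D%:R != 0 :> L. Proof. exact: natL. Qed.

Let EI : I \in E. Proof. by apply: seqv_sub_adjoin; rewrite !inE eqxx ?orbT. Qed.
Let EP : P \in E. Proof. by apply: seqv_sub_adjoin; rewrite !inE eqxx ?orbT. Qed.
Let Es0 : s0 \in E. Proof. by apply: seqv_sub_adjoin; rewrite !inE eqxx ?orbT. Qed.
Let Enu : nu \in E. Proof. by apply: seqv_sub_adjoin; rewrite !inE eqxx ?orbT. Qed.
Let EW : W \in E. Proof. exact: (subvP (subv_adjoin_seq _ _)). Qed.
Let Eint (n : int) : n%:~R \in E. Proof. exact: rpred_int. Qed.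
Let Enat (n : nat) : n%:R \in E. Proof. exact: rpred_nat. Qed.

Lemma vp_conj (fr : {rmorphism L -> L}) : fr I = - I -> vp * fr vp = P ^+ 2.
Proof.
move=> fI; rewrite P2 rmorphD rmorphM /= fI !rmorph_int.
rewrite (_ : _ * _ = va%:~R ^+ 2 - vb%:~R ^+ 2 * I ^+ 2); last by ring.
by rewrite I2 mulrN1 opprK -!rmorphXn -rmorphD /= vab.
Qed.

(** A conjugate of [nu] is a square root of a conjugate of [vp * mu]; its product with [nu] has
    square [(vp * mu) ^ 2], [(vp * s I be' s0b) ^ 2] or, by the conic, that of [P * twisted_root]. *)
Lemma mu_field_galois : galois k0 E.
Proof.
apply: galois_adjoin_seq => fa homf.
have fW : fa W = W by have /kAHomP := homf; apply.
have fI : fa I = I \/ fa I = - I.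
  have : (fa I) ^+ 2 == I ^+ 2 by rewrite -rmorphXn /= I2 rmorphN1.
  by rewrite eqf_sqr => /orP[] /eqP; [left|right].
have fP : fa P = P \/ fa P = - P.
  have : (fa P) ^+ 2 == P ^+ 2 by rewrite -rmorphXn /= P2 rmorph_nat.
  by rewrite eqf_sqr => /orP[] /eqP; [left|right].
have sgE := (rmorphD, rmorphB, rmorphM, rmorphN, rmorph1, rmorph_nat, rmorph_int).
have DL : (e%:~R + 4 * f%:~R * I) * (e%:~R - 4 * f%:~R * I) = D%:R.
  rewrite -[D%:R]/(D%:Z%:~R) -efD !(rmorphD, rmorphM, rmorph_nat).
  rewrite (_ : _ * _ = e%:~R * e%:~R - 16 * f%:~R * f%:~R * I ^+ 2); last by ring.
  by rewrite I2; ring.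
have s00 : s0 != 0.
  by rewrite -sqrf_eq0 s02; apply: contraNneq DL0 => h; rewrite -DL h mul0r.
pose s0b := I * W / s0.
have Es0b : s0b \in E by rewrite rpredM ?rpredV // rpredM.
have s0b2 : s0b ^+ 2 = e%:~R - 4 * f%:~R * I.
  rewrite /s0b expr_div_n exprMn I2 W2 mulrNN mul1r -DL s02 mulrC mulKf // -s02 sqrf_eq0 //.
have fs0 : fa s0 \in E /\ (fa I = I -> fa s0 = s0 \/ fa s0 = - s0).
  have fs2 : fa s0 ^+ 2 = e%:~R + 4 * f%:~R * fa I by rewrite -rmorphXn /= s02 !sgE.
  case: fI => fI; rewrite fI in fs2 *.
    have : fa s0 ^+ 2 == s0 ^+ 2 by rewrite fs2 s02.
    by rewrite eqf_sqr => /orP[] /eqP ->; rewrite ?rpredN; split=> //; [left|right].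
  have : fa s0 ^+ 2 == s0b ^+ 2 by rewrite fs2 s0b2 mulrN.
  rewrite eqf_sqr => /orP[] /eqP ->; rewrite ?rpredN; split=> // /eqP.
    rewrite -subr_eq0 -opprD oppr_eq0 -mulr2n -mulr_natl mulf_eq0 (negbTE two0) /= => /eqP I0.
    by move: I2; rewrite I0 expr0n /= => /eqP; rewrite eq_sym oppr_eq0 oner_eq0.
  rewrite -subr_eq0 -opprD oppr_eq0 -mulr2n -mulr_natl mulf_eq0 (negbTE two0) /= => /eqP I0.
  by move: I2; rewrite I0 expr0n /= => /eqP; rewrite eq_sym oppr_eq0 oner_eq0.
have Evp : vp \in E by rewrite rpredD // rpredM.
have Ebe' : be' \in E by rewrite rpredB // rpredM // rpredM.
have Eal : al \in E by rewrite rpredM // ?rpredM // rpredD ?rpred1 // rpredM.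
have Ebe : be \in E by rewrite rpredD // rpredM // rpredM.
have fnu : fa nu \in E.
  suff [z Ez hz] : exists2 z, z \in E & (nu * fa nu) ^+ 2 = z ^+ 2.
    have : nu * fa nu \in E.
      by move/eqP: hz; rewrite eqf_sqr => /orP[] /eqP ->; rewrite ?rpredN.
    by move=> h; rewrite -(mulKf nu0 (fa nu)) rpredM ?rpredV.
  case: fI => fI.
    have f2 : fa nu ^+ 2 = vp * (al + be * fa s0) by rewrite -rmorphXn /= nu2 !sgE /= fI.
    case: (fs0.2 fI) => fs; rewrite fs in f2.
      by exists (nu ^+ 2); [exact: rpredX | rewrite exprMn f2 -nu2; ring].
    exists (vp * (s%:~R * I * (be' * s0b))); first by rewrite rpredM // rpredM // rpredM .
    transitivity (vp ^+ 2 * (al ^+ 2 - (be * s0) ^+ 2)).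
      by rewrite [LHS]exprMn f2 nu2; ring.
    rewrite (mu_al_sqr I2 s1 st) (mu_b_sqr x y s02).
    transitivity (vp ^+ 2 * (s%:~R ^+ 2 * I ^+ 2 * (be' ^+ 2 * s0b ^+ 2))); last by ring.
    have sC : s%:~R ^+ 2 = 1 :> L by rewrite -rmorphXn /= s1.
    by rewrite sC I2 s0b2; ring.
  exists (P * twisted_root fa I s0 x y t s); last first.
    apply: (nu_sg_nu (sg := fa) I2 s1 st s02 nu2 fI _ two0); exact: vp_conj.
  rewrite rpredM // /twisted_root rpredM ?rpredV //.
    by apply: rpredD; [apply: rpredD => //; apply: rpredM | do 2!apply: rpredM => //; by [exact: fs0.1 | exact: rpred_int]].
  by apply: rpredD; [exact: rpred1 | apply: rpredM => //; exact: rpred_int].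
move=> a; rewrite !inE => /or4P[] /eqP -> //.
- by case: fP => ->; rewrite ?rpredN.
- by case: fI => ->; rewrite ?rpredN.
- exact: fs0.1.
Qed.

Lemma mu_field_dim : (\dim E <= 8 * \dim <<k0; P>>)%N.
Proof.
rewrite 2!adjoin_cons; set F := <<<<k0; P>>%AS; I>>%AS.
have FI : I \in F by exact: memv_adjoin.
have Fvp : vp \in F by apply: rpredD; [|apply: rpredM => //]; exact: rpred_int.
have d1 : (\dim F <= 2 * \dim <<k0; P>>)%N.
  by apply: dim_adjoin_sqrt; rewrite I2 rpredN rpred1.
have d2 : (\dim <<F; s0>> <= 2 * \dim F)%N.
  apply: dim_adjoin_sqrt; rewrite s02; apply: rpredD; first exact: rpred_int.
  by apply: rpredM; [apply: rpredM; [exact: rpred_nat | exact: rpred_int] | exact: FI].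
have d3 : (\dim <<<<F; s0>>%AS; nu>> <= 2 * \dim <<F; s0>>)%N.
  have sF z : z \in F -> z \in <<F; s0>>%VS by exact: subvP_adjoin.
  apply: dim_adjoin_sqrt; rewrite nu2; apply: rpredM; first exact: sF.
  apply: rpredD; last apply: rpredM; rewrite ?memv_adjoin //; apply: sF.
    apply: rpredM; first by apply: rpredM; [exact: rpred_nat | exact: rpred_int].
    by apply: rpredD; [exact: rpred1 | apply: rpredM => //; exact: rpred_int].
  apply: rpredD; first exact: rpred_int.
  by apply: rpredM => //; apply: rpredM; [exact: rpred_nat | exact: rpred_int].
rewrite adjoin_cons adjoin_seq1; apply: (leq_trans d3).
rewrite (_ : 8 = 2 * (2 * 2))%N // -!mulnA leq_pmul2l //.
by apply: (leq_trans d2); rewrite leq_pmul2l.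
Qed.

(** The square of such an automorphism negates [s0], and its fourth power negates [nu]. *)
Lemma mu_field_moving_order (u : gal_of E) : u \in 'Gal(E / k0)%g -> u I = - I -> u P = P ->
  [/\ (u ^+ 4)%g nu = - nu, (u ^+ 4)%g s0 = s0 & #[u]%g = 8%N].
Proof.
move=> Gu uI uP.
have uW : u W = W by apply: (fixed_gal _ Gu) => //; exact: subv_adjoin_seq.
have vpu : u (u vp) = vp by rewrite !rmorphE /= !rmorphM /= uI rmorphN /= uI opprK !rmorph_int.
have vpP : vp * u vp = P ^+ 2 by exact: vp_conj.
have e4 a : a \in E -> (u ^+ 4)%g a = u (u (u (u a))).
  by move=> Ea; rewrite !expgS expg0 mulg1 !galM ?memv_gal.
have h1 : (u ^+ 4)%g nu = - nu.
  by rewrite e4 //; apply: (sg4_nu (sg := u) I2 W2 s1 efD st s02 nu2 uI uW vpu).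
have h2 : (u ^+ 4)%g s0 = s0 by rewrite e4 //; apply: (sg4_s0 (sg := u) I2 W2 efD s02 uI uW).
have nN : - nu <> nu.
  move/eqP; rewrite eq_sym -subr_eq0 opprK -mulr2n -mulr_natl mulf_eq0 (negbTE two0) /=.
  by rewrite (negbTE nu0).
split=> //; have u8 : (u ^+ 8 = 1)%g.
  rewrite (_ : 8%N = (4 + 4)%N) // expgD; apply: (@gal_adjoin_seq_ext _ k0 rs).
  - by rewrite groupM ?groupX.
  - exact: group1.
  move=> a; rewrite !inE gal_id => ha.
  rewrite galM; last by case/or4P: ha => /eqP ->.
  case/or4P: ha => /eqP ->.
  - have hP : (u ^+ 4)%g P = P by rewrite e4 // !uP.
    by rewrite !hP.
  - have hI : (u ^+ 4)%g I = I by rewrite e4 // uI rmorphN /= uI opprK uI rmorphN /= uI opprK.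
    by rewrite !hI.
  - by rewrite !h2.
  - by rewrite h1 rmorphN /= h1 opprK.
have : (#[u]%g %| 8)%N by rewrite order_dvdn u8.
have : ~~ (#[u]%g %| 4)%N.
  by rewrite order_dvdn; apply/eqP => h; apply: nN; rewrite -h1 h gal_id.
have : (0 < #[u]%g)%N by exact: order_gt0.
case: #[u]%g => [|[|[|[|[|[|[|[|[|n]]]]]]]]] //.
Qed.

Let mu_field_card : (#|'Gal(E / k0)%g| * \dim k0 <= 8 * \dim <<k0; P>>)%N.
Proof.
have g := mu_field_galois.
by rewrite -(galois_dim g) divnK ?mu_field_dim // field_dimS // subv_adjoin_seq.
Qed.

(** The degree is at most 8, and an automorphism that moves [I] has order 8. *)
Lemma mu_field_C8 : P \in k0 -> I \notin k0 -> ('Gal(E / k0) \isog [set: 'Z_8])%g.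
Proof.
move=> kP kI.
have [u Gu uI] := gal_moving mu_field_galois EI kI.
have {}uI : u I = - I.
  have : (u I) ^+ 2 == I ^+ 2 by rewrite -rmorphXn /= I2 rmorphN1.
  by rewrite eqf_sqr (negbTE uI) => /eqP.
have uP : u P = P by apply: (fixed_gal _ Gu) => //; exact: subv_adjoin_seq.
have [_ _ o8] := mu_field_moving_order Gu uI uP.
have c8 : (#|'Gal(E / k0)%g| <= 8)%N.
  by move: mu_field_card; rewrite (Fadjoin_idP kP) leq_pmul2r // adim_gt0.
have eG : 'Gal(E / k0)%g = <[u]>%g.
  by apply/esym/eqP; rewrite eqEcard cycle_subG Gu -orderE o8.
have cZ : cyclic [set: 'Z_8]%g by apply/cyclicP; exists Zp1; exact: Zp_cycle.
rewrite eG isog_cyclic_card ?cycle_cyclic // cardsT card_ord -orderE o8; apply/andP; split=> //.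
Qed.

(** [u] moves [I] and fixes [P], [t0] moves [P] and fixes [I] and, after multiplication by
    [u ^ 2], also [s0]. As [nu * u nu] is [P] times an element fixed by [t0], the automorphism
    [t0] negates it, which is the relation [t0 u t0 = u ^ 5]. *)
Lemma mu_field_M42 : P \notin <<k0; I>>%VS -> I \notin <<k0; P>>%VS ->
  ('Gal(E / k0) \isog 'Mod_(16%N))%g.
Proof.
move=> kIP kPI; have gE := mu_field_galois.
have kE : (k0 <= E)%VS := subv_adjoin_seq _ _.
have sub a : a \in E -> (k0 <= <<k0; a>> <= E)%VS.
  by move=> Ea; rewrite subv_adjoin; apply/FadjoinP.
have [u Gu uI] := gal_moving (galoisS (sub _ EP) gE) EI kPI.
have [v Gv vP] := gal_moving (galoisS (sub _ EI) gE) EP kIP.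
have fixg a z (h : a \in E) : z \in 'Gal(E / <<k0; a>>)%g -> z a = a.
  by move=> Gz; apply: (fixed_gal _ Gz); [case/andP: (sub _ h) | exact: memv_adjoin].
have uP := fixg _ _ EP Gu; have vI := fixg _ _ EI Gv.
have {uI} uI : u I = - I.
  have : (u I) ^+ 2 == I ^+ 2 by rewrite -rmorphXn /= I2 rmorphN1.
  by rewrite eqf_sqr (negbTE uI) => /eqP.
have {vP} vP : v P = - P.
  have : (v P) ^+ 2 == P ^+ 2 by rewrite -rmorphXn /= P2 rmorph_nat.
  by rewrite eqf_sqr (negbTE vP) => /eqP.
have {}Gu : u \in 'Gal(E / k0)%g by apply: (fintype.subsetP (galS _ _)) Gu; exact: subv_adjoin.
have {}Gv : v \in 'Gal(E / k0)%g by apply: (fintype.subsetP (galS _ _)) Gv; exact: subv_adjoin.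
have fW z : z \in 'Gal(E / k0)%g -> z W = W by move=> Gz; apply: (fixed_gal _ Gz).
have [u4nu u4s0 o8] := mu_field_moving_order Gu uI uP.
have u2s0 : u (u s0) = - s0 := sg2_s0 I2 W2 efD s02 uI (fW _ Gu) DL0.
have [t0 [Gt tI tP ts0]] : exists t0, [/\ t0 \in 'Gal(E / k0)%g, t0 I = I, t0 P = - P & t0 s0 = s0].
  have : (v s0) ^+ 2 == s0 ^+ 2.
    by rewrite -rmorphXn /= s02 !rmorphE /= !rmorphM /= vI !rmorph_int rmorph_nat.
  rewrite eqf_sqr => /orP[] /eqP vs; first by exists v.
  exists (v * (u * u))%g; rewrite !groupM // !galM ?memv_gal //.
  by rewrite vI vP vs !rmorphN /= u2s0 uI rmorphN /= uI !opprK !uP.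
have ts0' : t0 (u s0) = u s0.
  have : (s0 * u s0) ^+ 2 == (I * W) ^+ 2.
    rewrite (sqrt_norm_sqr (sg := u) I2 efD s02 uI) exprMn I2 W2; apply/eqP; ring.
  have s00 : s0 != 0.
    apply: contraNneq DL0 => h.
    by rewrite -(sqrt_norm_sqr (sg := u) I2 efD s02 uI) sqrf_eq0 mulf_eq0; apply/orP; left; apply/eqP.
  move=> h; apply: (mulfI s00); rewrite -{1}ts0 -rmorphM /=.
  by move: h; rewrite eqf_sqr => /orP[] /eqP ->; rewrite ?rmorphN rmorphM /= tI fW.
have tmu : t0 (vp * mu) = vp * mu.
  by rewrite !(rmorphD, rmorphB, rmorphM, rmorphN, rmorph1, rmorph_nat, rmorph_int) /= tI ts0.
have [kp kp2 tnu] : exists2 kp : int, kp ^+ 2 = 1 & t0 nu = kp%:~R * nu.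
  have : (t0 nu) ^+ 2 == nu ^+ 2 by rewrite -rmorphXn /= nu2 tmu.
  by rewrite eqf_sqr => /orP[] /eqP ->; [exists 1; rewrite ?mul1r | exists (-1); rewrite // mulN1r].
have kC : kp%:~R ^+ 2 = 1 :> L by rewrite -rmorphXn /= kp2.
have tunu : t0 (u nu) = - (kp%:~R * u nu).
  have := nu_sg_nu (sg := u) I2 s1 st s02 nu2 uI (vp_conj uI) two0.
  set tr := twisted_root _ _ _ _ _ _ _ => htr.
  have ttr : t0 tr = tr.
    rewrite /tr /twisted_root.
    by rewrite !(rmorphD, rmorphB, rmorphM, rmorphN, rmorph1, rmorph_nat, rmorph_int, fmorphV) /= tI ts0 ts0'.
  have h : t0 (nu * u nu) = - (nu * u nu).
    by move/eqP: htr; rewrite eqf_sqr => /orP[] /eqP ->; rewrite ?rmorphN rmorphM /= tP ttr; ring.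
  apply: (mulfI nu0); move: h; rewrite rmorphM /= tnu => h.
  have -> : nu * t0 (u nu) = kp%:~R * (kp%:~R * nu * t0 (u nu)).
    by rewrite !mulrA -expr2 kC mul1r.
  by rewrite h; ring.
have t2 : (t0 ^+ 2 = 1)%g.
  apply: (@gal_adjoin_seq_ext _ k0 rs); [by rewrite groupX | exact: group1 |].
  move=> a; rewrite !inE gal_id expgS expg1 => ha.
  rewrite galM; last by case/or4P: ha => /eqP ->.
  case/or4P: ha => /eqP ->; rewrite ?tI ?ts0 ?ts0 //.
    by rewrite tP rmorphN /= tP opprK.
  by rewrite tnu rmorphM /= tnu rmorph_int mulrA -expr2 kC mul1r.
have rel : (t0 * u * t0 = u ^+ 5)%g.
  apply: (@gal_adjoin_seq_ext _ k0 rs); [by rewrite !groupM | by rewrite groupX |].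
  move=> a; rewrite !inE => ha.
  have Ea : a \in E by case/or4P: ha => /eqP ->.
  have eL : (t0 * u * t0)%g a = t0 (u (t0 a)) by rewrite galM // galM ?memv_gal.
  have u4 b : b \in E -> (u ^+ 4)%g b = u (u (u (u b))).
    by move=> Eb; rewrite !expgS expg0 mulg1 !galM ?memv_gal.
  have eR : (u ^+ 5)%g a = u (u (u (u (u a)))).
    by rewrite expgSr galM // u4.
  rewrite eL eR; case/or4P: ha => /eqP ->.
  - by rewrite tP !uP rmorphN /= uP rmorphN /= tP opprK.
  - by rewrite tI; do 6!rewrite ?rmorphN /= ?uI; rewrite tI ?opprK.
  - by rewrite ts0 ts0' u2s0; do 3!rewrite ?rmorphN /= ?u2s0; rewrite ?opprK.
  - rewrite tnu rmorphM /= rmorph_int rmorphM /= rmorph_int tunu.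
    rewrite mulrN mulrA -expr2 kC mul1r.
    by rewrite -[u (u (u (u nu)))]u4 // u4nu rmorphN.
pose H := (<[u]> <*> <[t0]>)%G.
have HG : H \subset 'Gal(E / k0)%g by rewrite join_subG !cycle_subG Gu.
have u8 : (u ^+ 8 = 1)%g by rewrite -o8 expg_order.
have hH : (H \homg 'Mod_(16%N))%g.
  rewrite M42_presentation; apply/existsP; exists (u, t0) => /=.
  by rewrite !xpair_eqE eqxx andTb u8 t2 rel !eqxx.
have cG : (#|'Gal(E / k0)%g| <= 16)%N.
  have d2 : (\dim <<k0; P>> <= 2 * \dim k0)%N.
    by apply: dim_adjoin_sqrt; rewrite P2 rpred_nat.
  rewrite -(leq_pmul2r (adim_gt0 k0)); apply: (leq_trans mu_field_card).
  by rewrite (_ : 16 = 8 * 2)%N // -mulnA leq_pmul2l.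
have cH : (16 <= #|H|)%N.
  have uH : <[u]>%g \subset H by exact: joing_subl.
  have tH : t0 \in H by rewrite (fintype.subsetP (joing_subr _ _)) ?cycle_id.
  have : (8 %| #|H|)%N by rewrite -o8 cardSg.
  have : (8 < #|H|)%N.
    rewrite -o8 ltn_neqAle subset_leq_card // andbT; apply/eqP => e8.
    have eH : <[u]>%g = H by apply/eqP; rewrite eqEcard uH -orderE e8 leqnn.
    move: tH; rewrite -eH => /cycleP[n tn].
    have unP m : (u ^+ m)%g P = P.
      by elim: m => [|m IH]; rewrite ?expg0 ?gal_id // expgS galM // uP.
    have P0 : P != 0 by rewrite -sqrf_eq0 P2 natL.
    move: tP; rewrite tn unP => /eqP.
    by rewrite -subr_eq0 opprK -mulr2n -mulr_natl mulf_eq0 (negbTE two0) (negbTE P0).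
  by move=> c8 /dvdnP[m em]; rewrite em in c8 *; case: m em c8 => [|[|m]] // _ _; lia.
have iH : (H \isog 'Mod_(16%N))%g.
  rewrite isogEcard hH /=; have := @card_modular_group 2 4 isT isT; rewrite (_ : 2 ^ 4 = 16)%N //. by move=> ->.
suff -> : 'Gal(E / k0)%g = H by [].
by apply/esym/eqP; rewrite eqEcard HG (leq_trans cG).
Qed.
End MuField.

Local Open Scope classical_set_scope.

(** * Subfields and quadratic extensions *)

Section Subfield.
Variables (E : set algC) (hE : subfield_set E).

Lemma sf1 : E 1. Proof. by case: hE. Qed.
Lemma sfB x y : E x -> E y -> E (x - y). Proof. by case: hE => _ + _; exact. Qed.
Lemma sf_div x y : E x -> E y -> E (x / y). Proof. by case: hE => _ _; exact. Qed.
Lemma sf0 : E 0. Proof. by rewrite -(subrr 1); apply: sfB; exact: sf1. Qed.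
Lemma sfN x : E x -> E (- x). Proof. by move=> Ex; rewrite -sub0r; apply: sfB => //; exact: sf0. Qed.
Lemma sfD x y : E x -> E y -> E (x + y).
Proof. by move=> Ex Ey; rewrite -[y]opprK; apply: sfB => //; exact: sfN. Qed.
Lemma sfV x : E x -> E x^-1. Proof. by move=> Ex; rewrite -div1r; apply: sf_div => //; exact: sf1. Qed.
Lemma sfM x y : E x -> E y -> E (x * y).
Proof. by move=> Ex Ey; rewrite -[y]invrK; apply: sf_div => //; exact: sfV. Qed.
Lemma sfX x n : E x -> E (x ^+ n).
Proof.
move=> Ex; elim: n => [|n IH]; first by rewrite expr0; exact: sf1.
by rewrite exprS; apply: sfM.
Qed.
Lemma sf_nat n : E n%:R.
Proof. by elim: n => [|n IH]; [exact: sf0 | rewrite -addn1 natrD; apply: sfD => //; exact: sf1]. Qed.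
Lemma sf_int (n : int) : E n%:~R.
Proof. by case: (intP n) => [|m|m]; rewrite ?rmorphN /=; try apply: sfN; exact: sf_nat. Qed.
Lemma sf_rat x : x \in Crat -> E x.
Proof.
move=> /CratP[r ->]; rewrite -[r]divq_num_den fmorph_div /= !ratr_int.
by apply: sf_div; exact: sf_int.
Qed.
Lemma sf_Crat_sub : ratC `<=` E. Proof. by move=> x /sf_rat. Qed.
End Subfield.

Lemma ratC_subfield : subfield_set ratC.
Proof.
split; rewrite /ratC /=; first exact: rpred1.
- by move=> x y; apply: rpredB.
- by move=> x y; apply: rpred_div.
Qed.

Lemma smallest_subfield_set (A : set algC) : subfield_set (smallest subfield_set A).
Proof.
split.
- by move=> F [[F1 _ _] _].
- by move=> x y hx hy F hF; case: (hF) => -[_ FB _] _; apply: FB; [exact: hx | exact: hy].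
- by move=> x y hx hy F hF; case: (hF) => -[_ _ FD] _; apply: FD; [exact: hx | exact: hy].
Qed.

Lemma adjoin_subfield E s : subfield_set (adjoin E s).
Proof. exact: smallest_subfield_set. Qed.

Lemma adjoin_base E s : E `<=` adjoin E s.
Proof. by move=> x Ex F [_]; apply; left. Qed.

Lemma adjoin_gen E s x : x \in s -> adjoin E s x.
Proof. by move=> xs F [_]; apply; right. Qed.

Lemma adjoin_min E s F : subfield_set F -> E `<=` F -> (forall x, x \in s -> F x) ->
  adjoin E s `<=` F.
Proof. by move=> hF EF sF x; apply; split=> // y [/EF|/sF]. Qed.

Lemma adjoin_eqP E s t : (forall x, x \in s -> adjoin E t x) ->
  (forall x, x \in t -> adjoin E s x) -> adjoin E s = adjoin E t.
Proof.
move=> h1 h2; apply/seteqP; split; apply: adjoin_min => //;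
  by [exact: adjoin_subfield | exact: adjoin_base].
Qed.

Lemma subfield_adjoin_nil E : subfield_set E -> adjoin E [::] = E.
Proof. by move=> hE; apply/seteqP; split; [apply: adjoin_min | exact: adjoin_base]. Qed.

(** The quadratic extension [E(x)] for [x ^ 2] in [E]. *)
Definition quad (E : set algC) (x : algC) : set algC :=
  [set z | exists u v, [/\ E u, E v & z = u + v * x]].

Section Quad.
Variables (E : set algC) (x : algC).
Hypotheses (hE : subfield_set E) (Ex : E (x ^+ 2)).

Lemma quad_base : E `<=` quad E x.
Proof. by move=> u Eu; exists u, 0; split=> //; [exact: sf0 | rewrite mul0r addr0]. Qed.

Lemma quad_gen : quad E x x.
Proof. by exists 0, 1; split; [exact: sf0|exact: sf1|rewrite add0r mul1r]. Qed.

Lemma quad_mul z t : quad E x z -> quad E x t -> quad E x (z * t).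
Proof.
move=> [u [v [Eu Ev ->]]] [u' [v' [Eu' Ev' ->]]].
exists (u * u' + v * v' * x ^+ 2), (u * v' + v * u'); split; last by ring.
  by apply: (sfD hE); apply: (sfM hE) => //; apply: (sfM hE).
by apply: (sfD hE); apply: (sfM hE).
Qed.

(** When the norm [u ^ 2 - v ^ 2 * x ^ 2] vanishes, [x] itself lies in [E] or the element
    is zero. *)
Lemma quad_inv z : quad E x z -> quad E x z^-1.
Proof.
move=> [u [v [Eu Ev ->]]].
pose N := u ^+ 2 - v ^+ 2 * x ^+ 2.
have EN : E N by apply: (sfB hE); [|apply: (sfM hE) => //]; apply: (sfX hE).
have [N0|N0] := eqVneq N 0; last first.
  exists (u / N), (- v / N); split; [exact: (sf_div hE)|apply: (sf_div hE) => //; exact: (sfN hE)|].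
  have e : (u + v * x) * (u - v * x) = N by rewrite /N; ring.
  have n1 : u + v * x != 0 by apply: contraNneq N0 => h; rewrite -e h mul0r.
  apply: (mulfI n1); rewrite divff //.
  have -> : (u + v * x) * (u / N + - v / N * x) = (u + v * x) * (u - v * x) / N by ring.
  by rewrite e divff.
have : (u + v * x) * (u - v * x) == 0 by rewrite -N0 /N; apply/eqP; ring.
rewrite mulf_eq0 => /orP[/eqP ->|]; first by rewrite invr0; apply: quad_base; exact: sf0.
rewrite subr_eq0 => /eqP <-; apply: quad_base; apply: (sfV hE); exact: (sfD hE).
Qed.

Lemma quad_subfield : subfield_set (quad E x).
Proof.
split.
- by apply: quad_base; exact: sf1.
- move=> _ _ [u [v [Eu Ev ->]]] [u' [v' [Eu' Ev' ->]]].
  by exists (u - u'), (v - v'); split; [exact: (sfB hE)|exact: (sfB hE)|ring].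
- by move=> z t hz ht; apply: quad_mul => //; exact: quad_inv.
Qed.

Lemma adjoin_quad_cons s : adjoin E (x :: s) = adjoin (quad E x) s.
Proof.
apply/seteqP; split.
  apply: adjoin_min; first exact: adjoin_subfield.
    by move=> z Ez; apply: adjoin_base; exact: quad_base.
  move=> z; rewrite inE => /orP[/eqP ->|zs]; last exact: adjoin_gen.
  by apply: adjoin_base; exact: quad_gen.
have hA : subfield_set (adjoin E (x :: s)) := adjoin_subfield _ _.
apply: adjoin_min => //; last by move=> z zs; apply: adjoin_gen; rewrite inE zs orbT.
move=> _ [u [v [Eu Ev ->]]]; apply: (sfD hA); first exact: adjoin_base.
by apply: (sfM hA); [exact: adjoin_base | apply: adjoin_gen; rewrite inE eqxx].
Qed.
End Quad.

Lemma Aint_integralP (x : algC) : x \in Aint <-> integralOver (intr : int -> algC) x.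
Proof.
split=> [Ax|[p mp px]]; last first.
  apply: (root_monic_Aint px); first exact: monic_map.
  by apply/polyOverP => i; rewrite coef_map intr_int.
have [r [_ mr] dr] := minCpolyP x; have /floorpP[s se] := Ax.
exists s; last by rewrite -se root_minCpoly.
have := minCpoly_monic x; rewrite se !monicE lead_coef_map_inj //; last exact: intr_inj.
by move/eqP => h; apply/eqP/(@intr_inj algC).
Qed.

Lemma Aint_quadratic (z t n : algC) : t \in Aint -> n \in Aint ->
  z ^+ 2 - t * z + n = 0 -> z \in Aint.
Proof.
move=> /Aint_integralP it /Aint_integralP i_n hz; apply/Aint_integralP.
pose p := Poly [:: n; - t; 1].
have sp : polyseq p = [:: n; - t; 1] by rewrite (PolyK (c := 0)) //= oner_neq0.
apply: (@integral_root_monic _ _ intr z p).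
- by rewrite monicE lead_coefE sp.
- rewrite rootE horner_Poly /= mul0r add0r mul1r; apply/eqP; rewrite -hz; ring.
- rewrite sp => u; rewrite !inE => /or3P[] /eqP -> //; first exact: integral_opp.
  exact: integral1.
Qed.

Lemma Aint_sqrt (z : algC) : z ^+ 2 \in Aint -> z \in Aint.
Proof.
move=> hz; apply: (@Aint_quadratic z 0 (- z ^+ 2)); rewrite ?rpredN ?Aint0 //.
by rewrite mul0r subr0 subrr.
Qed.

Lemma prime_mul_squarefree (p q : nat) (l : nat) : prime p -> prime q -> p != q -> prime l ->
  ~~ (l ^ 2 %| p * q)%N.
Proof.
move=> pp pq npq pl; apply/negP => hl.
have : (l %| p * q)%N by apply: dvdn_trans hl; rewrite -mulnn dvdn_mulr.
rewrite Euclid_dvdM // !dvdn_prime2 // => /orP[] /eqP le; move: hl; rewrite le -mulnn.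
  by rewrite dvdn_pmul2l ?prime_gt0 // dvdn_prime2 // (negbTE npq).
by rewrite dvdn_pmul2r ?prime_gt0 // dvdn_prime2 // eq_sym (negbTE npq).
Qed.

Lemma squarefree_mul_sqr_int (D : nat) (y : algC) : (forall l, prime l -> ~~ (l ^ 2 %| D)%N) ->
  y \in Crat -> D%:R * y ^+ 2 \in Num.int -> y \in Num.int.
Proof.
move=> sf /CratP[r ->] /intrP[m hm].
have den0 : (denq r)%:~R != 0 :> algC by rewrite intr_eq0 denq_neq0.
have e : D%:Z * numq r ^+ 2 = m * denq r ^+ 2.
  apply: (@intr_inj algC); rewrite [LHS]rmorphM [RHS]rmorphM /= !rmorphXn /= -hm.
  have -> : ratr r = (numq r)%:~R / (denq r)%:~R :> algC.
    by rewrite -[in LHS](divq_num_den r) fmorph_div /= !ratr_int.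
  by field.
have c1 : coprimez (denq r ^+ 2) (numq r ^+ 2).
  by rewrite coprimezE !abszX coprimeXl // coprimeXr // coprime_sym coprime_num_den.
have dD : (denq r ^+ 2 %| D%:Z)%Z.
  by rewrite -(Gauss_dvdzl _ c1) e; exact/dvdz_mull/dvdzz.
have d1 : `|denq r|%N = 1%N.
  apply/eqP; apply: contraT => dn1; have dn0 : (0 < `|denq r|)%N by rewrite absz_gt0 denq_neq0.
  have d2 : (1 < `|denq r|)%N by rewrite ltn_neqAle eq_sym dn1.
  case/negP: (sf _ (pdiv_prime d2)); move: dD; rewrite dvdzE abszX /=; apply: dvdn_trans.
  by rewrite dvdn_exp2r // pdiv_dvd.
have -> : r = (numq r)%:~R.
  rewrite -[LHS]divq_num_den -(gez0_abs (denq_ge0 r)) d1 divr1 //.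
by rewrite ratr_int intr_int.
Qed.

Section QuadraticRing.
Variables (D : nat) (w : algC).
Hypotheses (D1 : (D %% 4 = 1)%N) (sD : forall l, prime l -> ~~ (l ^ 2 %| D)%N).
Hypothesis (ww : w ^+ 2 = - D%:R).
Local Notation k := (quad ratC w).

Let D0 : (0 < D)%N. Proof. by move: D1; clear; lia. Qed.

Lemma imag_sqrt_conj : w^* = - w.
Proof.
have : (w^*) ^+ 2 == w ^+ 2 by rewrite -rmorphXn /= ww rmorphN rmorph_nat.
rewrite eqf_sqr => /orP[/eqP h|/eqP //].
have : w \is Num.real by apply/CrealP.
move/real_exprn_even_ge0 => /(_ 2 isT); rewrite ww oppr_ge0 lern0 => /eqP e.
by move: D0; rewrite e.
Qed.

Lemma w_Aint : w \in Aint.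
Proof. by apply: Aint_sqrt; rewrite ww rpredN rpred_nat. Qed.

(** Trace and norm of [x + y * w] are [2 * x] and [x ^ 2 + D * y ^ 2]; as [D] is [1] modulo
    [4], half-integers are excluded. *)
Lemma quad_ratC_int z : int_ring k z <-> exists x y : int, z = x%:~R + y%:~R * w.
Proof.
split; last first.
  move=> [x [y ->]]; split; first by exists x%:~R, y%:~R; split=> //; rewrite /ratC /=; exact: rpred_int.
  by rewrite rpredD ?rpredM ?Aint_int ?w_Aint.
move=> [[u [v [ru rv ->]]] iz]; rewrite /ratC /= in ru rv.
have cz : (u + v * w)^* = u - v * w.
  rewrite rmorphD rmorphM /= imag_sqrt_conj mulrN.
  by rewrite !(CrealP _) ?Creal_Crat.
have icz : u - v * w \in Aint by rewrite -cz (Aint_aut Num.conj).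
have [X Xe] : exists X : int, 2 * u = X%:~R.
  apply/intrP/Cint_rat_Aint; first by rewrite rpredM ?rpred_nat.
  have -> : 2 * u = (u + v * w) + (u - v * w) by ring.
  exact: rpredD.
have [Y Ye] : exists Y : int, 2 * v = Y%:~R.
  apply/intrP/(@squarefree_mul_sqr_int D) => //; first by rewrite rpredM ?rpred_nat.
  apply: Cint_rat_Aint; first by rewrite rpredM ?rpredX ?rpredM ?rpred_nat.
  have -> : D%:R * (2 * v) ^+ 2 = - ((u + v * w) - (u - v * w)) ^+ 2.
    have -> : u + v * w - (u - v * w) = 2 * v * w by ring.
    by rewrite [in RHS]exprMn ww; ring.
  by rewrite rpredN; apply: rpredX; exact: rpredB.
have [M Me] : exists M : int, (u + v * w) * (u - v * w) = M%:~R.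
  apply/intrP/Cint_rat_Aint; last exact: rpredM.
  have -> : (u + v * w) * (u - v * w) = u ^+ 2 - v ^+ 2 * w ^+ 2 by ring.
  by rewrite ww rpredB ?rpredX // rpredM ?rpredX // rpredN rpred_nat.
have hXY : X ^+ 2 + D%:Z * Y ^+ 2 = 4 * M.
  apply: (@intr_inj algC); rewrite rmorphD rmorphXn [in LHS]rmorphM rmorphXn [RHS]rmorphM /= -Xe -Ye -Me.
  rewrite (_ : (u + v * w) * (u - v * w) = u ^+ 2 - v ^+ 2 * w ^+ 2); last by ring.
  by rewrite ww; ring.
have [j De] : exists j : int, D%:Z = 4 * j + 1 by exists (D %/ 4)%N%:Z; move: D1; clear; lia.
have two0 : 2 != 0 :> algC by rewrite pnatr_eq0.
case: (int_parity X) => [] [x [xe _]]; case: (int_parity Y) => [] [y [ye _]].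
- exists x, y; congr (_ + _ * _); apply: (mulfI two0).
    by rewrite Xe xe intrM.
  by rewrite Ye ye intrM.
- by exfalso; move: hXY; rewrite xe ye De; clear; lia.
- by exfalso; move: hXY; rewrite xe ye De; clear; lia.
- by exfalso; move: hXY; rewrite xe ye De; clear; lia.
Qed.
End QuadraticRing.

(** * Ideal classes of binary quadratic forms *)

Section TwoGenerated.
Variable O : set algC.
Hypotheses (O1 : O 1) (OB : forall x y, O x -> O y -> O (x - y))
  (OM : forall x y, O x -> O y -> O (x * y)).

Let O0 : O 0. Proof. by rewrite -(subrr 1); apply: OB. Qed.
Let ON x : O x -> O (- x). Proof. by move=> Ox; rewrite -sub0r; apply: OB. Qed.
Let OD x y : O x -> O y -> O (x + y).
Proof. by move=> Ox Oy; rewrite -[y]opprK; apply: OB => //; apply: ON. Qed.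

(** The ideal [(a, b)]. *)
Definition gen2 (a b : algC) : set algC :=
  [set z | exists u v, [/\ O u, O v & z = u * a + v * b]].

Lemma gen2D a b x y : gen2 a b x -> gen2 a b y -> gen2 a b (x + y).
Proof.
move=> [u [v [Ou Ov ->]]] [u' [v' [Ou' Ov' ->]]].
by exists (u + u'), (v + v'); split; [exact: OD|exact: OD|ring].
Qed.

Lemma gen2M a b r x : O r -> gen2 a b x -> gen2 a b (r * x).
Proof.
move=> Or [u [v [Ou Ov ->]]].
by exists (r * u), (r * v); split; [exact: OM|exact: OM|ring].
Qed.

Lemma gen2_0 a b : gen2 a b 0.
Proof. by exists 0, 0; split=> //; ring. Qed.

Lemma gen2_l a b : gen2 a b a.
Proof. by exists 1, 0; split=> //; ring. Qed.

Lemma gen2_r a b : gen2 a b b.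
Proof. by exists 0, 1; split=> //; ring. Qed.

Lemma gen2_ideal a b : O a -> O b -> is_ideal O (gen2 a b).
Proof.
move=> Oa Ob; split.
- by move=> _ [u [v [Ou Ov ->]]]; apply: OD; apply: OM.
- exact: gen2_0.
- exact: gen2D.
- by move=> r x; apply: gen2M.
Qed.

Lemma gen2_sub a b c d : gen2 c d a -> gen2 c d b -> gen2 a b `<=` gen2 c d.
Proof. by move=> ha hb _ [u [v [Ou Ov ->]]]; apply: gen2D; apply: gen2M. Qed.

Lemma gen2_eq a b c d : gen2 c d a -> gen2 c d b -> gen2 a b c -> gen2 a b d ->
  gen2 a b = gen2 c d.
Proof. by move=> ha hb hc hd; apply/seteqP; split; apply: gen2_sub. Qed.

Lemma ideal_prod_min (I J K : set algC) : K 0 -> (forall x y, K x -> K y -> K (x + y)) ->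
  (forall x y, I x -> J y -> K (x * y)) -> ideal_prod I J `<=` K.
Proof.
move=> K0 KD h _ [s hs ->]; elim: s hs => [|u s IH] hs; first by rewrite big_nil.
rewrite big_cons; apply: KD.
  by have [h1 h2] := hs u (mem_head _ _); apply: h.
by apply: IH => t ts; apply: hs; rewrite inE ts orbT.
Qed.

Lemma ideal_prod_mul (I J : set algC) x y : I x -> J y -> ideal_prod I J (x * y).
Proof.
move=> Ix Jy; exists [:: (x, y)]; last by rewrite big_seq1.
by move=> u; rewrite inE => /eqP ->.
Qed.

Lemma ideal_prodD (I J : set algC) x y :
  ideal_prod I J x -> ideal_prod I J y -> ideal_prod I J (x + y).
Proof.
move=> [s hs ->] [t ht ->]; exists (s ++ t); last by rewrite big_cat.
by move=> u; rewrite mem_cat => /orP[/hs|/ht].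
Qed.

Lemma ideal_prod_scale a b (J : set algC) r x : O r ->
  ideal_prod (gen2 a b) J x -> ideal_prod (gen2 a b) J (r * x).
Proof.
move=> Or; apply: (ideal_prod_min (K := [set x | ideal_prod (gen2 a b) J (r * x)])) => /=.
- by rewrite mulr0; exists [::] => //; rewrite big_nil.
- by move=> y z hy hz; rewrite mulrDr; apply: ideal_prodD.
- by move=> y z Iy Jz; rewrite mulrA; apply: ideal_prod_mul => //; apply: gen2M.
Qed.

Lemma ideal_prodC (I J : set algC) : ideal_prod I J = ideal_prod J I.
Proof.
have h K L : ideal_prod K L `<=` ideal_prod L K.
  apply: ideal_prod_min; first by exists [::] => //; rewrite big_nil.
    by move=> x y; apply: ideal_prodD.
  by move=> x y Kx Ly; rewrite mulrC; apply: ideal_prod_mul.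
by apply/seteqP; split; exact: h.
Qed.

Lemma ideal_prod_gen2 a b c d e f :
    gen2 e f (a * c) -> gen2 e f (a * d) -> gen2 e f (b * c) -> gen2 e f (b * d) ->
    ideal_prod (gen2 a b) (gen2 c d) e -> ideal_prod (gen2 a b) (gen2 c d) f ->
  ideal_prod (gen2 a b) (gen2 c d) = gen2 e f.
Proof.
move=> ac ad bc bd he hf; apply/seteqP; split.
  apply: ideal_prod_min; [exact: gen2_0|exact: gen2D|].
  move=> _ _ [u [v [Ou Ov ->]]] [u' [v' [Ou' Ov' ->]]].
  rewrite (_ : _ * _ = u * u' * (a * c) + u * v' * (a * d) + (v * u' * (b * c) + v * v' * (b * d))); last by ring.
  by do !apply: gen2D; apply: gen2M => //; apply: OM.
by move=> _ [u [v [Ou Ov ->]]]; apply: ideal_prodD; apply: ideal_prod_scale.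
Qed.

Section ClassMap.
Variables (gT : finGroupType) (Cl : {group gT}) (cl : set algC -> gT).
Hypotheses (clin : forall I, nz_ideal O I -> cl I \in Cl)
  (clsurj : forall g, g \in Cl -> exists2 I, nz_ideal O I & cl I = g)
  (clM : forall I J, nz_ideal O I -> nz_ideal O J -> cl (ideal_prod I J) = (cl I * cl J)%g)
  (clE : forall I J, nz_ideal O I -> nz_ideal O J -> (cl I = cl J <-> ideal_equiv O I J)).

Lemma class_group_abelian : abelian Cl.
Proof.
apply/centsP => _ /clsurj[I hI <-] _ /clsurj[J hJ <-].
by rewrite /commute -!clM // ideal_prodC.
Qed.

Lemma gen2_nz a b : O a -> O b -> a != 0 -> nz_ideal O (gen2 a b).
Proof. by move=> Oa Ob a0; split; [exact: gen2_ideal | exists a => //; exact: gen2_l]. Qed.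

Lemma gen2_10 : gen2 1 0 = O.
Proof.
apply/seteqP; split=> x; first by case: (gen2_ideal O1 O0) => + _ _ _; apply.
by move=> Ox; exists x, 0; split=> //; ring.
Qed.

Lemma class_unit : cl (gen2 1 0) = 1%g.
Proof.
have hI := gen2_nz O1 O0 (oner_neq0 _).
have e : ideal_prod (gen2 1 0) (gen2 1 0) = gen2 1 0.
  apply: ideal_prod_gen2; rewrite ?mulr0 ?mul0r ?mulr1; try exact: gen2_0; try exact: gen2_l.
    by rewrite -[X in ideal_prod _ _ X]mulr1; apply: ideal_prod_mul; exact: gen2_l.
  by rewrite -[X in ideal_prod _ _ X](mulr0 1); apply: ideal_prod_mul; [exact: gen2_l | exact: gen2_0].
by apply: (mulgI (cl (gen2 1 0))); rewrite -clM // e mulg1.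
Qed.

Lemma class_principal x : O x -> x != 0 -> cl (gen2 x 0) = 1%g.
Proof.
move=> Ox x0; rewrite -class_unit; apply/clE; try exact: gen2_nz; first exact: (gen2_nz O1 O0 (oner_neq0 _)).
exists 1, x; split=> //; first exact: oner_neq0.
apply/seteqP; split=> _ [z [u [v [Ou Ov ->]]] <-].
  by exists u; [rewrite gen2_10 | ring].
by exists (x * u); [exists u, 0; split=> //; ring | ring].
Qed.

Lemma class_trivialP a b : O a -> O b -> a != 0 -> cl (gen2 a b) = 1%g ->
  exists2 t, gen2 a b t & forall z, gen2 a b z -> exists2 s, O s & z = t * s.
Proof.
move=> Oa Ob a0; rewrite -class_unit => /clE-/(_ (gen2_nz Oa Ob a0) (gen2_nz O1 O0 (oner_neq0 _))).
rewrite gen2_10 => -[x [y [Ox Oy x0 y0 e]]].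
have [t It ty] : [set x * u | u in gen2 a b] y.
  by rewrite e; exists 1; rewrite ?mulr1.
exists t => // z Iz.
have : [set y * u | u in O] (x * z) by rewrite -e; exists z.
case=> s Os sz; exists s => //; apply: (mulfI x0).
by rewrite -sz -ty mulrA.
Qed.
End ClassMap.
End TwoGenerated.

Section IntRing.
Variables (E : set algC) (hE : subfield_set E).
Local Notation O := (int_ring E).
Lemma int_ring1 : O 1. Proof. by split; [exact: sf1 | exact: Aint1]. Qed.
Lemma int_ringB x y : O x -> O y -> O (x - y).
Proof. by move=> [Ex Ax] [Ey Ay]; split; [exact: sfB | exact: rpredB]. Qed.
Lemma int_ringM x y : O x -> O y -> O (x * y).
Proof. by move=> [Ex Ax] [Ey Ay]; split; [exact: sfM | exact: rpredM]. Qed.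
Lemma int_ringD x y : O x -> O y -> O (x + y).
Proof. by move=> [Ex Ax] [Ey Ay]; split; [exact: sfD | exact: rpredD]. Qed.
Lemma int_ringN x : O x -> O (- x).
Proof. by move=> [Ex Ax]; split; [exact: sfN | rewrite rpredN]. Qed.
Lemma int_ringX x n : O x -> O (x ^+ n).
Proof. by move=> [Ex Ax]; split; [exact: sfX | exact: rpredX]. Qed.
Lemma int_ring_int (n : int) : O n%:~R.
Proof. by split; [exact: sf_int | exact: Aint_int]. Qed.
Lemma int_ring_nat (n : nat) : O n%:R. Proof. exact: (int_ring_int n). Qed.
End IntRing.

Section FormIdeals.
Variables (D : nat) (w : algC).
Hypotheses (D1 : (D %% 4 = 1)%N) (sD : forall l, prime l -> ~~ (l ^ 2 %| D)%N).
Hypothesis (ww : w ^+ 2 = - D%:R).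
Local Notation k := (quad ratC w).
Local Notation O := (int_ring k).

Let Rw : ratC (w ^+ 2). Proof. by rewrite ww /ratC /= rpredN rpred_nat. Qed.
Let hk : subfield_set k := quad_subfield ratC_subfield Rw.
Let O1 := int_ring1 hk.
Let OB := int_ringB hk.
Let OM := int_ringM hk.
Let OD := int_ringD hk.
Let Oint := int_ring_int hk.
Let Ow : O w. Proof. by split; [exact: quad_gen ratC_subfield | exact: w_Aint ww]. Qed.
Let Oxy (x y : int) : O (x%:~R + y%:~R * w). Proof. by apply: OD => //; apply: OM. Qed.

(** The ideal [(m, r + sqrt (- D))]; for [m] dividing [r ^ 2 + D] it has norm [m]. *)
Definition form_ideal (m r : int) : set algC := gen2 O m%:~R (r%:~R + w).

Let Orw (r : int) : O (r%:~R + w). Proof. by apply: OD. Qed.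

Lemma form_ideal_mod (m r s : int) : (m %| r - s)%Z -> form_ideal m r = form_ideal m s.
Proof.
move=> /dvdzP[j rs].
have e : r%:~R = s%:~R + j%:~R * m%:~R :> algC by rewrite -intrM -rmorphD -rs addrC subrK.
apply: gen2_eq => //; try exact: gen2_l.
- by exists j%:~R, 1; split=> //; rewrite e; ring.
- by exists (- j)%:~R, 1; split=> //; rewrite e rmorphN; ring.
Qed.

(** The product of the two ideals contains [m1 * m2], [m1 * (r + w)], [m2 * (r + w)] and
    [(r + w) ^ 2 = 2 * r * (r + w)] modulo [m1 * m2]; the Bezout relation extracts [r + w]. *)
Lemma form_ideal_mul (m1 m2 r u v t : int) : (m1 * m2 %| r ^+ 2 + D%:Z)%Z ->
  u * m1 + v * m2 + t * (2 * r) = 1 ->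
  ideal_prod (form_ideal m1 r) (form_ideal m2 r) = form_ideal (m1 * m2) r.
Proof.
move=> /dvdzP[j jr] huv.
have jr' : (r%:~R + w) * (r%:~R + w) = 2 * r%:~R * (r%:~R + w) - (j * (m1 * m2))%:~R.
  by rewrite -jr rmorphD rmorphXn /= -[D%:Z%:~R]/(D%:R) -[D%:R]opprK -ww; ring.
have huv' : u%:~R * m1%:~R + v%:~R * m2%:~R + t%:~R * (2 * r%:~R) = 1 :> algC.
  by rewrite -[RHS]/(1%:~R) -huv !rmorphD !rmorphM.
apply: ideal_prod_gen2 => //.
- by exists 1, 0; split=> //; [exact: (Oint 0) | rewrite intrM; ring].
- by exists 0, m1%:~R; split=> //; [exact: (Oint 0) | ring].
- by exists 0, m2%:~R; split=> //; [exact: (Oint 0) | ring].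
- by exists (- j)%:~R, (2 * r)%:~R; split=> //; rewrite jr' rmorphN !intrM; ring.
- by rewrite rmorphM; apply: ideal_prod_mul; exact: gen2_l.
have e : r%:~R + w = u%:~R * (m1%:~R * (r%:~R + w)) + (v%:~R * ((r%:~R + w) * m2%:~R)
    + (t%:~R * ((r%:~R + w) * (r%:~R + w)) + (t * j)%:~R * (m1%:~R * m2%:~R))).
  rewrite jr' -[LHS]mul1r -{1}huv' !intrM; ring.
rewrite [X in ideal_prod _ _ X]e.
do 3?[apply: ideal_prodD]; apply: ideal_prod_scale => //;
  apply: ideal_prod_mul; (exact: gen2_l || exact: gen2_r).
Qed.

Lemma form_ideal_principal (m x y r : int) : x ^+ 2 + D%:Z * y ^+ 2 = m -> coprimez y m ->
  (m %| x - r * y)%Z -> m != 0 -> form_ideal m r = gen2 O (x%:~R + y%:~R * w) 0.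
Proof.
move=> hm cym /dvdzP[j hj] m0.
have O0 : O 0 by exact: (Oint 0).
have hm' : m%:~R = (x%:~R - y%:~R * w) * (x%:~R + y%:~R * w).
  rewrite -hm rmorphD rmorphM !rmorphXn /= -[D%:Z%:~R]/(D%:R) -[D%:R]opprK -ww; ring.
have hx : x%:~R = j%:~R * m%:~R + r%:~R * y%:~R :> algC.
  by rewrite -!intrM -rmorphD -hj subrK.
have [i hi] : exists i, r * x + D%:Z * y = i * m.
  have : (m %| y * (r * x + D%:Z * y))%Z.
    rewrite (_ : _ * _ = m - (x - r * y) * x); last by rewrite -hm; ring.
    by rewrite hj; apply: rpredB; [exact: dvdzz | rewrite mulrAC; exact/dvdz_mull/dvdzz].
  by rewrite Gauss_dvdzr 1?coprimez_sym // => /dvdzP[i ->]; exists i.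
have Obar : O (x%:~R - y%:~R * w).
  by rewrite (_ : - _ = (- y)%:~R * w) //; rewrite rmorphN mulNr.
have Obar0 : x%:~R - y%:~R * w != 0.
  by apply: contra_neq m0 => h0; apply/eqP; rewrite -(intr_eq0 algC) hm' h0 mul0r.
have key : r%:~R + w = (i%:~R + j%:~R * w) * (x%:~R + y%:~R * w).
  apply: (mulfI Obar0); rewrite mulrCA -hm'.
  have -> : (x%:~R - y%:~R * w) * (r%:~R + w) =
      (r%:~R * x%:~R - y%:~R * w ^+ 2) + (x%:~R - r%:~R * y%:~R) * w by ring.
  rewrite {2}hx addrK ww mulrN opprK.
  have -> : r%:~R * x%:~R + y%:~R * D%:R = i%:~R * m%:~R :> algC.
    by rewrite -[D%:R]/(D%:Z%:~R) -!intrM -rmorphD -hi mulrC [y * _]mulrC [x * _]mulrC.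
  by ring.
apply: gen2_eq => //.
- by exists (x%:~R - y%:~R * w), 0; split=> //; rewrite hm'; ring.
- by exists (i%:~R + j%:~R * w), 0; split=> //; rewrite key; ring.
- by exists j%:~R, y%:~R; split=> //; rewrite hx; ring.
- by exists 0, 0; split=> //; ring.
Qed.

End FormIdeals.

Section ClassOfForms.
Variables (p q : nat) (w : algC).
Hypotheses (pp : prime p) (pq : prime q) (npq : p != q) (p4 : (p %% 4 = 1)%N) (q4 : (q %% 4 = 1)%N).
Local Notation D := (p * q)%N.
Hypothesis (ww : w ^+ 2 = - D%:R).
Local Notation k := (quad ratC w).
Local Notation O := (int_ring k).

Let D1 : (D %% 4 = 1)%N. Proof. by rewrite -modnMml p4 mul1n. Qed.
Let sD : forall l, prime l -> ~~ (l ^ 2 %| D)%N.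
Proof. by move=> l; apply: prime_mul_squarefree. Qed.
Let Rw : ratC (w ^+ 2). Proof. by rewrite ww /ratC /= rpredN rpred_nat. Qed.
Let hk : subfield_set k := quad_subfield ratC_subfield Rw.
Let O1 := int_ring1 hk.
Let OB := int_ringB hk.
Let OM := int_ringM hk.
Let OD := int_ringD hk.
Let Oint := int_ring_int hk.
Let Ow : O w. Proof. by split; [exact: quad_gen ratC_subfield | exact: w_Aint ww]. Qed.
Let Oxy (x y : int) : O (x%:~R + y%:~R * w). Proof. by apply: OD => //; apply: OM. Qed.
Let Orw (r : int) : O (r%:~R + w). Proof. by apply: OD. Qed.
Let p0 : (0 < p)%N. Proof. exact: prime_gt0. Qed.

Variables (gT : finGroupType) (Cl : {group gT}) (cl : set algC -> gT).
Hypotheses (clin : forall I, nz_ideal O I -> cl I \in Cl)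
  (clsurj : forall g, g \in Cl -> exists2 I, nz_ideal O I & cl I = g)
  (clM : forall I J, nz_ideal O I -> nz_ideal O J -> cl (ideal_prod I J) = (cl I * cl J)%g)
  (clE : forall I J, nz_ideal O I -> nz_ideal O J -> (cl I = cl J <-> ideal_equiv O I J)).

Local Notation I_ m r := (form_ideal w m r).
Local Notation c m r := (cl (form_ideal w m r)).

Lemma form_ideal_nz (m r : int) : m != 0 -> nz_ideal O (I_ m r).
Proof. by move=> m0; apply: gen2_nz => //; rewrite intr_eq0. Qed.

Lemma form_class_in (m r : int) : m != 0 -> c m r \in Cl.
Proof. by move=> m0; apply/clin/form_ideal_nz. Qed.

Lemma form_class_mul_coprime (m1 m2 r : int) : m1 != 0 -> m2 != 0 ->
  (m1 * m2 %| r ^+ 2 + D%:Z)%Z -> coprimez m1 m2 -> c (m1 * m2) r = (c m1 r * c m2 r)%g.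
Proof.
move=> m10 m20 h cm; have [u [v uv]] := Bezoutz m1 m2; rewrite (eqP cm) in uv.
rewrite -clM; try exact: form_ideal_nz.
by rewrite (form_ideal_mul ww (u := u) (v := v) (t := 0) h) // mul0r addr0.
Qed.

Lemma form_class_mul_2r (m1 m2 r : int) : m1 != 0 -> m2 != 0 ->
  (m1 * m2 %| r ^+ 2 + D%:Z)%Z -> coprimez m1 (2 * r) -> c (m1 * m2) r = (c m1 r * c m2 r)%g.
Proof.
move=> m10 m20 h cm; have [u [v uv]] := Bezoutz m1 (2 * r); rewrite (eqP cm) in uv.
rewrite -clM; try exact: form_ideal_nz.
by rewrite (form_ideal_mul ww (u := u) (v := 0) (t := v) h) // mul0r addr0.
Qed.

Lemma form_class_sqr (m r : int) : m != 0 ->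
  (m ^+ 2 %| r ^+ 2 + D%:Z)%Z -> coprimez m (2 * r) -> c (m ^+ 2) r = (c m r ^+ 2)%g.
Proof. by move=> m0 h cm; rewrite expgS expg1 -form_class_mul_2r. Qed.

Let class_princ x : O x -> x != 0 -> cl (gen2 O x 0) = 1%g.
Proof. by move=> Ox x0; apply: (class_principal O1 OB OM clM clE). Qed.

Lemma form_class_norm (m x y r : int) : m != 0 -> x ^+ 2 + D%:Z * y ^+ 2 = m -> coprimez y m ->
  (m %| x - r * y)%Z -> c m r = 1%g.
Proof.
move=> m0 hm cym hxy; rewrite (form_ideal_principal ww hm cym hxy m0).
apply: class_princ => //; apply: contra_neq m0 => h; apply/eqP; rewrite -(intr_eq0 algC).
rewrite -hm rmorphD rmorphM !rmorphXn /= -[D%:Z%:~R]/(D%:R) -[D%:R]opprK -ww.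
have -> : x%:~R ^+ 2 + - w ^+ 2 * y%:~R ^+ 2 = (x%:~R + y%:~R * w) * (x%:~R - y%:~R * w) by ring.
by rewrite h mul0r.
Qed.

Let O0 : O 0. Proof. exact: (Oint 0). Qed.

Lemma form_class_conj (m r : int) : m != 0 -> (m %| r ^+ 2 + D%:Z)%Z -> coprimez m (2 * r) ->
  (c m r * c m (- r) = 1)%g.
Proof.
move=> m0 /dvdzP[j jr] cm; have [u [v uv]] := Bezoutz m (2 * r); rewrite (eqP cm) in uv.
rewrite -clM; try exact: form_ideal_nz.
have uv' : u%:~R * m%:~R + v%:~R * (2 * r%:~R) = 1 :> algC.
  by rewrite -[RHS]/(1%:~R) -uv rmorphD !rmorphM.
have jr' : (r%:~R + w) * ((- r)%:~R + w) = - (j * m)%:~R.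
  by rewrite -jr rmorphD rmorphXn /= -[D%:Z%:~R]/(D%:R) -[D%:R]opprK -ww rmorphN; ring.
rewrite /form_ideal (@ideal_prod_gen2 O O1 OB OM _ _ _ _ m%:~R 0).
- by apply: class_princ; rewrite ?intr_eq0.
- by exists m%:~R, 0; split=> //; ring.
- by exists ((- r)%:~R + w), 0; split=> //; ring.
- by exists (r%:~R + w), 0; split=> //; ring.
- by exists (- j)%:~R, 0; split=> //; rewrite jr' rmorphN intrM; ring.
- have e : m%:~R = u%:~R * (m%:~R * m%:~R) + (v%:~R * ((r%:~R + w) * m%:~R)
     + (- v)%:~R * (m%:~R * ((- r)%:~R + w))).
    transitivity ((u%:~R * m%:~R + v%:~R * (2 * r%:~R)) * m%:~R : algC).
      by rewrite uv' mul1r.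
    by rewrite !rmorphN; ring.
  rewrite [X in ideal_prod _ _ X]e.
  by do 2?[apply: ideal_prodD]; apply: ideal_prod_scale => //;
    apply: ideal_prod_mul; (exact: gen2_l || exact: gen2_r).
- by rewrite -[X in ideal_prod _ _ X](mulr0 m%:~R); apply: ideal_prod_mul; [exact: gen2_l|exact: gen2_0].
Qed.

(** The ideals [(m, m' + w)] over ramified primes are their own conjugates:
    their square is [(m)]. *)
Lemma form_class_ambiguous (m r i u v : int) : m != 0 ->
    r ^+ 2 - D%:Z = i * m -> 2 * r = m -> u * m + v * (r - i) = 1 ->
  (c m r ^+ 2 = 1)%g /\ ideal_prod (I_ m r) (I_ m r) = gen2 O m%:~R 0.
Proof.
move=> m0 hi hj huv.
have e1 : (r%:~R + w) * (r%:~R + w) = (i%:~R + w) * m%:~R.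
  have -> : (r%:~R + w) * (r%:~R + w) = (r ^+ 2 - D%:Z)%:~R + w * (2 * r)%:~R.
    by rewrite rmorphB rmorphXn rmorphM /= -[D%:Z%:~R]/(D%:R) -ww; ring.
  by rewrite hi hj rmorphM /=; ring.
have huv' : u%:~R * m%:~R + v%:~R * (r%:~R - i%:~R) = 1 :> algC.
  by rewrite -[RHS]/(1%:~R) -huv rmorphD !rmorphM /= rmorphB.
suff e : ideal_prod (I_ m r) (I_ m r) = gen2 O m%:~R 0.
  split=> //; rewrite expgS expg1 -clM ?e; try exact: form_ideal_nz.
  by apply: class_princ; rewrite ?intr_eq0.
apply: (ideal_prod_gen2 O1 OB OM).
- by exists m%:~R, 0; split=> //; ring.
- by exists (r%:~R + w), 0; split=> //; ring.
- by exists (r%:~R + w), 0; split=> //; ring.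
- by exists (i%:~R + w), 0; split=> //; rewrite e1; ring.
- have e : m%:~R = u%:~R * (m%:~R * m%:~R) + (v%:~R * ((r%:~R + w) * m%:~R)
     + (- v)%:~R * ((r%:~R + w) * (r%:~R + w))).
    transitivity ((u%:~R * m%:~R + v%:~R * (r%:~R - i%:~R)) * m%:~R : algC).
      by rewrite huv' mul1r.
    by rewrite e1 !rmorphN; ring.
  rewrite [X in ideal_prod _ _ X]e.
  by do 2?[apply: ideal_prodD]; apply: ideal_prod_scale => //;
    apply: ideal_prod_mul; (exact: gen2_l || exact: gen2_r).
- by rewrite -[X in ideal_prod _ _ X](mulr0 m%:~R); apply: ideal_prod_mul; [exact: gen2_l|exact: gen2_0].
Qed.

(** [2] ramifies, as [- D] is [3] modulo [4]. *)
Lemma form_class_two : (c 2 1 ^+ 2 = 1)%g.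
Proof.
have [j De] : exists j : int, D%:Z = 4 * j + 1 by exists (D %/ 4)%N%:Z; move: D1; clear; lia.
have h1 : (1 : int) ^+ 2 - D%:Z = - (2 * j) * 2 by rewrite De; ring.
have h2 : 2 * (1 : int) = 2 by [].
have h3 : - j * 2 + 1 * (1 - - (2 * j)) = 1 by ring.
by have [] := form_class_ambiguous (isT : (2 : int) != 0) h1 h2 h3.
Qed.

(** Its square is [(2 * p)], so that a generator would have norm [2 * p], which the form
    [x ^ 2 + p * q * y ^ 2] does not represent. *)
Lemma form_class_2p : (c (2 * p%:Z) p ^+ 2 = 1)%g /\ c (2 * p%:Z) p <> 1%g.
Proof.
have [p1 pe] : exists j : int, p%:Z = 4 * j + 1 by exists (p %/ 4)%N%:Z; move: p4; clear; lia.
have [q1 qe] : exists j : int, q%:Z = 4 * j + 1 by exists (q %/ 4)%N%:Z; move: q4; clear; lia.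
have m0 : 2 * p%:Z != 0 by rewrite mulf_neq0 // -lt0n.
have cp : coprimez (2 * p%:Z) (2 * (p1 + q1) + 1).
  apply: coprimez_primeP => l pl; rewrite prime_dvdzM // => /orP[l2|lp] l3.
    have : (l %| (1:int))%Z.
      by rewrite -(dvdz_subr _ l3) // (_ : 1 - _ = 2 * - (p1 + q1)) ?dvdz_mulr //; ring.
    by rewrite dvdzE /= dvdn1; move: (prime_gt1 pl) => /gtn_eqF ->.
  have lep : l = p by move: lp; rewrite dvdzE /= dvdn_prime2 // => /eqP.
  have : (p %| q%:Z)%Z.
    have -> : q%:Z = 2 * (2 * (p1 + q1) + 1) - p%:Z by rewrite pe qe; ring.
    by apply: rpredB; [rewrite -lep; exact: dvdz_mull | exact: dvdzz].
  by rewrite dvdzE /= dvdn_prime2 // (negbTE npq).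
have [u [v uv]] := Bezoutz (2 * p%:Z) (2 * (p1 + q1) + 1); rewrite (eqP cp) in uv.
have h1 : p%:Z ^+ 2 - D%:Z = 2 * (p1 - q1) * (2 * p%:Z) by rewrite PoszM qe pe; ring.
have h3 : u * (2 * p%:Z) + v * (p%:Z - 2 * (p1 - q1)) = 1.
  by rewrite -[RHS]uv; congr (_ + _ * _); rewrite pe; ring.
have [{}h1 h2] := form_class_ambiguous m0 h1 (erefl _) h3.
split=> // /(class_trivialP O1 OB OM clM clE) [||| t It ht] //; first by rewrite intr_eq0.
have t2 : exists2 s, O s & (2 * p%:Z)%:~R = t * t * s.
  have : ideal_prod (I_ (2 * p%:Z) p) (I_ (2 * p%:Z) p) (2 * p%:Z)%:~R by rewrite h2; exact: gen2_l.
  apply: (ideal_prod_min (K := [set z | exists2 s, O s & z = t * t * s])) => /=.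
  - by exists 0; rewrite ?mulr0.
  - by move=> _ _ [s Os ->] [s' Os' ->]; exists (s + s'); [exact: OD | rewrite mulrDr].
  by move=> x y /ht[s Os ->] /ht[s' Os' ->]; exists (s * s'); [exact: OM | ring].
have [s' Os' ts'] : exists2 s, O s & t * t = s * (2 * p%:Z)%:~R.
  have : ideal_prod (I_ (2 * p%:Z) p) (I_ (2 * p%:Z) p) (t * t) by apply: ideal_prod_mul.
  by rewrite h2 => -[s [v' [Os _ ->]]]; exists s => //; ring.
have [s Os ps] := t2.
have m0' : (2 * p%:Z)%:~R != 0 :> algC by rewrite intr_eq0.
have ss : s' * s = 1.
  by apply: (mulfI m0'); rewrite mulr1 [in RHS]ps ts'; ring.
have nrm z : O z -> exists x y : int, z = x%:~R + y%:~R * w /\ z * z^* = (x ^+ 2 + D%:Z * y ^+ 2)%:~R.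
  move=> /(quad_ratC_int D1 sD ww)[x [y ->]]; exists x, y; split=> //.
  rewrite rmorphD rmorphM /= (imag_sqrt_conj D1 ww) !rmorph_int.
  by rewrite rmorphD rmorphM !rmorphXn /= -[D%:Z%:~R]/(D%:R) -[D%:R]opprK -ww; ring.
have Ot : O t by case: (gen2_ideal O1 OB OM (Oint (2 * p%:Z)) (Orw p)) => + _ _ _; apply.
have [x [y [_ nt]]] := nrm _ Ot; have [x1 [y1 [_ ns]]] := nrm _ Os; have [x2 [y2 [_ ns']]] := nrm _ Os'.
have e1 : (x1 ^+ 2 + D%:Z * y1 ^+ 2) * (x2 ^+ 2 + D%:Z * y2 ^+ 2) = 1.
  apply: (@intr_inj algC); rewrite rmorphM /= -ns -ns' mulrACA -rmorphM [s * s']mulrC ss.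
  by rewrite rmorph1 mulr1.
have e2 : (x ^+ 2 + D%:Z * y ^+ 2) ^+ 2 = (x2 ^+ 2 + D%:Z * y2 ^+ 2) * (2 * p%:Z) ^+ 2.
  apply: (@intr_inj algC); transitivity ((x ^+ 2 + D%:Z * y ^+ 2)%:~R ^+ 2 : algC).
    exact: rmorphXn.
  transitivity ((x2 ^+ 2 + D%:Z * y2 ^+ 2)%:~R * (2 * p%:Z)%:~R ^+ 2 : algC); last first.
    by rewrite [RHS]rmorphM; congr (_ * _); exact/esym/rmorphXn.
  rewrite -nt -ns' [LHS]expr2 mulrACA -rmorphM /= ts'.
  have cP : ((2 * p%:Z)%:~R : algC)^* = (2 * p%:Z)%:~R by rewrite rmorph_int.
  by move: cP; move: ((2 * p%:Z)%:~R : algC) => P cP; rewrite rmorphM /= cP; ring.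
have n2 : x2 ^+ 2 + D%:Z * y2 ^+ 2 = 1.
  have g2 : 0 <= x2 ^+ 2 + D%:Z * y2 ^+ 2 by rewrite addr_ge0 ?sqr_ge0 // mulr_ge0 ?sqr_ge0.
  have /eqP := congr1 absz e1; rewrite abszM muln_eq1 => /andP[_ /eqP h].
  by rewrite -(gez0_abs g2) h.
rewrite n2 mul1r in e2.
have {e2} e2 : x ^+ 2 + D%:Z * y ^+ 2 = 2 * p%:Z.
  have g1 : 0 <= x ^+ 2 + D%:Z * y ^+ 2 by rewrite addr_ge0 ?sqr_ge0 // mulr_ge0 ?sqr_ge0.
  by apply/eqP; rewrite -(eqrXn2 (n := 2)) ?e2.
have [y0|y0] := eqVneq y 0.
  have px : (p %| x)%Z.
    rewrite -(prime_dvdz_sqr _ pp) (_ : x ^+ 2 = p%:Z * 2); first exact/dvdz_mulr/dvdzz.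
    by move: e2; rewrite y0 expr0n /= mulr0 addr0 mulrC.
  have /dvdzP[x' xe] := px.
  have : p%:Z * (p%:Z * x' ^+ 2) = p%:Z * 2.
    by rewrite [RHS]mulrC -e2 y0 xe; ring.
  have p0' : p%:Z != 0 by rewrite -lt0n.
  move/(mulfI p0') => h; have : (p %| (2:int))%Z by rewrite -h; exact/dvdz_mulr/dvdzz.
  rewrite dvdzE /= dvdn_prime2 // => /eqP p2.
  by move: p4; rewrite p2.
have q5 : (5 <= q)%N by move: q4 (prime_gt1 pq); clear; lia.
have y1' : 1 <= y ^+ 2 by rewrite -gtz0_ge1 lt0r sqrf_eq0 y0 sqr_ge0.
have : p%:Z * q%:Z * y ^+ 2 <= 2 * p%:Z by rewrite -e2 -PoszM lerDr sqr_ge0.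
have : p%:Z * 5 * 1 <= p%:Z * q%:Z * y ^+ 2.
  by apply: ler_pM => //; rewrite ler_wpM2l.
move: p0; move: (_ * y ^+ 2) => Z; clear; lia.
Qed.

End ClassOfForms.

(** The computation that produces an element whose fourth power is [K^-1]: [K] is the class of
    norm [2 * p], [h ^ 2 * g] that of norm [n], and [g] is a square up to classes of order 2. *)
Lemma expg_abelian_eq (gT : finGroupType) (Cl : {group gT}) (K h g B C : gT) :
    abelian Cl -> h \in Cl -> g \in Cl -> B \in Cl -> C \in Cl -> K \in Cl ->
    (K * (h ^+ 2 * g) ^+ 2 = 1)%g -> (g ^+ 2 = ((B * C^-1) ^+ 2) ^+ 2)%g ->
  (K * (h * (B * C^-1)) ^+ 4 = 1)%g.
Proof.
move=> /centsP ab hh hg hB hC hK e1 e2.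
have c1 : commute h (B * C^-1)%g by apply: ab => //; rewrite groupM ?groupV.
have c2 : commute (h ^+ 2)%g g by apply: ab => //; rewrite groupX.
rewrite -[RHS]e1; congr (_ * _)%g.
rewrite (expgMn _ c1) (expgMn _ c2) e2 -!expgM //.
Qed.

Section OrderEightClass.
Variables (p q : nat) (w : algC).
Hypotheses (pp : prime p) (pq : prime q) (npq : p != q) (p4 : (p %% 4 = 1)%N) (q4 : (q %% 4 = 1)%N).
Local Notation D := (p * q)%N.
Hypothesis (ww : w ^+ 2 = - D%:R).
Local Notation k := (quad ratC w).
Local Notation O := (int_ring k).

Variables (gT : finGroupType) (Cl : {group gT}).
Hypothesis hCl : is_class_group O Cl.

Variables (n m n1 N : nat) (r X Y x y z : int).
Hypotheses (on : odd n) (nm : n = (m ^ 2 * n1)%N) (cn : coprime (p * q) n)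
  (cN : coprime (p * q) N) (sN : forall l, prime l -> ~~ (l ^ 2 %| N)%N).
Hypotheses (hX : (p%:Z * X) ^+ 2 + (p * q)%N%:Z * Y ^+ 2 = (2 * p * n ^ 2)%N%:Z)
  (cY : coprimez Y (2 * p * n ^ 2)%N) (hrX : ((2 * p * n ^ 2)%N %| p%:Z * X - r * Y)%Z)
  (hr : ((2 * p * n ^ 2)%N %| r ^+ 2 + (p * q)%N%:Z)%Z).
Hypotheses (eN : N = n1 \/ N = (2 * n1)%N) (N0 : (0 < N)%N)
  (hx : x ^+ 2 + (p * q)%N%:Z * y ^+ 2 = N%:Z * z ^+ 2)
  (cy : coprimez y (N%:Z * z)) (cz : coprimez z (2 * x)) (z0 : z != 0).

Let ndvdD (l : nat) (t : nat) : prime l -> coprime D t -> (l %| t)%N -> (l %| D%:Z)%Z = false.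
Proof.
move=> pl ct lt; rewrite dvdzE /=; apply/negbTE; rewrite -prime_coprime //.
by apply: coprime_dvdl lt _; rewrite coprime_sym.
Qed.

Let n0 : (0 < n)%N. Proof. by case: (n) on. Qed.
Let p0 : (0 < p)%N. Proof. exact: prime_gt0. Qed.
Let n10 : (0 < n1)%N. Proof. by move: n0; rewrite nm muln_gt0 => /andP[]. Qed.
Let m0 : (0 < m)%N. Proof. by move: n0; rewrite nm; case: (m). Qed.
Let dn2 : (n ^ 2 %| 2 * p * n ^ 2)%N. Proof. exact: dvdn_mull. Qed.
Let hrd (t : nat) : (t %| 2 * p * n ^ 2)%N -> (t%:Z %| r ^+ 2 + D%:Z)%Z.
Proof. by move=> ht; apply: dvdz_trans hr. Qed.

Let odd_root (s : int) (t : nat) : (t %| s ^+ 2 + D%:Z)%Z -> (2 %| t)%N -> (2 %| s - 1)%Z.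
Proof.
move=> h1 h2; have h3 : (2 %| s ^+ 2 + D%:Z)%Z by apply: dvdz_trans h1.
have D1 : (D %% 4 = 1)%N by rewrite -modnMml p4 mul1n.
have [j De] : exists j : int, D%:Z = 4 * j + 1 by exists (D %/ 4)%N%:Z; move: D1; clear; lia.
case: (int_parity s) => [] [s1 [se _]]; last by rewrite se addrK dvdz_mulr.
exfalso; have /dvdzP[i hi] := h3; move: hi; rewrite se De; clear; lia.
Qed.

Let r_odd : (2 %| r - 1)%Z.
Proof. by apply: odd_root hr _; rewrite -mulnA dvdn_mulr. Qed.

Let coprime_2r (t : nat) : odd t -> coprime D t -> (t%:Z %| r ^+ 2 + D%:Z)%Z -> coprimez t (2 * r).
Proof.
move=> ot ct ht; apply: coprimez_primeP => l pl lt; rewrite prime_dvdzM // => /orP[l2|lr].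
  by move: l2; rewrite dvdzE /= dvdn_prime2 // => /eqP l2; move: (dvdn_odd lt ot); rewrite l2.
have : (l %| D%:Z)%Z.
  have -> : D%:Z = (r ^+ 2 + D%:Z) - r ^+ 2 by ring.
  by apply: rpredB; [exact: dvdz_trans ht | rewrite prime_dvdz_sqr].
by rewrite (ndvdD pl ct).
Qed.

(** The norm [2 * p * n ^ 2] makes the ambiguous class of norm [2 * p] inverse to the square
    of the class of norm [n], and the latter is itself a square up to an element of order 2. *)
Lemma order_eight_class : exists2 g, g \in Cl & (g ^+ 4 <> 1)%g /\ (g ^+ 8 = 1)%g.
Proof.
have Rw : ratC (w ^+ 2) by rewrite ww /ratC /= rpredN rpred_nat.
have hk : subfield_set k := quad_subfield ratC_subfield Rw.
have [cl [clin clsurj clM clE]] := hCl.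
have abCl := class_group_abelian clsurj clM.
pose c (u v : int) := cl (form_ideal w u v).
have cin (u v : int) : u != 0 -> c u v \in Cl by move=> u0; apply: (form_class_in ww clin).
have cmul := form_class_mul_coprime ww clM.
have cmul2 := form_class_mul_2r ww clM.
have csqr := form_class_sqr ww clM.
have nz (t : nat) : (0 < t)%N -> t%:Z != 0 by rewrite -lt0n.
have nn1 : (n1 %| n)%N by rewrite nm dvdn_mull.
have mn : (m %| n)%N by rewrite nm -mulnn -mulnA dvdn_mulr.
have on1 := dvdn_odd nn1 on; have om := dvdn_odd mn on.
have cn1 := coprime_dvdr nn1 cn; have cm := coprime_dvdr mn cn.
have nn2 : (n %| n ^ 2)%N by rewrite -mulnn dvdn_mulr.
have hn : (n%:Z %| r ^+ 2 + D%:Z)%Z by apply: hrd; apply: dvdn_trans dn2.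
have hm : (m%:Z %| r ^+ 2 + D%:Z)%Z by apply: dvdz_trans hn; rewrite dvdzE.
pose h := c m r; pose g := c n1 r; pose K := c (2 * p%:Z) p.
have hh : h \in Cl by apply: cin; apply: nz.
have hg : g \in Cl by apply: cin; apply: nz.
have hK : K \in Cl by apply: cin; rewrite mulf_neq0 // nz.
have e1 : (K * (h ^+ 2 * g) ^+ 2 = 1)%g.
  have <- : c (2 * p * n ^ 2)%N r = 1%g.
    by apply: (form_class_norm ww clM clE _ hX cY hrX); rewrite nz // 2!muln_gt0 p0 expn_gt0 n0.
  have p2 : (2 %| p%:Z - 1)%Z.
    have [j ->] : exists j : int, p%:Z = 2 * j + 1 by exists (p ./2)%:Z; move: p4; clear; lia.
    by rewrite addrK; exact/dvdz_mulr/dvdzz.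
  have -> : K = c (2 * p%:Z) r.
    rewrite /K /c; congr cl; apply: (form_ideal_mod ww).
    rewrite (_ : 2 * p%:Z = (2 * p)%N%:Z); last by rewrite PoszM.
    apply: coprime_dvdz_mul.
    - by rewrite coprime2n; move: p4; clear; lia.
    - rewrite (_ : p%:Z - r = (p%:Z - 1) - (r - 1)); last by ring.
      exact: rpredB.
    apply: rpredB; first exact: dvdzz.
    rewrite -(prime_dvdz_sqr _ pp) (_ : r ^+ 2 = (r ^+ 2 + D%:Z) - D%:Z); last by ring.
    by apply: rpredB; [apply: hrd; rewrite mulnAC dvdn_mull | rewrite dvdzE dvdn_mulr].
  have e : (2 * p * n ^ 2)%N%:Z = (2 * p%:Z) * n%:Z ^+ 2 by rewrite !PoszM; ring.
  rewrite e [c (2 * p%:Z * _) r]cmul ?mulf_neq0 ?expf_neq0 ?nz //; last first.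
    rewrite coprimezE abszM abszX /= coprimeXr // coprimeMl coprime2n on.
    by apply: coprime_dvdl cn; apply: dvdn_mulr.
  congr (_ * _)%g; rewrite csqr ?nz //; first last.
  - exact: coprime_2r.
  - by rewrite -PoszX hrd.
  congr (_ ^+ 2)%g; rewrite nm PoszM PoszX.
  have dm : (m%:Z ^+ 2 * n1%:Z %| r ^+ 2 + D%:Z)%Z by rewrite -PoszX -PoszM -nm.
  rewrite cmul2 ?expf_neq0 ?nz //; last first.
    by rewrite coprimezE abszX; apply: coprimeXl; apply: coprime_2r.
  rewrite csqr ?nz //; last exact: coprime_2r.
  by apply: dvdz_trans dm; rewrite dvdz_mulr.
pose M := N%:Z * z ^+ 2.
have cyM : coprimez y M.
  move: cy; rewrite /M coprimezMr [in X in _ -> X]coprimezMr => /andP[-> h2] /=.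
  by rewrite coprimezE abszX; apply: coprimeXr.
have [y' hy'] := coprimez_inverse cyM.
pose s := x * y'.
have M0 : M != 0 by rewrite mulf_neq0 ?expf_neq0 ?nz.
have hs : (M %| x - s * y)%Z.
  rewrite (_ : _ - _ = - x * (y * y' - 1)); last by rewrite /s; ring.
  exact: dvdz_mull.
have hsD : (M %| s ^+ 2 + D%:Z)%Z.
  have cM2 : coprimez M (y ^+ 2) by rewrite coprimezE abszX; apply: coprimeXr; rewrite coprime_sym.
  rewrite -(Gauss_dvdzr _ cM2).
  rewrite (_ : y ^+ 2 * _ = (x ^+ 2 + D%:Z * y ^+ 2) - (x - s * y) * (x + s * y)); last by ring.
  by rewrite hx; apply: rpredB; [exact: dvdzz | exact: dvdz_mulr].
have NsD : (N%:Z %| s ^+ 2 + D%:Z)%Z by apply: dvdz_trans hsD; exact/dvdz_mulr/dvdzz.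
have zM : (z %| M)%Z by rewrite /M expr2 mulrA; exact/dvdz_mull/dvdzz.
have czs : coprimez z (2 * s).
  apply: coprimez_primeP => l pl lz; rewrite prime_dvdzM // => /orP[l2|ls].
    by have := coprimez_prime pl cz lz; rewrite prime_dvdzM // l2.
  have := coprimez_prime pl cz lz; rewrite prime_dvdzM // => /norP[_ /negP]; apply.
  have -> : x = (x - s * y) + s * y by ring.
  by apply: rpredD; [exact: dvdz_trans lz (dvdz_trans zM hs) | exact: dvdz_mulr].
pose N1 := gcdn N (absz (s - r)%R).
have N1N : (N1 %| N)%N by apply: dvdn_gcdl.
have [N2 N2N] := dvdnP N1N.
have N10 : (0 < N1)%N by move: N0; rewrite N2N muln_gt0 => /andP[].
have N20 : (0 < N2)%N by move: N0; rewrite N2N muln_gt0 => /andP[].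
have NrD : (N%:Z %| r ^+ 2 + D%:Z)%Z.
  apply: hrd; case: eN => ->; first by apply: dvdn_trans nn1 (dvdn_trans nn2 dn2).
  by rewrite -mulnA; apply: dvdn_mul => //; apply: dvdn_mull; apply: dvdn_trans nn1 nn2.
have sqf l : prime l -> (l %| N1)%N -> (l %| N2)%N -> False.
  move=> pl l1 l2; case/negP: (sN pl); rewrite N2N -mulnn; exact: dvdn_mul.
have cN12 : coprimez N1 N2 by apply: coprimez_primeP => l pl; apply: sqf.
have N1s : (N1%:Z %| s - r)%Z by rewrite dvdzE; apply: dvdn_gcdr.
have N2s : (N2%:Z %| s - - r)%Z.
  have cN2 : coprimez N2 (s - r).
    apply: coprimez_primeP => l pl l2 lsr; apply: (sqf l) => //.
    by rewrite dvdn_gcd N2N dvdn_mulr.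
  rewrite -(Gauss_dvdzr _ cN2) (_ : _ * _ = (s ^+ 2 + D%:Z) - (r ^+ 2 + D%:Z)); last by ring.
  by apply: rpredB; [apply: dvdz_trans NsD | apply: dvdz_trans NrD]; rewrite dvdzE N2N /= dvdn_mulr.
have oN2 : odd N2.
  apply: contraT; rewrite -dvdn2 => h2; exfalso.
  have N2e : (2 %| N)%N by rewrite N2N dvdn_mulr.
  apply: (sqf 2) => //; rewrite dvdn_gcd N2e /=.
  change (2 %| s - r)%Z; rewrite (_ : s - r = (s - 1) - (r - 1)); last by ring.
  by apply: rpredB => //; apply: odd_root NsD _.
have N12 : N%:Z = N1%:Z * N2%:Z by rewrite N2N PoszM mulrC.
have hN2 : (N2 %| N)%N by rewrite N2N dvdn_mulr.
have hN2r : (N2%:Z %| r ^+ 2 + D%:Z)%Z by apply: dvdz_trans NrD; rewrite dvdzE.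
pose A := c N1 r; pose B := c N2 r; pose C := c z s.
have hA : A \in Cl by apply: cin; apply: nz.
have hB : B \in Cl by apply: cin; apply: nz.
have hC : C \in Cl by apply: cin.
have eG : c N r = (A * B)%g.
  by rewrite /c N12 cmul ?nz // -N12.
have eBconj : (B * c N2 (- r) = 1)%g.
  by apply: (form_class_conj ww clM clE); rewrite ?nz //; apply: coprime_2r => //; apply: coprime_dvdr cN.
have e2 : (C ^+ 2 * (A * B^-1) = 1)%g.
  have <- : c M s = 1%g by apply: (form_class_norm ww clM clE M0 hx cyM hs).
  have -> : c M s = (c (z ^+ 2)%R s * c N s)%g.
    rewrite /c /M mulrC; apply: cmul2; rewrite ?expf_neq0 ?nz //; first by rewrite mulrC.
    by rewrite coprimezE abszX; apply: coprimeXl.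
  have -> : c (z ^+ 2)%R s = (C ^+ 2)%g.
    by apply: csqr => //; apply: dvdz_trans hsD; exact/dvdz_mull/dvdzz.
  have -> : c N s = (c N1 s * c N2 s)%g by rewrite /c N12 cmul ?nz // -N12.
  have -> : c N1 s = A by rewrite /A /c (form_ideal_mod ww N1s).
  have -> // : c N2 s = (B^-1)%g.
  by rewrite /c (form_ideal_mod ww N2s); apply: (mulgI B); rewrite mulgV.
have eg : (g ^+ 2 = c N r ^+ 2)%g.
  case: eN => ->; first by [].
  have -> : c (2 * n1)%N r = (c 2 r * g)%g.
    rewrite /c PoszM cmul ?nz //; last by rewrite coprimezE /= coprime2n.
    rewrite -PoszM; apply: hrd; rewrite -mulnA; apply: dvdn_mul => //.
    by apply: dvdn_mull; apply: dvdn_trans nn1 nn2.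
  have c21 : c 2 r = c 2 1 by rewrite /c (form_ideal_mod ww r_odd).
  rewrite expgMn; last by apply: (centsP abCl) => //; apply: cin.
  by rewrite c21 (form_class_two p4 q4 ww clM clE) mul1g.
have [K2 K1] := form_class_2p pp pq npq p4 q4 ww clM clE.
have ab := centsP abCl.
have e3 : (g ^+ 2 = ((B * C^-1) ^+ 2) ^+ 2)%g.
  rewrite eg eG; congr (_ ^+ 2)%g.
  have cBC : commute B (C^-1)%g by apply: ab; rewrite ?groupV.
  rewrite expgMn //; have -> : A = (C ^- 2 * B)%g.
    by apply: (mulgI (C ^+ 2)%g); apply: (mulIg (B^-1)%g); rewrite -mulgA e2 mulKVg mulgV.
  rewrite -mulgA -expg2 expgVn; apply: ab; rewrite ?groupV ?groupX //.
have e4 := expg_abelian_eq abCl hh hg hB hC hK e1 e3.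
exists (h * (B * C^-1))%g; first by rewrite !groupM ?groupV.
have x4 : ((h * (B * C^-1)) ^+ 4 = K^-1)%g by apply: (mulgI K); rewrite e4 mulgV.
split; first by rewrite x4 => /(canRL invgK); rewrite invg1.
by rewrite (expgM _ 4 2) x4 expgVn K2 invg1.
Qed.
End OrderEightClass.

(** * The class group of type (4,2) *)

Lemma Z4Z2_exponent (u : 'Z_4 * 'Z_2) : (u ^+ 4 = 1)%g.
Proof.
have h4 (a : 'Z_4) : (a ^+ 4 = 1)%g.
  have ha : a \in [set: 'Z_4]%G by rewrite inE.
  by have := expg_cardG ha; rewrite cardsT card_ord.
have h2 (b : 'Z_2) : (b ^+ 4 = 1)%g.
  have hb : b \in [set: 'Z_2]%G by rewrite inE.
  have := expg_cardG hb; rewrite cardsT card_ord => e.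
  by rewrite (expgM b 2 2) e expg1n.
case: u => a b; have -> : ((a, b) ^+ 4 = (a ^+ 4, b ^+ 4))%g by [].
by rewrite h4 h2.
Qed.

Lemma two_class_exponent (gT : finGroupType) (Cl S : {group gT}) (g : gT) :
  (2.-Sylow(Cl) S)%g -> (S \isog [set: 'Z_4 * 'Z_2]%G)%g -> g \in Cl ->
  (g ^+ 8 = 1)%g -> (g ^+ 4 = 1)%g.
Proof.
move=> sylS /isogP[f injf imf] gCl g8.
have sub : (<[g]> \subset Cl)%g by rewrite cycle_subG.
have p2 : (2.-group <[g]>)%g.
  have : (#[g]%g %| 2 ^ 3)%N by rewrite order_dvdn g8.
  by rewrite /pgroup -orderE => h; apply: (@pnat_dvd _ (2 ^ 3)) => //; rewrite pnatX.
have [x xCl gS] := Sylow_subJ sylS sub p2.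
have : (g ^ x^-1 \in S)%g.
  by have := fintype.subsetP gS _ (cycle_id g); rewrite mem_conjg.
move=> sS.
have s4 : ((g ^ x^-1) ^+ 4 = 1)%g.
  apply: (injmP injf); rewrite ?groupX ?group1 //.
  by rewrite morphX // morph1 Z4Z2_exponent.
by move: s4; rewrite -conjXg => /(canRL (conjgKV _)); rewrite conj1g.
Qed.

Section ClassGroup42.
Variables (p q : nat) (a b c d : int) (w : algC).
Hypotheses (pp : prime p) (pq : prime q) (p5 : (p %% 8 = 5)%N) (q5 : (q %% 8 = 5)%N).
Hypotheses (hpq : nonres q p) (pab : p%:Z = a ^+ 2 + b ^+ 2) (qcd : q%:Z = c ^+ 2 + d ^+ 2).
Hypotheses (oa : odd `|a|) (oc : odd `|c|).
Hypothesis hres : nonres q (d * (a * d - b * c)) = false.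
Hypothesis (ww : w ^+ 2 = - (p * q)%:R).
Hypothesis hCl : two_class_group_isog (quad ratC w) [set: 'Z_4 * 'Z_2]%G.

(** If the two symbols agreed, the class group would contain an element of order 8, while its
    2-part has exponent 4. *)
Lemma class_group_42_jacobi : jacobi 2 (absz (a - b)%R) (+) jacobi 2 (absz (c - d)%R).
Proof.
apply: contraT => /negbTE hj.
have p4 : (p %% 4 = 1)%N by move: p5; clear; lia.
have q4 : (q %% 4 = 1)%N by move: q5; clear; lia.
have npq := p_neq_q pq hpq.
have [n [m [n1 [N [r [X [Y [x [y [z [[on nm cn cN sN] [[h1 h2 h3 h4] [[e1 e2 e3 e4 e5] z0]]]]]]]]]]]]] :=
  order_eight_data pp pq p5 q5 hpq pab qcd oa oc hres hj.
have [gT [Cl [S [hC sylS isoS]]]] := hCl.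
have [g gCl [g4 g8]] := order_eight_class pp pq npq p4 q4 ww hC on nm cn cN sN h1 h2 h3 h4 e1 e2 e3 e4 e5 z0.
by case: g4; apply: two_class_exponent gCl g8; [exact: sylS | exact: isoS].
Qed.
End ClassGroup42.

(** * Transport to subfields of the complex numbers *)

Local Notation pQtoC := (map_poly ratr).

(** The field generated by all conjugates of a primitive element is a splitting field. *)
Lemma splitting_embedding (s : seq algC) :
  exists (Om : splittingFieldType rat) (phi : {rmorphism Om -> algC}) (s1 : seq Om), map phi s1 = s.
Proof.
have [z _ [ps es]] := algC_PET s.
have [p [_ mp] pz] := minCpolyP z.
have [r er] := closed_field_poly_normal (pQtoC p : {poly algC}).
rewrite lead_coef_map (monicP mp) rmorph1 scale1r in er.
have [Qr [phi [rr err genQ]]] := num_field_exists r.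
pose q : {poly Qr} := map_poly (in_alg Qr) p.
have phiq (t : {poly rat}) : map_poly phi (map_poly (in_alg Qr) t) = pQtoC t.
  by rewrite -map_poly_comp; apply: eq_map_poly => a /=; rewrite alg_num_field fmorph_rat.
have sq : splitting_field_axiom Qr.
  exists q; first by apply/polyOverP => i; rewrite coef_map memvZ ?memv_line.
  exists rr => //; congr (_ %= _): (eqpxx q); apply/(map_poly_inj phi).
  rewrite phiq er -err big_map rmorph_prod /=; apply: eq_bigr => a _.
  by rewrite map_polyXsubC.
pose Om : splittingFieldType rat := HB.pack Qr (FieldExt_isSplittingField.Build rat Qr sq).
have [zz ez] : exists zz, phi zz = z.
  have : z \in r by rewrite -root_prod_XsubC -er pz.
  by rewrite -err => /mapP[zz _ ->]; exists zz.
exists Om, phi, [seq (map_poly (in_alg Qr) t).[zz] | t <- ps].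
rewrite -map_comp es; apply: eq_map => t /=.
by rewrite -horner_map /= phiq ez.
Qed.

Section Transport.
Variables (Om : splittingFieldType rat) (phi : {rmorphism Om -> algC}).
Local Notation img K := (phi @` [set` K%VS]).

Lemma img_subfield (K : {subfield Om}) : subfield_set (img K).
Proof.
split.
- by exists 1; [exact: mem1v | rewrite rmorph1].
- by move=> _ _ [x Kx <-] [y Ky <-]; exists (x - y); [exact: rpredB | rewrite rmorphB].
- move=> _ _ [x Kx <-] [y Ky <-]; exists (x / y); last by rewrite fmorph_div.
  by rewrite /= rpred_div.
Qed.

Lemma img_Fadjoin_seq_sub (F : set algC) : subfield_set F -> forall rs (K : {subfield Om}),
  img K `<=` F -> (forall x, x \in rs -> F (phi x)) -> img <<K & rs>> `<=` F.
Proof.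
move=> hF; elim=> [|a rs IH] K KF rF; first by rewrite Fadjoin_nil.
rewrite adjoin_cons; apply: IH; last by move=> x xr; apply: rF; rewrite inE xr orbT.
move=> _ [x /= /Fadjoin_polyP[p Kp ->] <-].
rewrite -horner_map /= horner_coef.
elim/big_ind: _ => [|u v Fu Fv|i _]; [exact: sf0|exact: sfD|].
apply: (sfM hF).
  by rewrite coef_map; apply: KF; exists p`_i => //; move/polyOverP: Kp; apply.
by apply: (sfX hF); apply: rF; rewrite inE eqxx.
Qed.

Lemma img_adjoin_seq (K : {subfield Om}) rs :
  img <<K & rs>> = adjoin (img K) (map phi rs).
Proof.
apply/seteqP; split.
  apply: img_Fadjoin_seq_sub; first exact: adjoin_subfield.
    exact: adjoin_base.
  by move=> x xr; apply: adjoin_gen; exact: map_f.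
apply: adjoin_min; first exact: img_subfield.
  by move=> _ [x Kx <-]; exists x => //; apply: (subvP (subv_adjoin_seq _ _)).
by move=> _ /mapP[x xr ->]; exists x => //; exact: seqv_sub_adjoin.
Qed.

Lemma img_rat : img 1%AS = ratC.
Proof.
apply/seteqP; split=> [_ [x /= /vlineP[a ->] <-]|x /= /CratP[a ->]].
  by rewrite alg_num_field fmorph_rat /ratC /=; apply/CratP; exists a.
by exists (ratr a); rewrite ?fmorph_rat //= -alg_num_field; apply/vlineP; exists a.
Qed.
End Transport.

Section MuFieldC.
Variables (I W s0 nu P : algC) (e f x y t s va vb : int) (D p_ : nat).
Hypotheses (I2 : I ^+ 2 = -1) (W2 : W ^+ 2 = - D%:R) (s1 : s ^+ 2 = 1).
Hypotheses (efD : e ^+ 2 + (4 * f) ^+ 2 = D%:Z) (D0 : (0 < D)%N)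
  (st : s * t ^+ 2 = f * (x ^+ 2 - 4 * y ^+ 2) + e * x * y).
Hypothesis s02 : s0 ^+ 2 = e%:~R + 4 * f%:~R * I.
Local Notation mu := (2 * t%:~R * (1 + s%:~R * I) + (x%:~R + 2 * y%:~R * I) * s0).
Hypotheses (nu2 : nu ^+ 2 = (va%:~R + vb%:~R * I) * mu) (nu0 : nu != 0).
Hypotheses (vab : va ^+ 2 + vb ^+ 2 = p_%:Z) (P2 : P ^+ 2 = p_%:R) (p0 : (0 < p_)%N).
Local Notation k := (adjoin ratC [:: W]).
Local Notation K := (adjoin k [:: P; I; s0; nu]).

Lemma mu_field_transport : exists (Om : splittingFieldType rat) (phi : {rmorphism Om -> algC})
    (k0 : {subfield Om}) (I' P' s0' nu' : Om),
  [/\ phi @` [set` k0] = k, phi @` [set` <<k0 & [:: P'; I'; s0'; nu']>>%VS] = K,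
      phi I' = I & phi P' = P] /\
  [/\ galois k0 <<k0 & [:: P'; I'; s0'; nu']>>%VS,
      (P' \in k0 -> I' \notin k0 -> ('Gal(<<k0 & [:: P'; I'; s0'; nu']>> / k0) \isog [set: 'Z_8]%G)%g)
    & (P' \notin <<k0; I'>>%VS -> I' \notin <<k0; P'>>%VS ->
      ('Gal(<<k0 & [:: P'; I'; s0'; nu']>> / k0) \isog 'Mod_(16%N))%g)].
Proof.
have [Om [phi [s1' es]]] := splitting_embedding [:: W; I; P; s0; nu].
case: s1' es => [|W' [|I' [|P' [|s0' [|nu' [|]]]]]] //= [eW eI eP es0 enu].
pose k0 : {subfield Om} := <<1%AS & [:: W']>>%AS.
have ek : phi @` [set` k0] = k.
  by rewrite /k0 /= img_adjoin_seq img_rat /= eW.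
have sgE := (rmorphD, rmorphB, rmorphM, rmorphN, rmorph1, rmorph_nat, rmorph_int).
have I2' : I' ^+ 2 = -1 by apply: (fmorph_inj phi); rewrite rmorphXn /= eI I2 rmorphN1.
have W2' : W' ^+ 2 = - D%:R by apply: (fmorph_inj phi); rewrite rmorphXn /= eW W2 rmorphN rmorph_nat.
have s02' : s0' ^+ 2 = e%:~R + 4 * f%:~R * I'.
  by apply: (fmorph_inj phi); rewrite rmorphXn /= es0 s02 !sgE /= eI.
have nu2' : nu' ^+ 2 = (va%:~R + vb%:~R * I') *
    (2 * t%:~R * (1 + s%:~R * I') + (x%:~R + 2 * y%:~R * I') * s0').
  by apply: (fmorph_inj phi); rewrite rmorphXn /= enu nu2 !sgE /= eI es0.
have nu0' : nu' != 0 by rewrite -(fmorph_eq0 phi) enu.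
have P2' : P' ^+ 2 = p_%:R by apply: (fmorph_inj phi); rewrite rmorphXn /= eP P2 rmorph_nat.
have Wk : W' \in k0 by apply: seqv_sub_adjoin; rewrite inE.
exists Om, phi, k0, I', P', s0', nu'; split; split=> //.
- by rewrite img_adjoin_seq ek /= eP eI es0 enu.
- exact: (mu_field_galois I2' Wk W2' s1 efD D0 st s02' nu2' nu0' vab P2').
- exact: (mu_field_C8 I2' Wk W2' s1 efD D0 st s02' nu2' nu0' vab P2').
- exact: (mu_field_M42 I2' Wk W2' s1 efD D0 st s02' nu2' nu0' vab P2').
Qed.

Lemma mu_galois_C8 : k P -> ~ k I -> galois_extension k K [set: 'Z_8]%G.
Proof.
move=> kP kI; have [Om [phi [k0 [I' [P' [s0' [nu' [[ek eK eI eP] [g c _]]]]]]]]] := mu_field_transport.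
exists Om, phi, k0, <<k0 & [:: P'; I'; s0'; nu']>>%AS; split=> //.
apply: c.
  by move: kP; rewrite -ek -eP => -[z zk /fmorph_inj <-].
by apply/negP => h; apply: kI; rewrite -ek -eI; exists I'.
Qed.

Lemma mu_galois_M42 : ~ adjoin k [:: I] P -> ~ adjoin k [:: P] I ->
  galois_extension k K 'Mod_(16%N)%G.
Proof.
move=> kP kI; have [Om [phi [k0 [I' [P' [s0' [nu' [[ek eK eI eP] [g _ c]]]]]]]]] := mu_field_transport.
exists Om, phi, k0, <<k0 & [:: P'; I'; s0'; nu']>>%AS; split=> //.
apply: c; apply/negP => h.
  by apply: kP; rewrite -ek -eI -eP -(img_adjoin_seq phi k0 [:: I']) adjoin_seq1; exists P'.
by apply: kI; rewrite -ek -eI -eP -(img_adjoin_seq phi k0 [:: P']) adjoin_seq1; exists I'.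
Qed.
End MuFieldC.

(** * Ramification through local generators *)

Section QuadConj.
Variables (E : set algC) (a : algC).
Hypotheses (hE : subfield_set E) (Ea : E (a ^+ 2)).

(** Conjugation over [E], as a relation: it is a function only if [a] is not in [E]. *)
Definition quad_conj (y y' : algC) : Prop :=
  exists u v, [/\ E u, E v, y = u + v * a & y' = u - v * a].

Lemma quad_conj_ex y : quad E a y -> exists y', quad_conj y y'.
Proof. by move=> [u [v [Eu Ev ->]]]; exists (u - v * a), u, v. Qed.

Lemma quad_conj_quad y y' : quad_conj y y' -> quad E a y /\ quad E a y'.
Proof.
move=> [u [v [Eu Ev -> ->]]]; split; [by exists u, v|].
by exists u, (- v); split=> //; [exact: sfN | rewrite mulNr].
Qed.

Lemma quad_conjC y y' : quad_conj y y' -> quad_conj y' y.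
Proof.
move=> [u [v [Eu Ev -> ->]]]; exists u, (- v); split=> //; first exact: sfN.
  by rewrite mulNr.
by rewrite mulNr opprK.
Qed.

Lemma quad_conjM y y' t t' : quad_conj y y' -> quad_conj t t' -> quad_conj (y * t) (y' * t').
Proof.
move=> [u [v [Eu Ev -> ->]]] [c [d [Ec Ed -> ->]]].
exists (u * c + v * d * a ^+ 2), (u * d + v * c); split; try ring.
  by apply: (sfD hE); apply: (sfM hE) => //; apply: (sfM hE).
by apply: (sfD hE); apply: (sfM hE).
Qed.

Lemma quad_conj_tr y y' : quad_conj y y' -> E (y + y').
Proof.
move=> [u [v [Eu Ev -> ->]]].
have -> : u + v * a + (u - v * a) = u + u by ring.
exact: sfD.
Qed.

Lemma quad_conj_gen c : E c -> quad_conj (c * a) (- (c * a)).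
Proof. by move=> Ec; exists 0, c; split=> //; [exact: sf0| |]; ring. Qed.

(** A polynomial with coefficients in [E] takes conjugate values at conjugate arguments. *)
Lemma quad_conj_int y y' : ~ E a -> quad_conj y y' -> y \in Aint -> y' \in Aint.
Proof.
move=> nEa [u [v [Eu Ev -> ->]]] /Aint_integralP[p mp].
have [A [B [EA EB e1 e2]]] : exists A B, [/\ E A, E B,
    (map_poly intr p).[u + v * a] = A + B * a & (map_poly intr p).[u - v * a] = A - B * a].
  elim/poly_ind: p {mp} => [|p c [A [B [EA EB e1 e2]]]].
    by exists 0, 0; rewrite rmorph0 !horner0; split=> //; [exact: sf0 | exact: sf0 | ring | ring].
  exists (A * u + B * v * a ^+ 2 + c%:~R), (A * v + B * u).
  rewrite rmorphD rmorphM /= map_polyX map_polyC /= !hornerMXaddC e1 e2; split; try ring.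
    apply: (sfD hE); last exact: sf_int.
    by apply: (sfD hE); apply: (sfM hE) => //; apply: (sfM hE).
  by apply: (sfD hE); apply: (sfM hE).
rewrite /root e1 => h; apply/Aint_integralP; exists p => //; rewrite /root e2.
have [B0|B0] := eqVneq B 0; first by move: h; rewrite B0 !mul0r subr0 addr0.
case: nEa; move: h; rewrite addrC addr_eq0 => /eqP h.
by rewrite -(mulKf B0 a) h; apply: (sfM hE); [exact: sfV | exact: sfN].
Qed.
End QuadConj.

Lemma quad_idle E a : subfield_set E -> E a -> quad E a = E.
Proof.
move=> hE Ea; apply/seteqP; split; last exact: quad_base.
by move=> _ [u [v [Eu Ev ->]]]; apply: (sfD hE) => //; apply: (sfM hE).
Qed.

Lemma int_ring_sub (E F : set algC) : E `<=` F -> int_ring E `<=` int_ring F.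
Proof. by move=> EF z [Ez iz]; split=> //; exact: EF. Qed.

Section Localize.
Variables (L P : set algC).
Hypotheses (hL : subfield_set L) (hP : nz_prime_ideal (int_ring L) P).
Local Notation OL := (int_ring L).

Lemma prime_id : is_ideal OL P. Proof. by case: hP => -[]. Qed.
Lemma prime_int z : P z -> OL z. Proof. by case: prime_id => h _ _ _; exact: h. Qed.
Lemma prime0 : P 0. Proof. by case: prime_id. Qed.
Lemma primeD x y : P x -> P y -> P (x + y). Proof. by case: prime_id => _ _ + _; exact. Qed.
Lemma primeMl r x : OL r -> P x -> P (r * x). Proof. by case: prime_id => _ _ _; exact. Qed.
Lemma primeMr r x : OL r -> P x -> P (x * r). Proof. by rewrite mulrC; exact: primeMl. Qed.
Lemma primeN x : P x -> P (- x).
Proof. by move=> Px; rewrite -mulN1r; apply: primeMl => //; apply: (int_ringN hL); exact: int_ring1. Qed.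
Lemma primeB x y : P x -> P y -> P (x - y).
Proof. by move=> Px Py; apply: primeD => //; exact: primeN. Qed.
Lemma prime1 : ~ P 1. Proof. by case: hP. Qed.
Lemma prime_notM x y : OL x -> OL y -> ~ P x -> ~ P y -> ~ P (x * y).
Proof. by move=> Ox Oy nx ny h; case: hP => _ _ /(_ _ _ Ox Oy h) []. Qed.
Lemma prime_sqr x : OL x -> P (x ^+ 2) -> P x.
Proof. by rewrite expr2 => Ox h; case: hP => _ _ /(_ _ _ Ox Ox h) []. Qed.

(** Divisibility in the localization of [O] at [P]. *)
Definition loc_dvd (O : set algC) (x z : algC) : Prop :=
  exists s y, [/\ O s, ~ P s, O y & s * z = x * y].

(** [x] generates the localization at [P] of the prime of [E] below [P]. *)
Definition loc_gen (E : set algC) (x : algC) : Prop :=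
  forall z, P z -> int_ring E z -> loc_dvd (int_ring E) x z.

Section LocDvd.
Variable E : set algC.
Hypotheses (hE : subfield_set E) (EL : E `<=` L).
Local Notation O := (int_ring E).
Let OOL : O `<=` OL := int_ring_sub EL.

Lemma loc_dvd0 x : loc_dvd O x 0.
Proof.
exists 1, 0; split; [exact: int_ring1|exact: prime1|exact: (int_ring_int hE 0)|by rewrite !mulr0].
Qed.

Lemma loc_dvdD x y z : loc_dvd O x y -> loc_dvd O x z -> loc_dvd O x (y + z).
Proof.
move=> [s [u [Os ns Ou e1]]] [t [v [Ot nt Ov e2]]].
exists (s * t), (t * u + s * v); split; first exact: int_ringM.
- by apply: prime_notM => //; exact: OOL.
- by apply: (int_ringD hE); apply: (int_ringM hE).
- by rewrite mulrDr -{1}[s * t]mulrC -!mulrA e1 e2; ring.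
Qed.

Lemma loc_dvdM x y z t : loc_dvd O x z -> loc_dvd O y t -> loc_dvd O (x * y) (z * t).
Proof.
move=> [s [u [Os ns Ou e1]]] [s' [v [Ot nt Ov e2]]].
exists (s * s'), (u * v); split; first exact: int_ringM.
- by apply: prime_notM => //; exact: OOL.
- exact: int_ringM.
- by rewrite mulrACA e1 e2; ring.
Qed.

Lemma loc_dvd_mull x z r : O r -> loc_dvd O x z -> loc_dvd O x (r * z).
Proof.
move=> Or [s [u [Os ns Ou e1]]]; exists s, (r * u); split=> //; first exact: int_ringM.
by rewrite mulrCA e1; ring.
Qed.

Lemma loc_dvd_cancel x z r : O r -> ~ P r -> loc_dvd O x (r * z) -> loc_dvd O x z.
Proof.
move=> Or nr [s [u [Os ns Ou e1]]]; exists (s * r), u; split=> //; first exact: int_ringM.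
  by apply: prime_notM => //; exact: OOL.
by rewrite -e1; ring.
Qed.

End LocDvd.

Lemma loc_dvd_sub E F x z : E `<=` F -> loc_dvd (int_ring E) x z -> loc_dvd (int_ring F) x z.
Proof. by move=> EF [s [y [Os ns Oy e]]]; exists s, y; split=> //; exact: (int_ring_sub EF). Qed.

(** If [y] lies in [P], multiply it by some [s] outside [P] whose conjugate lies in [P] (by [1]
    when [P] is stable under conjugation); the traces of [s * y] and of [z * s * y] then lie in
    the base field and in [P], and they determine [s * y] up to the factor [z - z']. *)
Lemma loc_gen_quad E a x z z' : subfield_set E -> E (a ^+ 2) -> quad E a `<=` L ->
  quad_conj E a z z' -> z \in Aint -> ~ P (z - z') -> loc_gen E x -> loc_gen (quad E a) x.
Proof.
move=> hE Ea2 qL zz' iz nz lE.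
have [Ea|nEa] := EM (E a); first by rewrite quad_idle.
have hq := quad_subfield hE Ea2; have Eq : E `<=` quad E a := @quad_base E a hE.
have EL : E `<=` L by move=> u /Eq /qL.
have OL2 := int_ring_sub qL.
have Oq u u' : quad_conj E a u u' -> u \in Aint -> int_ring (quad E a) u /\ int_ring (quad E a) u'.
  move=> cu iu; have [q1 q2] := quad_conj_quad hE cu; split; split=> //.
  exact: (quad_conj_int hE Ea2 nEa cu).
have tr_dvd u u' : quad_conj E a u u' -> P u -> P u' -> loc_dvd (int_ring (quad E a)) x (u + u').
  move=> cu Pu Pu'; apply: (loc_dvd_sub Eq); apply: lE; first exact: primeD.
  split; first exact: (quad_conj_tr hE cu).
  by apply: rpredD; [case: (prime_int Pu) | case: (prime_int Pu')].
have [Oz Oz'] := Oq _ _ zz' iz.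
have key u u' : quad_conj E a u u' -> P u -> P u' -> loc_dvd (int_ring (quad E a)) x u.
  move=> cu Pu Pu'; apply: (loc_dvd_cancel hq qL (r := z - z')) => //; first exact: int_ringB.
  have -> : (z - z') * u = (z * u + z' * u') + - z' * (u + u') by ring.
  apply: (loc_dvdD hq qL).
    apply: tr_dvd; first exact: quad_conjM.
      by apply: primeMl => //; exact: OL2.
    by apply: primeMl => //; exact: OL2.
  by apply: (loc_dvd_mull hq); [exact: int_ringN | exact: tr_dvd].
move=> y Py Oy; have [y' cy] := quad_conj_ex (proj1 Oy).
have [Oy1 Oy'] := Oq _ _ cy (proj2 Oy).
have [[s [s' [cs is_ ns Ps']]]|nex] := EM (exists s s', [/\ quad_conj E a s s', s \in Aint, ~ P s & P s']).
  have [Os Os'] := Oq _ _ cs is_.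
  apply: (loc_dvd_cancel hq qL Os ns); apply: (key _ (s' * y')); first exact: quad_conjM.
    by apply: primeMl => //; exact: OL2.
  by apply: primeMr => //; exact: OL2.
apply: (key _ y') => //; apply: contrapT => nPy'; apply: nex; exists y', y; split=> //.
  exact: quad_conjC.
by case: Oy'.
Qed.

(** An element divides the constant term of a polynomial it satisfies, which can be taken
    nonzero for a nonzero element. *)
Lemma prime_above : exists2 l : nat, prime l & P l%:R.
Proof.
have [y Py y0] : exists2 y, P y & y != 0 by case: hP => -[].
have Oy := prime_int Py.
have [p mp rp0] : integralOver (intr : int -> algC) y by apply/Aint_integralP; case: Oy.
have intL (c : int) : OL c%:~R := int_ring_int hL c.
have [m m0 Pm] : exists2 m : int, m != 0 & P m%:~R.
  have [n] := ubnP (size p); elim: n p mp rp0 => // n IH p mp rp sn.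
  have p0 : p != 0 := monic_neq0 mp.
  have [q [c ep]] : exists q c, p = q * 'X + c%:P.
    by elim/poly_ind: p {mp sn rp p0} => [|q c _]; [exists 0, 0; rewrite mul0r addr0 | exists q, c].
  have Pqy : P ((map_poly intr q).[y] * y).
    apply: primeMl => //; elim/poly_ind: q {ep} => [|r d Or].
      by rewrite rmorph0 horner0; exact: (intL 0).
    rewrite rmorphD rmorphM /= map_polyX map_polyC /= hornerMXaddC.
    by apply: (int_ringD hL) => //; apply: (int_ringM hL).
  move: rp; rewrite ep rmorphD rmorphM /= map_polyX map_polyC /= /root hornerMXaddC => rp.
  have [c0|c0] := eqVneq c 0; last first.
    exists c => //; rewrite -[c%:~R](addKr ((map_poly intr q).[y] * y)) (eqP rp) addr0.
    exact: primeN.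
  rewrite c0 addr0 in ep.
  have q0 : q != 0 by apply: contraNneq p0 => q0; rewrite ep q0 mul0r.
  apply: (IH q).
  - by move: mp; rewrite ep monicMr ?monicX.
  - by move: rp; rewrite c0 addr0 mulf_eq0 (negbTE y0) orbF.
  - by move: sn; rewrite ep size_mulX.
have [n [n0 Pn]] : exists n : nat, (0 < n)%N /\ P n%:R.
  exists `|m|%N; split; first by rewrite absz_gt0.
  have [-> // | ->] : (`|m|%N)%:R = m%:~R :> algC \/ (`|m|%N)%:R = - m%:~R :> algC.
    by rewrite -[(absz m)%:R]/((absz m)%:Z%:~R); case: (intP m) => [|k|k]; rewrite ?rmorphN /= ?opprK; auto.
  exact: primeN.
have ex : exists n, (0 < n)%N && `[< P n%:R >] by exists n; rewrite n0; apply/asboolP.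
have [l /andP[l0 /asboolP Pl] lmin] := ex_minnP ex.
exists l => //; apply/primeP; split.
  by case: l l0 Pl {lmin} => [|[|]] // _ h; case: prime1.
move=> d /dvdnP[c ec]; have c0 : (0 < c)%N by case: c ec => // ec; rewrite ec in l0.
have d0 : (0 < d)%N by case: d ec => // ec; rewrite ec muln0 in l0.
have hmin j : (0 < j)%N -> P j%:R -> (l <= j)%N.
  by move=> j0 Pj; apply: lmin; rewrite j0; apply/asboolP.
case: hP => _ _ /(_ c%:R d%:R (int_ring_nat hL c) (int_ring_nat hL d)).
rewrite -natrM -ec => /(_ Pl) [] /hmin; [move/(_ c0)|move/(_ d0)] => h; apply/orP.
  by left; rewrite eqn_leq d0 andbT -(leq_pmul2l c0) -ec muln1.
by right; rewrite eqn_leq h andbT ec leq_pmull.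
Qed.

Lemma prime_int_dvd (l : nat) (m : int) : prime l -> P l%:R -> P m%:~R -> (l %| `|m|)%N.
Proof.
move=> pl Pl Pm; apply: contraT => nd.
have co : coprimez l m by rewrite coprimezE /= prime_coprime.
have [[u v] e] := coprimezP _ _ co.
case: prime1; rewrite -[1]/(1%:~R) -e /= rmorphD !rmorphM /=.
by apply: primeD; apply: primeMl => //; exact: int_ring_int.
Qed.

Lemma prime_int_mem (l : nat) (m : int) : P l%:R -> (l %| `|m|)%N -> P m%:~R.
Proof.
move=> Pl; rewrite -[l]/(absz l%:Z) => /dvdzP[c ->]; rewrite rmorphM /=.
by apply: primeMl => //; exact: int_ring_int.
Qed.

(** If [x] were in the square of [P], then [x] would be divisible by [x ^ 2] in the
    localization, and [x] would be a unit there. *)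
Lemma loc_gen_unramified k x : subfield_set k -> k `<=` L -> P x -> int_ring k x -> x != 0 ->
  loc_gen L x -> ramification_index k L P 1.
Proof.
move=> hk kL Px Ox x0 lL; rewrite /ramification_index /ideal_exp /=.
have O1 : OL 1 := int_ring1 hL.
have PO z : ideal_prod P OL z -> P z.
  move: z; apply: ideal_prod_min; [exact: prime0 | exact: primeD | by move=> u v Pu Ov; apply: primeMr].
split.
  by move=> _ [s hs ->]; exists s => // u /hs[[] ].
move=> /(_ x) []; first by rewrite -[x]mulr1; apply: ideal_prod_mul.
move=> s hs ex; have : loc_dvd OL (x * x) x.
  rewrite [X in loc_dvd _ _ X]ex; have : forall u, u \in s -> loc_dvd OL (x * x) (u.1 * u.2).
    move=> u /hs[Pu /PO Pv]; apply: (loc_dvdM hL) => //; apply: lL => //; exact: prime_int.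
  elim: s {hs ex} => [|u s IH] h; first by rewrite big_nil; exact: (loc_dvd0 hL).
  rewrite big_cons; apply: (loc_dvdD hL) => //; first by apply: h; rewrite inE eqxx.
  by apply: IH => v vs; apply: h; rewrite inE vs orbT.
move=> [t [y [Ot nt Oy e]]]; apply: nt.
have -> : t = x * y by apply: (mulIf x0); rewrite e; ring.
exact: primeMr.
Qed.
End Localize.

Lemma Crat_Aint_int x : x \in Crat -> x \in Aint -> exists m : int, x = m%:~R.
Proof. by move=> Qx Ax; have /intrP := Cint_rat_Aint Qx Ax. Qed.

Section BaseField.
Variables (p q : nat) (w : algC) (L P : set algC).
Local Notation D := (p * q)%N.
Hypotheses (pp : prime p) (pq : prime q) (npq : p != q) (D8 : (D %% 8 = 1)%N).
Hypothesis (ww : w ^+ 2 = - D%:R).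
Local Notation k := (quad ratC w).
Hypotheses (hL : subfield_set L) (kL : k `<=` L) (hP : nz_prime_ideal (int_ring L) P).

Let ratw : ratC (w ^+ 2).
Proof. by rewrite ww /ratC /= rpredN rpred_nat. Qed.
Let hk : subfield_set k := quad_subfield ratC_subfield ratw.
Let ratL : ratC `<=` L. Proof. exact: sf_Crat_sub. Qed.
Let intP_ (m : int) : int_ring L m%:~R := int_ring_int hL m.
Let kint (m : int) : int_ring k m%:~R := int_ring_int hk m.
Let kw : int_ring k w.
Proof. by split; [exact: (quad_gen _ ratC_subfield) | apply: Aint_sqrt; rewrite ww rpredN rpred_nat]. Qed.
Let Lw : int_ring L w. Proof. exact: (int_ring_sub kL). Qed.
Let D4 : (D %% 4 = 1)%N. Proof. by move: D8; clear; lia. Qed.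
Let kE z : int_ring k z -> exists x y : int, z = x%:~R + y%:~R * w.
Proof. by move/(quad_ratC_int D4 (fun l => prime_mul_squarefree pp pq npq (l := l)) ww). Qed.

Lemma rational_loc_gen (l : nat) : prime l -> P l%:R -> loc_gen P ratC l%:R.
Proof.
move=> pl Pl z Pz [Qz iz]; have [m em] := Crat_Aint_int Qz iz.
have : (l %| `|m|)%N by apply: (prime_int_dvd hL hP pl) => //; rewrite -em.
rewrite -[l]/(absz l%:Z) => /dvdzP[c ec]; exists 1, c%:~R; split.
- exact: (int_ring1 ratC_subfield).
- exact: (prime1 hP).
- exact: (int_ring_int ratC_subfield).
- by rewrite em ec mul1r rmorphM /= mulrC.
Qed.

(** [1 + w] has norm [1 + p * q], which is twice an odd number. *)
Lemma base_loc_gen_two : P 2 -> P (1 + w) /\ loc_gen P k (1 + w).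
Proof.
move=> P2; have Pw : P (1 + w).
  apply: (prime_sqr hP); first by apply: (int_ringD hL) => //; exact: int_ring1.
  have -> : (1 + w) ^+ 2 = ((1 - D%:Z)%:~R + 2 * w).
    by rewrite rmorphB /= -[D%:~R]/(D%:R) -[D%:R]opprK -ww; ring.
  apply: (primeD hP); last exact: (primeMr hP).
  by apply: (prime_int_mem hL hP P2); move: D4; clear; lia.
split=> // z Pz /kE [x [y ez]].
have Pxy : P (x - y)%:~R.
  have -> : (x - y)%:~R = z - y%:~R * (1 + w) by rewrite ez rmorphB /=; ring.
  by apply: (primeB hL hP) => //; exact: (primeMl hP).
have [m em] : exists m : int, x - y = m * 2.
  by apply/dvdzP; exact: (prime_int_dvd hL hP (l := 2) (m := x - y)).
have [n en] : exists n : nat, D.+1 = (4 * n + 2)%N.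
  by exists (D.+1 %/ 4)%N; move: D4; clear; lia.
exists (n.*2.+1)%:R, (m%:~R * (1 - w) + n.*2.+1%:R * y%:~R); split.
- exact: (int_ring_nat hk).
- move=> Pn; suff : (2 %| `|n.*2.+1%:Z|)%N by rewrite absz_nat dvdn2 /= odd_double.
  exact: (prime_int_dvd hL hP (l := 2) (m := n.*2.+1%:Z)).
- apply: (int_ringD hk); apply: (int_ringM hk) => //; last exact: (int_ring_nat hk).
  by apply: (int_ringB hk) => //; exact: int_ring1.
- have e2 : (n.*2.+1)%:R * 2 = (1 + w) * (1 - w).
    have -> : (1 + w) * (1 - w) = 1 - w ^+ 2 by ring.
    rewrite ww opprK nat1r -natrM en; congr (_%:R).
    by clear; lia.
  have -> : z = m%:~R * 2 + y%:~R * (1 + w).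
    have -> : m%:~R * 2 = (x - y)%:~R :> algC by rewrite em rmorphM.
    by rewrite ez rmorphB /=; ring.
  have -> : (1 + w) * (m%:~R * (1 - w) + n.*2.+1%:R * y%:~R) =
      m%:~R * ((1 + w) * (1 - w)) + n.*2.+1%:R * y%:~R * (1 + w) by ring.
  by rewrite -e2; ring.
Qed.

(** [l] is a unit times [w ^ 2] in the localization. *)
Lemma base_loc_gen_dvd (l l' : nat) : prime l -> coprime l l' -> D = (l * l')%N -> P l%:R ->
  P w /\ loc_gen P k w.
Proof.
move=> pl co eD Pl; have Pw : P w.
  apply: (prime_sqr hP) => //; rewrite ww eD natrM; apply: (primeN hL hP).
  by apply: (primeMr hP) => //; exact: (int_ring_nat hL).
split=> // z Pz /kE [x [y ez]].
have Px : P x%:~R.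
  have -> : x%:~R = z - y%:~R * w by rewrite ez; ring.
  by apply: (primeB hL hP) => //; exact: (primeMl hP).
have [m em] : exists m : int, x = m * l%:Z.
  by apply/dvdzP; rewrite dvdzE; exact: (prime_int_dvd hL hP pl Pl Px).
exists l'%:R, (- (w * m%:~R) + l'%:R * y%:~R); split.
- exact: (int_ring_nat hk).
- move=> Pl'; have := prime_int_dvd hL hP (m := l'%:Z) pl Pl Pl'.
  by rewrite absz_nat; move: co; rewrite prime_coprime // => /negbTE ->.
- apply: (int_ringD hk); last by apply: (int_ringM hk) => //; exact: (int_ring_nat hk).
  by apply: (int_ringN hk); apply: (int_ringM hk).
- have eDC : l%:R * l'%:R = - w ^+ 2 :> algC by rewrite ww opprK eD natrM.
  rewrite ez em rmorphM /= -[(Posz l)%:~R]/(l%:R).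
  have -> : l'%:R * (m%:~R * l%:R + y%:~R * w) = m%:~R * (l%:R * l'%:R) + l'%:R * y%:~R * w :> algC by ring.
  by rewrite eDC; ring.
Qed.

Lemma base_loc_gen_odd (l : nat) : prime l -> odd l -> ~~ (l %| D)%N -> P l%:R ->
  loc_gen P k l%:R.
Proof.
move=> pl ol nl Pl; have QwQ : quad_conj ratC w w (- w).
  by have := quad_conj_gen w ratC_subfield (sf1 ratC_subfield); rewrite mul1r.
apply: (loc_gen_quad hP ratC_subfield ratw kL QwQ) => //.
- by case: kw.
- move=> h; have : P (4 * D%:Z)%:~R.
    have -> : (4 * D%:Z)%:~R = - ((w - - w) * (w - - w)) :> algC.
      rewrite (_ : _ * _ = 4 * w ^+ 2); last by ring.
      by rewrite ww rmorphM /= mulrN opprK.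
    apply: (primeN hL hP); apply: (primeMr hP) => //.
    by apply: (int_ringB hL) => //; apply: (int_ringN hL).
  move/(prime_int_dvd hL hP pl Pl); rewrite abszM absz_nat Euclid_dvdM // (negbTE nl) orbF.
  by rewrite (_ : `|4|%N = 2 ^ 2)%N // Euclid_dvdX // andbT dvdn_prime2 // => /eqP el; rewrite el in ol.
- exact: rational_loc_gen.
Qed.

(** The uniformizer is [1 + w], [w] or the residue characteristic, according to whether
    the prime lies above [2], above a divisor of [D], or is unramified over [Q]. *)
Lemma base_loc_gen : exists x, [/\ P x, int_ring k x, x != 0 & loc_gen P k x].
Proof.
have [l pl Pl] := prime_above hL hP.
have D0 : D%:R != 0 :> algC by rewrite pnatr_eq0 -lt0n muln_gt0 !prime_gt0.
have w0 : w != 0 by rewrite -sqrf_eq0 ww oppr_eq0.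
have [l2|nl2] := eqVneq l 2%N.
  rewrite l2 in Pl; have [Pw lw] := base_loc_gen_two Pl; exists (1 + w); split=> //.
    by apply: (int_ringD hk) => //; exact: int_ring1.
  apply: contraTneq isT => /eqP; rewrite addrC addr_eq0 => /eqP ew.
  move: ww; rewrite ew sqrrN expr1n => /esym/eqP; rewrite eqr_oppLR => /eqP e1.
  have : 0 <= -1 :> algC by rewrite -e1 ler0n.
  by rewrite oppr_ge0 ler10.
have ol : odd l by case: (even_prime pl) => // h; rewrite h in nl2.
have [lD|nlD] := boolP (l %| D)%N.
  have [l' [eD co]] : exists l', D = (l * l')%N /\ coprime l l'.
    move: lD; rewrite Euclid_dvdM // !dvdn_prime2 // => /orP[/eqP ->|/eqP ->].
      by exists q; split=> //; rewrite prime_coprime // dvdn_prime2.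
    by exists p; split; [rewrite mulnC | rewrite prime_coprime // dvdn_prime2 // eq_sym].
  by have [Pw lw] := base_loc_gen_dvd pl co eD Pl; exists w.
exists l%:R; split=> //; first exact: (int_ring_nat hk).
  by rewrite pnatr_eq0 -lt0n prime_gt0.
exact: base_loc_gen_odd.
Qed.
End BaseField.

(** * The congruence modulo 4 *)

(** The quotients by 4 in [gauss_mod4], in the basis [1, I, om, I * om]. *)
Definition mod4_quot0 (x1 y f t1 c2 m v2 s1 E : int) : int :=
  f * x1 + (2) * x1 * y + (2) * t1 * x1 + x1 * x1 + (2) * x1 + (-1) * f + t1 + f * y + y * y +
    (2) * t1 * y + (4) * E * f + E * y + (2) * E * t1 + E * x1 + (2) * E + (2) * f * m + (2) * m
    * y + (4) * m * t1 + (2) * m * x1 + m + (-4) * f * s1 * v2 + (-2) * f * v2 + (-4) * s1 * v2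
    * y + (-4) * v2 * y + (-8) * s1 * t1 * v2 + (-4) * t1 * v2 + (-2) * f * s1 + (-2) * s1 * y +
    (-4) * s1 * t1 + (-1) * c2 + (-1) * f * f + (-2) * c2 * f + (2) * E * c2 + (2) * E * f * f +
    (4) * E * c2 * f.
Definition mod4_quot1 (x1 y f t1 c2 m v2 s1 E : int) : int :=
  (2) * f * s1 * x1 + f * x1 + (2) * s1 * x1 * y + (2) * x1 * y + (4) * s1 * t1 * x1 + (2) * t1
    * x1 + (3) * f * s1 + (2) * f + (3) * s1 * y + (4) * y + (6) * s1 * t1 + (5) * t1 + (2) * f
    * s1 * y + f * y + (2) * s1 * y * y + (2) * y * y + (4) * s1 * t1 * y + (2) * t1 * y + (2) *
    E * f * s1 + (2) * E * f + (2) * E * s1 * y + (2) * E * y + (4) * E * s1 * t1 + (2) * E * t1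
    + (4) * f * m * s1 + (2) * f * m + (4) * m * s1 * y + (4) * m * y + (8) * m * s1 * t1 + (4)
    * m * t1 + (2) * f * v2 + (2) * v2 * y + (4) * t1 * v2 + (2) * v2 * x1 + v2 + x1 + (-2) * c2
    + (-2) * c2 * f + (-2) * c2 * c2 + E + (4) * E * c2 + (4) * E * c2 * f + (4) * E * c2 * c2.
Definition mod4_quot2 (x1 y f t1 c2 m v2 s1 E : int) : int :=
  (2) * x1 * x1 + (4) * x1 + (1) + (2) * x1 * y + (-1) * y + (2) * E * x1 + (2) * E + (4) * m *
    x1 + (2) * m + (-4) * v2 * y + (-1) * f + (2) * E * f.
Definition mod4_quot3 (x1 y f t1 c2 m v2 s1 E : int) : int :=
  (2) * x1 * y + (3) * y + (2) * y * y + (2) * E * y + (4) * m * y + (4) * v2 * x1 + (2) * v2 +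
    (2) * x1 + (-1) * f + (-2) * c2 + (2) * E + (2) * E * f + (4) * E * c2.

Section Mod4.
Variables (F : fieldType) (I om : F).
Hypothesis I2 : I ^+ 2 = -1.

Lemma gaussM (a b c d : F) : (a + b * I) * (c + d * I) = (a * c - b * d) + (a * d + b * c) * I.
Proof.
transitivity (a * c + b * d * I ^+ 2 + (a * d + b * c) * I); first by ring.
by rewrite I2; ring.
Qed.

(** Modulo 4, both sides are [+- (1 + 2 * c1 + 2 * om + 2 * (1 + f) * I)]; the square of
    [1 + (1 + I) * (om + c)] is computed with [om ^ 2 + om + c = 0] for [c = c1 - f * I]. *)
Lemma gauss_mod4 (x1 y f t1 c2 m v2 s1 E : int) :
  let c1 := 1 + f + 2 * c2 in let t := f + y + 2 * t1 in let s := 1 + 2 * s1 in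
  let x := 1 + 2 * x1 in let va := 1 + 2 * (1 + x1 + y + E + 2 * m) in let vb := 2 + 4 * v2 in
  let c : F := c1%:~R - f%:~R * I in
  om ^+ 2 = - om - c ->
  (va%:~R + vb%:~R * I) *
    (2 * t%:~R * (1 + s%:~R * I) + (x%:~R + 2 * y%:~R * I) * (1 + 2 * om)) =
  (1 - 2 * E)%:~R * (1 + (1 + I) * (om + c)) ^+ 2 +
  4 * (((mod4_quot0 x1 y f t1 c2 m v2 s1 E)%:~R + (mod4_quot1 x1 y f t1 c2 m v2 s1 E)%:~R * I) +
       ((mod4_quot2 x1 y f t1 c2 m v2 s1 E)%:~R + (mod4_quot3 x1 y f t1 c2 m v2 s1 E)%:~R * I) * om).
Proof.
move=> c1 t s x va vb c om2.
have [ec1 et es ex] : [/\ c1 = 1 + f + 2 * c2, t = f + y + 2 * t1, s = 1 + 2 * s1 & x = 1 + 2 * x1] by [].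
have [eva evb] : va = 1 + 2 * (1 + x1 + y + E + 2 * m) /\ vb = 2 + 4 * v2 by [].
clearbody c1 t s x va vb.
pose A : F := (1 + c1 + f)%:~R + (c1 - f)%:~R * I.
pose B : F := 1%:~R + 1%:~R * I.
have -> : 1 + (1 + I) * (om + c) = A + B * om.
  rewrite /A /B /c rmorph1 mul1r !(rmorphD, rmorphB) rmorph1.
  transitivity (1 + (1 + 1 * I) * (c1%:~R + (- f%:~R) * I) + (1 + I) * om); first by ring.
  by rewrite gaussM; ring.
have -> : (A + B * om) ^+ 2 = (A * A - B * B * c) + (2 * (A * B) - B * B) * om.
  transitivity (A * A + 2 * (A * B) * om + B * B * om ^+ 2); first by ring.
  by rewrite om2; ring.
have -> : 2 * t%:~R * (1 + s%:~R * I) + (x%:~R + 2 * y%:~R * I) * (1 + 2 * om) =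
    ((2 * t + x)%:~R + (2 * t * s + 2 * y)%:~R * I) + ((2 * x)%:~R + (4 * y)%:~R * I) * om.
  by rewrite !(rmorphD, rmorphM) /=; ring.
have -> : c = c1%:~R + (- f)%:~R * I by rewrite /c rmorphN mulNr.
rewrite mulrDr mulrA /A /B !gaussM eva evb ex es et ec1 /mod4_quot0 /mod4_quot1 /mod4_quot2 /mod4_quot3.
by rewrite !(rmorphD, rmorphB, rmorphM, rmorphN, rmorph1) /=; ring.
Qed.

End Mod4.

(** * Unramified primes *)

Ltac in_field h :=
  repeat first [assumption | exact: (sf1 h) | exact: (sf_int h) | exact: (sf_nat h)
    | apply: (sfD h) | apply: (sfN h) | apply: (sfM h) | apply: (sfV h) | apply: (sfX h)].
Ltac in_Aint :=
  repeat first [assumption | exact: rpred1 | exact: rpred_int | exact: rpred_nat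
    | apply: rpredD | rewrite rpredN | apply: rpredM | apply: rpredX].

Section Steps.
Variables (L P : set algC).
Hypotheses (hL : subfield_set L) (hP : nz_prime_ideal (int_ring L) P).

(** Away from 2, a square root [c * a] that is a unit differs from its conjugate by a unit. *)
Lemma loc_gen_odd_sqrt E a c x : subfield_set E -> E (a ^+ 2) -> quad E a `<=` L -> E c ->
  (c * a) ^+ 2 \in Aint -> ~ P 2 -> ~ P ((c * a) ^+ 2) -> loc_gen P E x -> loc_gen P (quad E a) x.
Proof.
move=> hE Ea qL Ec i2 n2 nz; have iz := Aint_sqrt i2.
have Oz : int_ring L (c * a).
  by split=> //; apply: qL; apply: (quad_mul hE Ea); [exact: quad_base | exact: quad_gen].
apply: (loc_gen_quad hP hE Ea qL (quad_conj_gen a hE Ec) iz) => h; apply: nz.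
rewrite expr2; apply: (primeMl hP) => //.
have h2 : P (2 * (c * a)) by rewrite mulr_natl mulr2n -{2}[c * a]opprK.
by case: hP => _ _ /(_ _ _ (int_ring_nat hL 2) Oz h2) [].
Qed.

(** [(h + c * a) / 2] is integral, as [(c * a) ^ 2] is congruent to [h ^ 2] modulo 4. *)
Lemma loc_gen_half E a c h x : subfield_set E -> E (a ^+ 2) -> quad E a `<=` L -> E c -> E h ->
  h \in Aint -> ((c * a) ^+ 2 - h ^+ 2) / 4 \in Aint -> ~ P ((c * a) ^+ 2) ->
  loc_gen P E x -> loc_gen P (quad E a) x.
Proof.
move=> hE Ea qL Ec Eh ih i4 nz.
have cz : quad_conj E a ((h + c * a) / 2) ((h - c * a) / 2).
  exists (h / 2), (c / 2); split; first by in_field hE.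
  - by in_field hE.
  - by ring.
  - by ring.
apply: (loc_gen_quad hP hE Ea qL cz).
  apply: (Aint_quadratic (t := h) (n := - (((c * a) ^+ 2 - h ^+ 2) / 4))) => //.
    by rewrite rpredN.
  by field.
have -> : (h + c * a) / 2 - (h - c * a) / 2 = c * a by field.
move=> Pca; apply: nz; rewrite expr2; apply: (primeMl hP) => //.
exact: (prime_int hP).
Qed.

Lemma loc_gen_two_sqrt E a c x : subfield_set E -> E (a ^+ 2) -> quad E a `<=` L -> E c -> P 2 ->
  ((c * a) ^+ 2 - 1) / 4 \in Aint -> loc_gen P E x -> loc_gen P (quad E a) x.
Proof.
move=> hE Ea qL Ec P2 i4.
apply: (loc_gen_half hE Ea qL Ec (sf1 hE)); rewrite ?expr1n //.
move=> h; apply: (prime1 hP).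
have -> : 1 = (c * a) ^+ 2 - 2 * (2 * (((c * a) ^+ 2 - 1) / 4)) by field.
apply: (primeB hL hP) => //; apply: (primeMr hP) => //.
apply: (int_ringM hL); [exact: (int_ring_nat hL) | split=> //].
apply: qL; apply: (@quad_base E a hE); rewrite exprMn.
by in_field hE.
Qed.
End Steps.

Lemma quarter_Aint (m : nat) : (m %% 4 = 1)%N -> (m%:R - 1) / 4 \in Aint.
Proof.
move=> m4; have -> : m = (4 * (m %/ 4) + 1)%N by move: m4; clear; lia.
rewrite natrD natrM (_ : _ / 4 = (m %/ 4)%:R); first exact: rpred_nat.
by field.
Qed.

(** At a prime above 2, [k (I)] is generated over [k] by the half-integer
    [(1 + w * I) / 2], and [F (s0)] by [(1 + s0) / 2]. *)
Lemma loc_gen_two_tower (L P k : set algC) (w I s0 z : algC) (D : nat) (c1 f : int) :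
    let F := quad k I in let E := quad F s0 in
    subfield_set L -> nz_prime_ideal (int_ring L) P -> P 2 -> subfield_set k -> k w -> E `<=` L ->
    w ^+ 2 = - D%:R -> (D %% 4 = 1)%N -> I ^+ 2 = -1 ->
    s0 ^+ 2 = (1 - 4 * c1)%:~R + 4 * f%:~R * I ->
  loc_gen P k z -> loc_gen P E z.
Proof.
move=> F E hL hP P2 hk kw EL ww D4 I2 s02 lk.
have kI2 : k (I ^+ 2) by rewrite I2; in_field hk.
have hF : subfield_set F := quad_subfield hk kI2.
have FI : F I by exact: (quad_gen _ hk).
have Fs2 : F (s0 ^+ 2) by rewrite s02; in_field hF.
have FL : F `<=` L by move=> u /(@quad_base F s0 hF) /EL.
have iI : I \in Aint by apply: Aint_sqrt; rewrite I2 rpredN rpred1.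
apply: (loc_gen_two_sqrt hL hP hF Fs2 EL (c := 1)) => //; first exact: sf1.
  rewrite mul1r s02 rmorphB rmorphM rmorph1 /= (_ : _ / 4 = - c1%:~R + f%:~R * I); first by in_Aint.
  by field.
apply: (loc_gen_two_sqrt hL hP hk kI2 FL (c := w)) => //.
by rewrite exprMn I2 ww mulrN1 opprK; apply: quarter_Aint.
Qed.

Section Unramified.
Variables (p q : nat) (w I s0 r nu : algC) (e f x y t s c1 va vb ra rb sg : int).
Local Notation D := (p * q)%N.
Hypotheses (pp : prime p) (pq : prime q) (npq : p != q) (p4 : (p %% 4 = 1)%N)
  (D8 : (D %% 8 = 1)%N) (ww : w ^+ 2 = - D%:R).
Hypotheses (I2 : I ^+ 2 = -1) (s1 : s ^+ 2 = 1) (efD : e ^+ 2 + (4 * f) ^+ 2 = D%:Z)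
  (st : s * t ^+ 2 = f * (x ^+ 2 - 4 * y ^+ 2) + e * x * y)
  (s02 : s0 ^+ 2 = e%:~R + 4 * f%:~R * I) (ec1 : e = 1 - 4 * c1)
  (cxy : coprimez x (2 * y)).
Local Notation al := (2 * t%:~R * (1 + s%:~R * I)).
Local Notation be := (x%:~R + 2 * y%:~R * I).
Local Notation be' := (x%:~R - 2 * y%:~R * I).
Local Notation mu := (al + be * s0).
Local Notation A := (e%:~R + 4 * f%:~R * I).
Local Notation Ab := (e%:~R - 4 * f%:~R * I).
Local Notation vp := (va%:~R + vb%:~R * I).
Local Notation rh := (ra%:~R + rb%:~R * I).
Hypotheses (vab : va ^+ 2 + vb ^+ 2 = p%:Z) (rab : ra ^+ 2 + rb ^+ 2 = q%:Z)
  (sg2 : sg ^+ 2 = 1) (s0vr : s0 ^+ 2 = sg%:~R * vp * rh)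
  (r2 : r ^+ 2 = p%:R) (nu2 : nu ^+ 2 = vp * mu) (nu0 : nu != 0).
Variables (ep : algC) (h eta : algC).
Local Notation k := (quad ratC w).
Local Notation F := (quad k I).
Local Notation E := (quad F s0).
Local Notation M := (quad E r).
Local Notation L := (quad M nu).
Hypotheses (ep2 : ep = 1 \/ ep = I) (Eh : E h) (ih : h \in Aint) (ieta : eta \in Aint)
  (hmod : ep ^+ 2 * nu ^+ 2 = h ^+ 2 + 4 * eta)
  (h1 : exists2 kp, kp \in Aint & E kp /\ h = 1 + (1 + I) * kp).

Let D0 : D%:R != 0 :> algC. Proof. by rewrite pnatr_eq0 -lt0n muln_gt0 !prime_gt0. Qed.
Let AAb : A * Ab = D%:R.
Proof.
transitivity (e%:~R ^+ 2 - 16 * f%:~R ^+ 2 * I ^+ 2 : algC); first by ring.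
by rewrite I2 -[D%:R]/(D%:Z%:~R) -efD !(rmorphD, rmorphM) /=; ring.
Qed.
Let A0 : A != 0. Proof. by apply: contraNneq D0 => h0; rewrite -AAb h0 mul0r. Qed.
Let s00 : s0 != 0. Proof. by rewrite -sqrf_eq0 s02. Qed.
Let vpp : vp * (va%:~R - vb%:~R * I) = p%:R.
Proof.
transitivity (va%:~R ^+ 2 - vb%:~R ^+ 2 * I ^+ 2 : algC); first by ring.
by rewrite I2 -[p%:R]/(p%:Z%:~R) -vab !(rmorphD, rmorphM) /=; ring.
Qed.
Let rhq : rh * (ra%:~R - rb%:~R * I) = q%:R.
Proof.
transitivity (ra%:~R ^+ 2 - rb%:~R ^+ 2 * I ^+ 2 : algC); first by ring.
by rewrite I2 -[q%:R]/(q%:Z%:~R) -rab !(rmorphD, rmorphM) /=; ring.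
Qed.
Let pC0 : p%:R != 0 :> algC. Proof. by rewrite pnatr_eq0 -lt0n prime_gt0. Qed.
Let vp0 : vp != 0. Proof. by apply: contraNneq pC0 => h0; rewrite -vpp h0 mul0r. Qed.
Let mu0 : mu != 0.
Proof. by apply: contraNneq nu0 => h0; rewrite -sqrf_eq0 nu2 h0 mulr0. Qed.

Let hk : subfield_set k.
Proof. by apply: quad_subfield; [exact: ratC_subfield | rewrite ww /ratC /= rpredN rpred_nat]. Qed.
Let kw : k w. Proof. exact: (quad_gen _ ratC_subfield). Qed.
Let kI2 : k (I ^+ 2). Proof. by rewrite I2; in_field hk. Qed.
Let hF : subfield_set F := quad_subfield hk kI2.
Let FI : F I. Proof. exact: (quad_gen _ hk). Qed.
Let Fs2 : F (s0 ^+ 2). Proof. by rewrite s02; in_field hF. Qed.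
Let hE : subfield_set E := quad_subfield hF Fs2.
Let Er2 : E (r ^+ 2). Proof. by rewrite r2; in_field hE. Qed.
Let hM : subfield_set M := quad_subfield hE Er2.
Let kF : k `<=` F := @quad_base k I hk.
Let FE : F `<=` E := @quad_base F s0 hF.
Let EM_ : E `<=` M := @quad_base E r hE.
Let Es0 : E s0. Proof. exact: (quad_gen _ hF). Qed.
Let EI : E I. Proof. exact: FE. Qed.
Let Ew : E w. Proof. by apply: FE; exact: kF. Qed.
Let MI : M I. Proof. exact: EM_. Qed.
Let Ms0 : M s0. Proof. exact: EM_. Qed.
Let Mw : M w. Proof. exact: EM_. Qed.
Let Mn2 : M (nu ^+ 2). Proof. by rewrite nu2; in_field hM. Qed.
Let hL : subfield_set L := quad_subfield hM Mn2.
Let ML : M `<=` L := @quad_base M nu hM.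
Let EL : E `<=` L. Proof. by move=> z /EM_ /ML. Qed.
Let FL : F `<=` L. Proof. by move=> z /FE /EL. Qed.
Let kL : k `<=` L. Proof. by move=> z /kF /FL. Qed.
Let LI : L I. Proof. exact: FL. Qed.
Let Ls0 : L s0. Proof. exact: EL. Qed.
Let Lw : L w. Proof. exact: kL. Qed.
Let iI : I \in Aint. Proof. by apply: Aint_sqrt; rewrite I2 rpredN rpred1. Qed.
Let iw : w \in Aint. Proof. by apply: Aint_sqrt; rewrite ww rpredN rpred_nat. Qed.
Let is0 : s0 \in Aint. Proof. by apply: Aint_sqrt; rewrite s02; in_Aint. Qed.

Variable P : set algC.
Hypothesis hP : nz_prime_ideal (int_ring L) P.

Ltac in_OL := split; [by in_field hL | by in_Aint].

Let Pdvd (l : nat) (m : int) : prime l -> P l%:R -> P m%:~R -> (l %| `|m|)%N := @prime_int_dvd L P hL hP l m.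
Let Pmul u v : int_ring L u -> int_ring L v -> P (u * v) -> P u \/ P v.
Proof. by case: hP => _ _; apply. Qed.

Section OddPrime.
Variable l : nat.
Hypotheses (pl : prime l) (ol : odd l) (Pl : P l%:R).

Let n2 : ~ P 2.
Proof.
move=> h2; have := Pdvd (m := 2) pl Pl h2; rewrite /= dvdn_prime2 // => /eqP el.
by move: ol; rewrite el.
Qed.
Let Phalf u : int_ring L u -> P (2 * u) -> P u.
Proof. by move=> Ou /(Pmul (int_ring_nat hL 2) Ou)[]. Qed.
Let ldvd2 (m : nat) : (l %| 2 * m)%N = (l %| m)%N.
Proof. by rewrite Euclid_dvdM // dvdn_prime2 //; case: eqP => // el; move: ol; rewrite el. Qed.
Let sqf : ~~ (l ^ 2 %| D)%N. Proof. exact: prime_mul_squarefree. Qed.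

Let be_be'_notP : P be -> P be' -> False.
Proof.
move=> h0 h0'.
have lx : (l %| `|x|)%N.
  rewrite -ldvd2 -[2%N]/`|2|%N -abszM; apply: Pdvd => //.
  by rewrite rmorphM /= (_ : _ * _ = be + be'); [exact: (primeD hP) | ring].
have ly : (l %| (absz (2 * y)%R))%N.
  rewrite -ldvd2 -[2%N]/`|2|%N -abszM; apply: Pdvd => //.
  rewrite !rmorphM /= (_ : _ * _ = - I * (be - be')).
    by apply: (primeMl hP); [in_OL | exact: (primeB hL hP)].
  transitivity (4 * y%:~R * (- I ^+ 2)); last by ring.
  by rewrite I2; ring.
have : (l %| gcdn `|x| (absz (2 * y)%R))%N by rewrite dvdn_gcd lx ly.
move: cxy; rewrite /coprimez /gcdz => /eqP [->]; rewrite dvdn1 => /eqP l1.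
by move: pl; rewrite l1.
Qed.

Let R : int := e * (x ^+ 2 - 4 * y ^+ 2) - 16 * f * x * y.
Let N : int := x ^+ 2 + 4 * y ^+ 2.
Let stC : s%:~R * t%:~R ^+ 2 = f%:~R * (x%:~R ^+ 2 - 4 * y%:~R ^+ 2) + e%:~R * x%:~R * y%:~R :> algC.
Proof.
transitivity ((s * t ^+ 2)%:~R : algC); first by rewrite rmorphM rmorphXn.
by rewrite st !(rmorphD, rmorphB, rmorphM, rmorphXn) /=; ring.
Qed.
Let be2A : be ^+ 2 * A = R%:~R + 4 * (s * t ^+ 2)%:~R * I.
Proof.
rewrite rmorphM rmorphXn /= stC /R.
transitivity (x%:~R ^+ 2 * e%:~R + 4 * x%:~R * y%:~R * e%:~R * I + 4 * f%:~R * x%:~R ^+ 2 * I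
  + (4 * y%:~R ^+ 2 * e%:~R + 16 * x%:~R * y%:~R * f%:~R + 16 * y%:~R ^+ 2 * f%:~R * I) * I ^+ 2 : algC); first by ring.
by rewrite I2 !(rmorphD, rmorphB, rmorphM, rmorphXn) /=; ring.
Qed.
Let be2Ab : be' ^+ 2 * Ab = R%:~R - 4 * (s * t ^+ 2)%:~R * I.
Proof.
rewrite rmorphM rmorphXn /= stC /R.
transitivity (x%:~R ^+ 2 * e%:~R - 4 * x%:~R * y%:~R * e%:~R * I - 4 * f%:~R * x%:~R ^+ 2 * I
  + (4 * y%:~R ^+ 2 * e%:~R + 16 * x%:~R * y%:~R * f%:~R - 16 * y%:~R ^+ 2 * f%:~R * I) * I ^+ 2 : algC); first by ring.
by rewrite I2 !(rmorphD, rmorphB, rmorphM, rmorphXn) /=; ring.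
Qed.
Let RN : R ^+ 2 + 16 * t ^+ 4 = D%:Z * N ^+ 2.
Proof.
have -> : 16 * t ^+ 4 = 16 * (s * t ^+ 2) ^+ 2 by rewrite exprMn s1; ring.
by rewrite st -efD /R /N; ring.
Qed.

(** The factors [mu], [al + g] and [al - g] have no common odd prime: such a prime divides
    [t] and both [be ^ 2 * A], [be' ^ 2 * A'], and comparing norms it would divide [x] and
    [2 * y]. *)
Lemma mu_factors_coprime g : g ^+ 2 = - (Ab * be' ^+ 2) -> int_ring L g ->
  P mu -> P (al + g) -> P (al - g) -> False.
Proof.
move=> g2 Og Pmu Pp Pm.
have Oal : int_ring L al by in_OL.
have Pal : P al.
  apply: Phalf => //; rewrite (_ : 2 * al = (al + g) + (al - g)); last by ring.
  exact: (primeD hP).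
have Pg : P g by rewrite (_ : g = (al + g) - al); [exact: (primeB hL hP) | ring].
have Pbs : P (be * s0) by rewrite (_ : be * s0 = mu - al); [exact: (primeB hL hP) | ring].
have PA : P (be ^+ 2 * A).
  by rewrite -s02 -exprMn expr2; apply: (primeMl hP) => //; exact: (prime_int hP).
have PAb : P (be' ^+ 2 * Ab).
  rewrite mulrC -[_ * _]opprK -g2; apply: (primeN hL hP); rewrite expr2.
  by apply: (primeMl hP).
have lt : (l %| `|t|)%N.
  rewrite -ldvd2 -ldvd2 -[2%N]/`|2|%N -!abszM; apply: Pdvd => //.
  have -> : (2 * (2 * t))%:~R = (1 - s%:~R * I) * al.
    transitivity (2 * t%:~R * (1 - s%:~R ^+ 2 * I ^+ 2) : algC); last by ring.
    by rewrite I2 -rmorphXn /= s1 !rmorphM /=; ring.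
  by apply: (primeMl hP) => //; in_OL.
have Obe : int_ring L be by in_OL.
have Obe' : int_ring L be' by in_OL.
have OA : int_ring L A by in_OL.
have OAb : int_ring L Ab by in_OL.
have sqP u v : int_ring L u -> int_ring L v -> ~ P v -> P (u ^+ 2 * v) -> P u.
  move=> Ou Ov nv h0; have Ou2 : int_ring L (u ^+ 2) by exact: (int_ringX hL).
  by apply: (prime_sqr hP) => //; case: (Pmul Ou2 Ov h0).
have [lD|nlD] := boolP (l %| D)%N; last first.
  have nD : ~ P D%:R.
    by move=> h0; have := Pdvd (m := D%:Z) pl Pl h0; rewrite absz_nat (negbTE nlD).
  apply: be_be'_notP.
    apply: (sqP _ A) => // h0; apply: nD; rewrite -AAb; exact: (primeMr hP).
  apply: (sqP _ Ab) => // h0; apply: nD; rewrite -AAb; exact: (primeMl hP).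
have lR : (l %| `|R|)%N.
  apply: Pdvd => //; rewrite (_ : R%:~R = be ^+ 2 * A - 4 * (s * t ^+ 2)%:~R * I).
    apply: (primeB hL hP) => //; apply: (primeMr hP); first by in_OL.
    apply: (primeMl hP); first by in_OL.
    by apply: (prime_int_mem hL hP Pl); rewrite abszM dvdn_mull // abszX dvdn_exp.
  by rewrite be2A; ring.
have [m em] : exists m, D = (l * m)%N by have /dvdnP[m ->] := lD; exists m; rewrite mulnC.
have nm : ~~ (l %| m)%N by apply: contra sqf => lm; rewrite em expnS expn1 dvdn_mul.
have l0 : (0 < l)%N := prime_gt0 pl.
have lz : l%:Z != 0 by rewrite -absz_gt0.
have [R1 eR] : exists R1, R = R1 * l%:Z by apply/dvdzP.
have [t1 et] : exists t1, t = t1 * l%:Z by apply/dvdzP.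
have lN : (l %| `|N|)%N.
  have : (l %| m * `|N| ^ 2)%N.
    rewrite -[l]/`|l%:Z|%N -[m]/`|m%:Z|%N -abszX -abszM -dvdzE; apply/dvdzP.
    exists (R1 ^+ 2 + 16 * t1 ^+ 4 * l%:Z ^+ 2); apply: (mulfI lz).
    by rewrite mulrA -PoszM -em -RN eR et; ring.
  by rewrite Euclid_dvdM // (negbTE nm) /= Euclid_dvdX // andbT.
have [N1 eN] : exists N1, N = N1 * l%:Z by apply/dvdzP.
have lR1 : (l %| `|R1|)%N.
  have : (l %| `|R1| ^ 2)%N.
    rewrite -[l]/`|l%:Z|%N -abszX -dvdzE; apply/dvdzP.
    exists (m%:Z * N1 ^+ 2 - 16 * t1 ^+ 4 * l%:Z).
    have lz2 : l%:Z ^+ 2 != 0 by rewrite sqrf_eq0.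
    apply: (mulfI lz2).
    transitivity (R ^+ 2); first by rewrite eR; ring.
    rewrite (_ : R ^+ 2 = D%:Z * N ^+ 2 - 16 * t ^+ 4); last by rewrite -RN; ring.
    by rewrite em PoszM eN et; ring.
  by rewrite Euclid_dvdX // andbT.
have [R2 eR1] : exists R2, R1 = R2 * l%:Z by apply/dvdzP.
have nmP : ~ P m%:R.
  by move=> h0; have := Pdvd (m := m%:Z) pl Pl h0; rewrite absz_nat (negbTE nm).
have lC : l%:R != 0 :> algC by rewrite pnatr_eq0 -lt0n.
have fin u v v' z : int_ring L u -> int_ring L v' -> int_ring L z -> v * v' = D%:R ->
    u ^+ 2 * v = l%:R ^+ 2 * z -> P u.
  move=> Ou Ov' Oz vv' uv; apply: (sqP _ m%:R) => //; first exact: (int_ring_nat hL).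
  have -> : u ^+ 2 * m%:R = l%:R * (z * v').
    apply: (mulfI lC); rewrite mulrCA -natrM -em -vv' [u ^+ 2 * _]mulrA uv; ring.
  by apply: (primeMr hP) => //; exact: (int_ringM hL).
apply: be_be'_notP.
  apply: (fin _ A Ab (R2%:~R + 4 * (s * t1 ^+ 2)%:~R * I)) => //; first by in_OL.
  by rewrite be2A eR eR1 et !(rmorphM, rmorphXn) /= -[(Posz l)%:~R]/(l%:R); ring.
apply: (fin _ Ab A (R2%:~R - 4 * (s * t1 ^+ 2)%:~R * I)) => //; first by in_OL.
  by rewrite mulrC.
by rewrite be2Ab eR eR1 et !(rmorphM, rmorphXn) /= -[(Posz l)%:~R]/(l%:R); ring.
Qed.

Let Pintl (m : int) : ~~ (l %| `|m|)%N -> ~ P m%:~R.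
Proof. by move=> nm /(Pdvd pl Pl); apply/negP. Qed.

Let nPl1 : ~~ (l %| 1)%N.
Proof. by rewrite dvdn1; apply: contraTneq pl => ->. Qed.

Lemma loc_gen_odd_F z : loc_gen P k z -> loc_gen P F z.
Proof.
apply: (loc_gen_odd_sqrt hL hP hk kI2 FL (c := 1)) => //; first exact: sf1.
  by rewrite mul1r I2; in_Aint.
by rewrite mul1r I2; exact: (Pintl (m := -1)).
Qed.

(** The square of [s0] and its conjugate [Ab] are coprime; if [P] contains the first, the
    square root [I * w / s0] of the second is used. *)
Lemma loc_gen_odd_E z : loc_gen P F z -> loc_gen P E z.
Proof.
have OA : int_ring L A by in_OL.
have OAb : int_ring L Ab by in_OL.
have [PA|nPA] := EM (P A); last first.
  apply: (loc_gen_odd_sqrt hL hP hF Fs2 EL (c := 1)) => //; first exact: sf1.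
    by rewrite mul1r s02; in_Aint.
  by rewrite mul1r s02.
have e1 : (I * w / A * s0) ^+ 2 = Ab.
  apply: (mulfI A0); rewrite AAb exprMn expr_div_n s02 exprMn I2 ww; field; exact: A0.
apply: (loc_gen_odd_sqrt hL hP hF Fs2 EL (c := I * w / A)) => //.
- by have Fw := kF kw; in_field hF.
- by rewrite e1; case: OAb.
rewrite e1 => PAb.
have le : (l %| `|e|)%N.
  rewrite -ldvd2 -[2%N]/`|2|%N -abszM; apply: Pdvd => //.
  by rewrite rmorphM /= (_ : _ * _ = A + Ab); [exact: (primeD hP) | ring].
have lf : (l %| (absz (4 * f)%R))%N.
  rewrite -ldvd2 -[2%N]/`|2|%N -abszM; apply: Pdvd => //.
  rewrite !rmorphM /= (_ : _ * _ = - I * (A - Ab)).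
    by apply: (primeMl hP); [in_OL | exact: (primeB hL hP)].
  transitivity (8 * f%:~R * (- I ^+ 2)); last by ring.
  by rewrite I2; ring.
have [u eu] : exists u, e = u * l%:Z by apply/dvdzP.
have [v ev] : exists v, 4 * f = v * l%:Z by apply/dvdzP.
case/negP: sqf; rewrite -[D]/`|D%:Z|%N -[(l ^ 2)%N]/`|(l ^ 2)%N%:Z|%N -dvdzE; apply/dvdzP.
by exists (u ^+ 2 + v ^+ 2); rewrite -efD eu ev -mulnn PoszM; ring.
Qed.

(** Above [p], the square root of [q] generates the same extension. *)
Lemma loc_gen_odd_M z : loc_gen P E z -> loc_gen P M z.
Proof.
have ndvd (u : nat) : prime u -> l != u -> ~ P u%:R.
  by move=> pu lu; apply: (Pintl (m := u%:Z)); rewrite absz_nat dvdn_prime2.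
have [lp|nlp] := eqVneq l p; last first.
  apply: (loc_gen_odd_sqrt hL hP hE Er2 ML (c := 1)) => //; first exact: sf1.
    by rewrite mul1r r2; in_Aint.
  by rewrite mul1r r2; exact: ndvd.
have e1 : (I * w / p%:R * r) ^+ 2 = q%:R.
  apply: (mulfI pC0); rewrite -natrM exprMn expr_div_n r2 exprMn I2 ww natrM; field; exact: pC0.
apply: (loc_gen_odd_sqrt hL hP hE Er2 ML (c := I * w / p%:R)) => //.
- by in_field hE.
- by rewrite e1; in_Aint.
- by rewrite e1; apply: ndvd => //; rewrite lp.
Qed.

(** Up to squares of the field, [vp * mu] is any product of one of [vp], [rh] by one of
    [mu], [al + g], [al - g]; one such product is prime to [P]. *)
Lemma loc_gen_odd_L z : loc_gen P M z -> loc_gen P L z.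
Proof.
pose s0b := I * w / s0.
have Ms0b : M s0b by rewrite /s0b; in_field hM.
have s0b2 : s0b ^+ 2 = Ab.
  apply: (mulfI A0); rewrite AAb /s0b expr_div_n s02 exprMn I2 ww; field; exact: A0.
have is0b : s0b \in Aint by apply: Aint_sqrt; rewrite s0b2; in_Aint.
have Ls0b : L s0b by exact: ML.
clearbody s0b; pose g := s%:~R * I * (be' * s0b).
have Mg : M g by rewrite /g; in_field hM.
have Og : int_ring L g by rewrite /g; in_OL.
have g2 : g ^+ 2 = - (Ab * be' ^+ 2).
  by rewrite /g !exprMn s0b2 I2 -rmorphXn /= s1 rmorph1; ring.
have gm := mu_factors_coprime g2 Og.
have Oal : int_ring L al by in_OL.
have theta d : d ^+ 2 = - (Ab * be' ^+ 2) -> (al + be * s0 + d) ^+ 2 = 2 * (mu * (al + d)).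
  move=> d2; transitivity (2 * (mu * (al + d)) + ((be * s0) ^+ 2 + d ^+ 2 - al ^+ 2)); first by ring.
  by rewrite (mu_b_sqr x y s02) d2 (mu_al_sqr I2 s1 st); ring.
have [T [c0 [OT nT Mc0 ec0]]] : exists T c0, [/\ int_ring L T, ~ P T, M c0 & (c0 * nu) ^+ 2 = vp * T].
  have alt d : M d -> int_ring L d -> d ^+ 2 = - (Ab * be' ^+ 2) -> ~ P (al + d) ->
      exists T c0, [/\ int_ring L T, ~ P T, M c0 & (c0 * nu) ^+ 2 = vp * T].
    move=> Md Od d2 nd; have Oad := int_ringD hL Oal Od.
    exists (2 * (al + d)), ((al + be * s0 + d) / mu); split.
    - by apply: (int_ringM hL) => //; exact: (int_ring_nat hL).
    - by move/Phalf => /(_ Oad).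
    - by in_field hM.
    - by rewrite exprMn expr_div_n (theta d d2) nu2; field; exact: mu0.
  have [Pmu|nmu] := EM (P mu); last first.
    exists mu, 1; split=> //; [by in_OL | exact: sf1 | by rewrite mul1r].
  have [Pp|np] := EM (P (al + g)); last exact: (alt g).
  apply: (alt (- g)); rewrite ?sqrrN //; [exact: sfN | exact: (int_ringN hL) | exact: gm].
have sgC2 : sg%:~R ^+ 2 = 1 :> algC by rewrite -rmorphXn /= sg2.
have [V [c2 [OV nV Mc2 ec2]]] : exists V c2, [/\ int_ring L V, ~ P V, M c2 & c2 ^+ 2 * vp = V].
  have [Pv|nv] := EM (P vp); last first.
    by exists vp, 1; split=> //; [in_OL | exact: sf1 | rewrite expr1n mul1r].
  have Pp : P p%:R by rewrite -vpp; apply: (primeMr hP) => //; in_OL.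
  exists (sg%:~R * rh), (s0 / vp); split.
  - by in_OL.
  - move=> h0; have Pq : P q%:R.
      rewrite -rhq (_ : rh = sg%:~R * (sg%:~R * rh)); last by rewrite mulrA -expr2 sgC2 mul1r.
      by apply: (primeMr hP); [in_OL | apply: (primeMl hP) => //; in_OL].
    have := Pdvd (m := p%:Z) pl Pl Pp; have := Pdvd (m := q%:Z) pl Pl Pq.
    rewrite !absz_nat !dvdn_prime2 // => /eqP -> /eqP qp.
    by move: npq; rewrite qp eqxx.
  - by in_field hM.
  - by rewrite expr_div_n s0vr; field; exact: vp0.
have e3 : (c0 * c2 * nu) ^+ 2 = V * T.
  by rewrite mulrAC exprMn ec0 -ec2; ring.
have [_ iVT] : int_ring L (V * T) by exact: (int_ringM hL).
apply: (loc_gen_odd_sqrt hL hP hM Mn2 _ (c := c0 * c2)) => //; rewrite ?e3 //.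
- by in_field hM.
- exact: (prime_notM hP).
Qed.
End OddPrime.

Section EvenPrime.
Hypothesis P2 : P 2.

Let P1I : P (1 + I).
Proof.
apply: (prime_sqr hP); first by in_OL.
rewrite (_ : (1 + I) ^+ 2 = 2 * I); first by apply: (primeMr hP) => //; in_OL.
by transitivity (1 + 2 * I + I ^+ 2); [ring | rewrite I2; ring].
Qed.

Lemma loc_gen_even_M z : loc_gen P k z -> loc_gen P M z.
Proof.
move=> lk; apply: (loc_gen_two_sqrt hL hP hE Er2 ML (c := 1)) => //; first exact: sf1.
  by rewrite mul1r r2; exact: quarter_Aint.
have D4 : (D %% 4 = 1)%N by move: D8; clear; lia.
by apply: (loc_gen_two_tower hL hP P2 hk kw EL ww D4 I2 _ lk (c1 := c1) (f := f)); rewrite -ec1.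
Qed.

(** [nu], or [I * nu], has a square congruent to [h ^ 2] modulo 4, with [h] a unit at [P]. *)
Lemma loc_gen_even_L z : loc_gen P M z -> loc_gen P L z.
Proof.
have e1 : (ep * nu) ^+ 2 = h ^+ 2 + 4 * eta by rewrite exprMn.
apply: (loc_gen_half hP hM Mn2 _ (c := ep) (h := h)) => //; rewrite ?e1.
- by case: ep2 => ->; [exact: sf1 | exact: MI].
- exact: EM_.
- rewrite (_ : _ / 4 = eta) //; by field.
have [kp ikp [Ekp eh]] := h1.
have Oh : int_ring L h by split=> //; exact: EL.
have Okp : int_ring L kp by split=> //; exact: EL.
have Leta : L eta.
  have -> : eta = ((ep * nu) ^+ 2 - h ^+ 2) / 4 by rewrite e1; field.
  have Lep : L ep by case: ep2 => ->; [exact: sf1 | exact: LI].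
  have Lnu : L nu by exact: (quad_gen _ hM).
  by case: Oh => Lh _; in_field hL.
move=> h2; have Ph : P h.
  apply: (prime_sqr hP) => //; rewrite (_ : h ^+ 2 = (h ^+ 2 + 4 * eta) - 2 * (2 * eta)); last by ring.
  apply: (primeB hL hP) => //; apply: (primeMr hP) => //.
  by apply: (int_ringM hL) => //; exact: (int_ring_nat hL).
apply: (prime1 hP); rewrite (_ : 1 = h - (1 + I) * kp); last by rewrite eh; ring.
by apply: (primeB hL hP) => //; apply: (primeMr hP).
Qed.
End EvenPrime.

Lemma mu_field_unramified : ramification_index k L P 1.
Proof.
have [z [Pz Oz z0 lgk]] := base_loc_gen pp pq npq D8 ww hL kL hP.
apply: (loc_gen_unramified hL hP hk kL Pz Oz z0).
have [l pl Pl] := prime_above hL hP.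
have [l2|nl2] := eqVneq l 2%N.
  rewrite l2 in Pl.
  by apply: (loc_gen_even_L Pl); exact: (loc_gen_even_M Pl).
have ol : odd l by case: (even_prime pl) => // h0; rewrite h0 in nl2.
apply: (loc_gen_odd_L pl ol Pl); apply: (loc_gen_odd_M pl ol Pl).
by apply: (loc_gen_odd_E pl ol Pl); exact: (loc_gen_odd_F pl ol Pl).
Qed.
End Unramified.

(** * The ramified prime above 2 *)

Lemma half_notin_Aint : (2^-1 : algC) \notin Aint.
Proof.
apply/negP => h; have Qh : (2^-1 : algC) \in Crat by rewrite rpredV rpred_nat.
have [m em] := Crat_Aint_int Qh h.
have : (2 * m)%:~R = 1%:~R :> algC by rewrite rmorphM /= -em; apply: divff; rewrite pnatr_eq0.
by move/intr_inj; clear; lia.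
Qed.

(** Zorn's lemma for the ideals that contain 2 but not 1; the empty set is admitted to deal
    with the empty chain. *)
Lemma maximal_above_two L : subfield_set L -> exists P, [/\ nz_prime_ideal (int_ring L) P, P 2
  & forall s, int_ring L s -> ~ P s -> exists m r, [/\ P m, int_ring L r & 1 = m + s * r]].
Proof.
move=> hL; pose O := int_ring L; have O2 : O 2 := int_ring_nat hL 2.
have O1 : O 1 := int_ring1 hL.
have O0 : O 0 := int_ring_int hL 0.
pose good (X : set algC) := [/\ is_ideal O X, X 2 & ~ X 1].
have [|A [[A0|gA] maxA]] := @Zorn_bigcup algC (fun X => X = set0 \/ good X).
- move=> F FP tot; have [[X FX gX]|nF] := EM (exists2 X, F X & good X); last first.
    left; rewrite -subset0 => z [X FX Xz]; case: (FP _ FX) => [X0|gX]; first by rewrite X0 in Xz.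
    by case: nF; exists X.
  right; have gF Y z : F Y -> Y z -> good Y.
    by move=> FY Yz; case: (FP _ FY) => // Y0; rewrite Y0 in Yz.
  case: gX => [[_ X0 _ _] X2 _].
  split; [split| by exists X |].
  + by move=> z [Y FY Yz]; case: (gF _ _ FY Yz) => -[h _ _ _] _ _; exact: h.
  + by exists X.
  + move=> u v [Y FY Yu] [Z FZ Zv]; case: (tot _ _ FY FZ) => h.
      by exists Z => //; case: (gF _ _ FZ Zv) => -[_ _ ad _] _ _; apply: ad => //; exact: h.
    by exists Y => //; case: (gF _ _ FY Yu) => -[_ _ ad _] _ _; apply: ad => //; exact: h.
  + move=> r u Or [Y FY Yu]; exists Y => //; case: (gF _ _ FY Yu) => -[_ _ _ mu_] _ _.
    exact: mu_.
  + by move=> [Y FY Y1]; case: (gF _ _ FY Y1).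
- case: (maxA [set 2 * u | u in O]).
    rewrite A0 properEneq; split; last exact: sub0set.
    by apply/eqP => h; have : set0 (2 * 1 : algC) by rewrite h; exists 1.
  right; split; [split| by exists 1; rewrite ?mulr1 |].
  + by move=> _ [u Ou <-]; exact: int_ringM.
  + by exists 0; rewrite ?mulr0.
  + by move=> _ _ [u Ou <-] [v Ov <-]; exists (u + v); [exact: int_ringD | rewrite mulrDr].
  + by move=> r _ Or [u Ou <-]; exists (r * u); [exact: int_ringM | rewrite mulrCA].
  + move=> [u [_ iu] eu]; have := half_notin_Aint; rewrite (_ : 2^-1 = u) ?iu //.
    have t0 : 2 != 0 :> algC by rewrite pnatr_eq0.
    by apply: (mulfI t0); rewrite eu divff.
have [[AO A0 AD AM] A2 A1] := gA.
have mx s : O s -> ~ A s -> exists m r, [/\ A m, O r & 1 = m + s * r].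
  move=> Os ns; apply: contrapT => nex.
  pose B := [set z | exists m r, [/\ A m, O r & z = m + s * r]].
  have AB z : A z -> B z by move=> Az; exists z, 0; rewrite mulr0 addr0.
  have Bs : B s by exists 0, 1; rewrite add0r mulr1.
  apply: (maxA B).
    by rewrite properEneq; split=> //; apply/eqP => h; apply: ns; rewrite h.
  right; split; [split| exact: AB | by move=> [m [r h]]; apply: nex; exists m, r].
  - by move=> _ [m [r [Am Or ->]]]; apply: (int_ringD hL); [exact: AO | exact: int_ringM].
  - exact: AB.
  - move=> _ _ [m [r [Am Or ->]]] [m' [r' [Am' Or' ->]]]; exists (m + m'), (r + r').
    by split; [exact: AD | exact: int_ringD | ring].
  - move=> c _ Oc [m [r [Am Or ->]]]; exists (c * m), (c * r).
    by split; [exact: AM | exact: int_ringM | ring].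
exists A; split=> //; split=> //.
  by split=> //; exists 2; rewrite // pnatr_eq0.
move=> u v Ou Ov Auv; have [Au|nu] := EM (A u); [by left | right].
have [m [r [Am Or e1]]] := mx u Ou nu.
have -> : v = v * m + r * (u * v) by rewrite -[LHS]mulr1 e1; ring.
by apply: AD; exact: AM.
Qed.

Section QuadConjUniq.
Variables (E : set algC) (a : algC).
Hypotheses (hE : subfield_set E) (nEa : ~ E a).

Lemma quad_conj_uniq y y1 y2 : quad_conj E a y y1 -> quad_conj E a y y2 -> y1 = y2.
Proof.
move=> [u [v [Eu Ev -> ->]]] [c [d [Ec Ed e ->]]].
have e1 : (v - d) * a = c - u.
  by apply/eqP; rewrite -subr_eq0; apply/eqP; move/eqP: e; rewrite -subr_eq0 => /eqP <-; ring.
have [vd|vd] := eqVneq (v - d) 0.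
  move/eqP: vd; rewrite subr_eq0 => /eqP vd.
  by move: e1; rewrite vd subrr mul0r => /esym/eqP; rewrite subr_eq0 => /eqP ->.
case: nEa; rewrite -(mulKf vd a) e1; apply: (sfM hE); first by apply: (sfV hE); exact: sfB.
exact: sfB.
Qed.

Lemma quad_conjD y y' t t' : quad_conj E a y y' -> quad_conj E a t t' ->
  quad_conj E a (y + t) (y' + t').
Proof.
move=> [u [v [Eu Ev -> ->]]] [c [d [Ec Ed -> ->]]].
by exists (u + c), (v + d); split; [exact: sfD | exact: sfD | ring | ring].
Qed.

Lemma quad_conj_base u : E u -> quad_conj E a u u.
Proof. by move=> Eu; exists u, 0; split=> //; [exact: sf0 | ring | ring]. Qed.
End QuadConjUniq.

(** At a prime above 2, [E (nu)] is obtained by the Eisenstein polynomial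
    [X ^ 2 + (3 - I) * h * X + (1 - I) * h ^ 2 + 2 * I * z]. *)
Section Eisenstein.
Variables (E : set algC) (nu I ep h z kp : algC) (P : set algC).
Local Notation K := (quad E nu).
Hypotheses (hE : subfield_set E) (Enu : E (nu ^+ 2)) (I2 : I ^+ 2 = -1).
Hypotheses (EI : E I) (Eep : E ep) (iep : ep \in Aint) (ep0 : ep != 0).
Hypotheses (Eh : E h) (ih : h \in Aint) (Ez : E z) (iz : z \in Aint)
  (Ekp : E kp) (ikp : kp \in Aint) (eh : h = 1 + (1 + I) * kp).
Hypothesis nu2 : (ep * nu) ^+ 2 = (1 + 2 * I) * h ^+ 2 + 4 * z.
Hypotheses (hP : nz_prime_ideal (int_ring K) P) (P2 : P 2).

Local Notation lam := (1 - I).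
Local Notation OE := (int_ring E).
Local Notation OK := (int_ring K).
(** The root of the Eisenstein polynomial: [ep * nu = (1 + I) * eisen_root + (2 + I) * h]. *)
Definition eisen_root : algC := (ep * nu - (2 + I) * h) / (1 + I).
Local Notation Pi := eisen_root.
Let Pi' : algC := (- (ep * nu) - (2 + I) * h) / (1 + I).

Let hK : subfield_set K := quad_subfield hE Enu.
Let EK : E `<=` K := @quad_base E nu hE.
Let OEK : OE `<=` OK := int_ring_sub EK.
Let Knu : K nu. Proof. exact: (quad_gen _ hE). Qed.
Let KI : K I. Proof. exact: EK. Qed.
Let Kep : K ep. Proof. exact: EK. Qed.
Let Kh : K h. Proof. exact: EK. Qed.
Let Kz : K z. Proof. exact: EK. Qed.
Let Kkp : K kp. Proof. exact: EK. Qed.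
Let iI : I \in Aint. Proof. by apply: Aint_sqrt; rewrite I2 rpredN rpred1. Qed.
Let I1 : 1 + I != 0.
Proof.
have e : (1 + I) ^+ 2 = 2 * I by transitivity (1 + 2 * I + I ^+ 2); [ring | rewrite I2; ring].
have I0 : I != 0 by rewrite -sqrf_eq0 I2 oppr_eq0 oner_eq0.
by rewrite -sqrf_eq0 e mulf_neq0 ?pnatr_eq0.
Qed.
Let lamI : lam = - I * (1 + I).
Proof. by transitivity (- I - I ^+ 2); [rewrite I2; ring | ring]. Qed.
Let lam2 : lam ^+ 2 = - 2 * I.
Proof. by transitivity (1 - 2 * I + I ^+ 2); [ring | rewrite I2; ring]. Qed.
Let Itwo : 2 = I * lam ^+ 2 :> algC.
Proof. by rewrite lam2; transitivity (- 2 * I ^+ 2); [rewrite I2; ring | ring]. Qed.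
Let lam0 : lam != 0.
Proof. by rewrite -sqrf_eq0; apply: contraTneq isT => h0; move: Itwo; rewrite h0 mulr0 => /eqP; rewrite pnatr_eq0. Qed.

Let T : algC := - lam * (2 + I) * h.
Let u0 : algC := h ^+ 2 - lam * z.
Let EisP : Pi + Pi' = T.
Proof.
rewrite /eisen_root /Pi' /T lamI.
transitivity (- ((2 + I) * h) * 2 / (1 + I)); first by field; exact: I1.
have -> : 2 = (1 + I) * (1 - I) :> algC.
  by transitivity (1 - I ^+ 2); [rewrite I2; ring | ring].
rewrite -lamI; field; exact: I1.
Qed.
Let EisN : Pi * Pi' = lam * u0.
Proof.
have I12 : (1 + I) ^+ 2 = 2 * I by transitivity (1 + 2 * I + I ^+ 2); [ring | rewrite I2; ring].
have I0 : I != 0 by rewrite -sqrf_eq0 I2 oppr_eq0 oner_eq0.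
rewrite /eisen_root /Pi' /u0.
transitivity (- ((ep * nu) ^+ 2 - (2 + I) ^+ 2 * h ^+ 2) / (1 + I) ^+ 2); first by field; exact: I1.
have n0 : (1 + I) ^+ 2 != 0 by rewrite sqrf_eq0.
apply: (mulIf n0); rewrite divfK // nu2 I12.
transitivity ((3 + 2 * I + I ^+ 2) * h ^+ 2 - 4 * z); first by ring.
transitivity ((2 * I - 2 * I ^+ 2) * h ^+ 2 - lam ^+ 2 * (2 * I) * z); last by ring.
by rewrite lam2; transitivity ((2 * I - 2 * I ^+ 2) * h ^+ 2 + 4 * I ^+ 2 * z); [rewrite I2; ring | ring].
Qed.
Let PiN : Pi ^+ 2 = - (lam * (u0 + (2 + I) * h * Pi)).
Proof.
have e : Pi ^+ 2 = T * Pi - lam * u0 by rewrite -EisN -EisP; ring.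
by rewrite e /T; ring.
Qed.
Let iu0 : OE u0. Proof. by split; [rewrite /u0; in_field hE | rewrite /u0; in_Aint]. Qed.
Let iT : OE T. Proof. by split; [rewrite /T; in_field hE | rewrite /T; in_Aint]. Qed.
Let Olam : OE lam. Proof. by split; [in_field hE | in_Aint]. Qed.
Let OPi : OK Pi.
Proof.
split; first by rewrite /eisen_root; in_field hK.
apply: (Aint_quadratic (t := T) (n := lam * u0)); [by case: iT | by case: (int_ringM hE Olam iu0) |].
by rewrite -EisN -EisP; ring.
Qed.
Let Oh : OE h. Proof. by []. Qed.
Let Plam : P lam.
Proof.
apply: (prime_sqr hP); first exact: OEK.
by rewrite lam2 mulNr; apply: (primeN hK hP); apply: (primeMr hP) => //; split.
Qed.
Let nh : ~ P h.
Proof.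
move=> Ph; apply: (prime1 hP); rewrite (_ : 1 = h - (1 + I) * kp); last by rewrite eh; ring.
apply: (primeB hK hP) => //; apply: (primeMr hP); first by split.
have -> : 1 + I = I * lam by transitivity (I - I ^+ 2); [rewrite I2; ring | ring].
by apply: (primeMl hP) => //; split.
Qed.
Let nu0P : ~ P u0.
Proof.
move=> h0; apply: nh; apply: (prime_sqr hP); first by split.
have -> : h ^+ 2 = u0 + z * lam by rewrite /u0; ring.
by apply: (primeD hP) => //; apply: (primeMl hP) => //; split.
Qed.
Let PPi : P Pi.
Proof.
apply: (prime_sqr hP) => //; rewrite PiN; apply: (primeN hK hP); apply: (primeMr hP) => //.
split; [by rewrite /u0 /eisen_root; in_field hK | ].
have [_ iPi] := OPi; have [_ i0] := iu0; by in_Aint.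
Qed.
Let u1 : algC := u0 + (2 + I) * h * Pi.
Let Ou1 : OK u1.
Proof.
apply: (int_ringD hK); first exact: OEK.
by apply: (int_ringM hK) => //; split; [in_field hK | in_Aint].
Qed.
Let nu1 : ~ P u1.
Proof.
move=> h0; apply: nu0P; rewrite (_ : u0 = u1 - (2 + I) * h * Pi); last by rewrite /u1; ring.
by apply: (primeB hK hP) => //; apply: (primeMl hP) => //; split; [in_field hK | in_Aint].
Qed.
Let Pi0 : Pi != 0.
Proof.
apply: contra_not_neq nu1 => h0; move/eqP: PiN.
rewrite -/u1 h0 expr0n /= eq_sym oppr_eq0 mulf_eq0 (negbTE lam0) /= => /eqP ->; exact: (prime0 hP).
Qed.
Let cPi : quad_conj E nu Pi Pi'.
Proof.
exists (- ((2 + I) * h) / (1 + I)), (ep / (1 + I)); split; try by in_field hE.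
- by rewrite /eisen_root; field; exact: I1.
- by rewrite /Pi'; field; exact: I1.
Qed.

Variable lgE : loc_gen P E lam.

(** [y] lies in the localization of [OE + OE * Pi]. *)
Let split_loc (y : algC) := exists r a b, [/\ OE r, ~ P r, OE a, OE b & r * y = a + b * Pi].

(** If [lam] divides [a + b * Pi], then the norm shows that [lam] divides [a] and [b]. *)
Let descent y : ~ E nu -> OK y -> split_loc (lam * y) -> split_loc y.
Proof.
move=> nE Oy [r [a [b [Or nr Oa Ob e1]]]].
have [y' cy] := quad_conj_ex (proj1 Oy).
have iy' := quad_conj_int hE Enu nE cy (proj2 Oy).
have cB c : OE c -> quad_conj E nu c c by move=> [Ec _]; exact: quad_conj_base.
have e2 : r * (lam * y') = a + b * Pi'.
  apply: (quad_conj_uniq hE nE (y := a + b * Pi)).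
    rewrite -e1; apply: (quad_conjM hE Enu); first exact: cB.
    by apply: (quad_conjM hE Enu); [exact: cB | exact: cy].
  by apply: (quad_conjD hE); [exact: cB | apply: (quad_conjM hE Enu); [exact: cB | exact: cPi]].
have EN : E (y * y').
  by move: cy => [u [v [Eu Ev -> ->]]]; rewrite (_ : _ * _ = u ^+ 2 - v ^+ 2 * nu ^+ 2); [in_field hE | ring].
have OY : OE (r ^+ 2 * (y * y')).
  by case: Or Oy => Er ir [_ iy]; split; [in_field hE | in_Aint].
set Y := r ^+ 2 * (y * y') in OY.
have e3 : a ^+ 2 + a * b * T + b ^+ 2 * (lam * u0) = lam ^+ 2 * Y.
  rewrite -EisN -EisP.
  transitivity ((a + b * Pi) * (a + b * Pi')); first by ring.
  by rewrite -e1 -e2 /Y; ring.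
have PMl c : OE c -> P (lam * c) by move=> Oc; apply: (primeMr hP) => //; exact: OEK.
have Oc2 : OE ((2 + I) * h) by split; [in_field hE | in_Aint].
have Pa : P a.
  apply: (prime_sqr hP); first exact: OEK.
  have -> : a ^+ 2 = lam * (lam * Y + a * b * ((2 + I) * h) - b ^+ 2 * u0).
    transitivity (lam ^+ 2 * Y - a * b * T - b ^+ 2 * (lam * u0)); last by rewrite /T; ring.
    by rewrite -e3; ring.
  by apply: PMl; apply: (int_ringB hE); [apply: (int_ringD hE); apply: (int_ringM hE) => //; exact: (int_ringM hE) | apply: (int_ringM hE) => //; exact: (int_ringX hE)].
have [s [a1 [Os ns Oa1 ea]]] := lgE Pa Oa.
have Pb : P b.
  apply: (prime_sqr hP); first exact: OEK.
  have Osu : OE (s ^+ 2 * u0) by apply: (int_ringM hE) => //; exact: (int_ringX hE).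
  have nsu : ~ P (s ^+ 2 * u0).
    apply: (prime_notM hP) => //; [by apply: OEK; exact: (int_ringX hE) | exact: OEK |].
    by move=> h0; apply: ns; apply: (prime_sqr hP) => //; exact: OEK.
  have h0 : P (s ^+ 2 * u0 * b ^+ 2).
    have -> : s ^+ 2 * u0 * b ^+ 2 = lam * (s ^+ 2 * Y - a1 ^+ 2 + s * b * a1 * ((2 + I) * h)).
      apply: (mulfI lam0).
      transitivity (s ^+ 2 * (lam ^+ 2 * Y) - (s * a) ^+ 2 - s * b * (s * a) * T).
        by rewrite -e3; ring.
      by rewrite ea /T; ring.
    apply: PMl; apply: (int_ringD hE); first by apply: (int_ringB hE); [apply: (int_ringM hE) => //; exact: (int_ringX hE) | exact: (int_ringX hE)].
    by apply: (int_ringM hE) => //; apply: (int_ringM hE) => //; exact: (int_ringM hE).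
  case: hP => _ _ /(_ _ _ (OEK Osu) (OEK (int_ringX hE 2 Ob)) h0) [] //.
have [t [b1 [Ot nt Ob1 eb]]] := lgE Pb Ob.
exists (s * t * r), (t * a1), (s * b1); split; try (by do ?apply: (int_ringM hE)).
  by apply: (prime_notM hP); [apply: OEK; exact: (int_ringM hE) | exact: OEK | apply: (prime_notM hP) => //; exact: OEK |].
apply: (mulfI lam0).
transitivity (s * t * (r * (lam * y))); first by ring.
rewrite e1; transitivity (t * (s * a) + s * (t * b) * Pi); first by ring.
by rewrite ea eb; ring.
Qed.

(** The discriminant of [Pi] is [lam ^ 2] times a unit, which two descents remove. *)
Let split_all y : OK y -> split_loc y.
Proof.
move=> Oy; have [Ea|nE] := EM (E nu).
  exists 1, y, 0; split; [exact: int_ring1 | exact: (prime1 hP) | | exact: (int_ring_int hE 0) | by ring].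
  by move: Oy; rewrite (quad_idle hE Ea).
have [y' cy] := quad_conj_ex (proj1 Oy).
have iy' := quad_conj_int hE Enu nE cy (proj2 Oy).
have iPi' := quad_conj_int hE Enu nE cPi (proj2 OPi).
have [_ iy] := Oy; have [_ iPi] := OPi.
pose de := Pi - Pi'.
have de2 : de ^+ 2 = lam ^+ 2 * (ep * nu) ^+ 2.
  have -> : de = 2 * (ep * nu) / (1 + I) by rewrite /de /eisen_root /Pi'; field; exact: I1.
  have -> : 2 = (1 + I) * lam by transitivity (1 - I ^+ 2); [rewrite I2; ring | ring].
  by field; exact: I1.
pose b0 := (y - y') * de; pose a0 := de * (y' * Pi - y * Pi').
have Ob0 : OE b0.
  split; last by rewrite /b0 /de; in_Aint.
  move: cy cPi; rewrite /b0 /de => -[u [v [Eu Ev -> ->]]] [c [d [Ec Ed -> ->]]].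
  by rewrite (_ : _ * _ = 4 * v * d * nu ^+ 2); [in_field hE | ring].
have Oa0 : OE a0.
  split; last by rewrite /a0 /de; in_Aint.
  move: cy cPi; rewrite /a0 /de => -[u [v [Eu Ev -> ->]]] [c [d [Ec Ed -> ->]]].
  by rewrite (_ : _ * _ = 4 * d * nu ^+ 2 * (u * d - v * c)); [in_field hE | ring].
have On2 : OE ((ep * nu) ^+ 2) by rewrite nu2; split; [in_field hE | in_Aint].
apply: descent => //; apply: descent => //; first by apply: (int_ringM hK) => //; exact: OEK.
exists ((ep * nu) ^+ 2), a0, b0; split=> //; last first.
  transitivity (de ^+ 2 * y); first by rewrite de2; ring.
  by rewrite /a0 /b0 /de; ring.
rewrite nu2 => h0; apply: nh; apply: (prime_sqr hP); first by split.
have -> : h ^+ 2 = ((1 + 2 * I) * h ^+ 2 + 4 * z) - 2 * (I * h ^+ 2 + 2 * z) by ring.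
apply: (primeB hK hP) => //; apply: (primeMr hP) => //.
by split; [in_field hK | in_Aint].
Qed.

(** [lam] is a unit times [Pi ^ 2], so that [Pi] divides both terms of [a + b * Pi]. *)
Lemma eisen_loc_gen : loc_gen P K Pi.
Proof.
move=> y Py Oy; have [r [a [b [Or nr Oa Ob e1]]]] := split_all Oy.
have Pa : P a.
  rewrite (_ : a = r * y - b * Pi); last by rewrite e1; ring.
  apply: (primeB hK hP); [apply: (primeMl hP) => // | apply: (primeMl hP) => //]; exact: OEK.
have [s [a1 [Os ns Oa1 ea]]] := lgE Pa Oa.
exists (u1 * s * r), (- Pi * a1 + u1 * s * b).
have [Os' Or' Oa1' Ob'] : [/\ OK s, OK r, OK a1 & OK b] by split; exact: OEK.
split.
- by do ?apply: (int_ringM hK).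
- by apply: (prime_notM hP) => //; [exact: int_ringM | exact: (prime_notM hP)].
- apply: (int_ringD hK); last by do ?apply: (int_ringM hK).
  by apply: (int_ringM hK) => //; exact: int_ringN.
- transitivity (u1 * (s * a) + u1 * s * b * Pi); first by rewrite -!mulrA e1; ring.
  by rewrite ea; transitivity (- Pi ^+ 2 * a1 + u1 * s * b * Pi); [rewrite PiN -/u1; ring | ring].
Qed.

Hypothesis maxP : forall s, OK s -> ~ P s -> exists m r, [/\ P m, OK r & 1 = m + s * r].

(** [2] is, up to a unit at [P], the fourth power of the uniformizer, and every element of
    [P] in [E] is divisible by its square. *)
Lemma eisen_ramified k : k `<=` E -> subfield_set k ->
  exists2 n, ramification_index k K P n & (1 < n)%N.
Proof.
move=> kE hk; pose pO := ideal_prod (P `&` int_ring k) OK.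
have ex0 n : ideal_exp OK P n 0.
  case: n => [|n]; first exact: (int_ring_int hK 0).
  by exists [::]; rewrite ?big_nil.
have exD n u v : ideal_exp OK P n u -> ideal_exp OK P n v -> ideal_exp OK P n (u + v).
  by case: n => [|n]; [exact: int_ringD | exact: ideal_prodD].
have sub2 : pO `<=` ideal_exp OK P 2.
  apply: ideal_prod_min; [exact: ex0 | exact: exD |].
  move=> u v [Pu [ku iu]] Ov; have Ou : OE u by split=> //; exact: kE.
  have [s [a1 [Os ns Oa1 ea]]] := lgE Pu Ou.
  have Os' : OK s := OEK Os.
  have [m [r [Pm Or e1]]] := maxP (int_ringM hK Ou1 Os') (prime_notM hP Ou1 Os' nu1 ns).
  have -> : u * v = m * (u * v) + Pi * (Pi * (- (r * a1 * v))).
    transitivity ((m + u1 * s * r) * (u * v)); first by rewrite -e1 mul1r.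
    transitivity (m * (u * v) + (u1 * (s * u)) * (r * v)); first by ring.
    by rewrite ea; congr (_ + _); transitivity (- Pi ^+ 2 * (a1 * (r * v))); [rewrite PiN -/u1; ring | ring].
  apply: exD; apply: ideal_prod_mul => //; apply: ideal_prod_mul => //.
  apply: (int_ringN hK); apply: (int_ringM hK) => //; apply: (int_ringM hK) => //; exact: OEK.
have exv n y : ideal_exp OK P n y -> loc_dvd P OK (Pi ^+ n) y.
  elim: n y => [|n IH] y.
    by move=> Oy; exists 1, y; split=> //; [exact: int_ring1 | exact: (prime1 hP)].
  move: y; apply: ideal_prod_min; [exact: (loc_dvd0 hP hK)| by move=> u v; exact: (loc_dvdD hP hK)|].
  move=> u v Pu /IH dv; rewrite exprS; apply: (loc_dvdM hP hK) => //.
  by apply: eisen_loc_gen => //; exact: (prime_int hP).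
have n5 : ~ (pO `<=` ideal_exp OK P 5).
  move=> h5; have /h5/exv [S [Y [OS nS OY e1]]] : pO 2.
    rewrite -[2]mulr1; apply: ideal_prod_mul; last exact: int_ring1.
    by split=> //; exact: (int_ring_nat hk).
  have e2 : u1 ^+ 2 * 2 = I * Pi ^+ 4.
    by rewrite {1}Itwo (_ : 4 = 2 * 2)%N // exprM PiN -/u1; ring.
  have e3 : S * I = u1 ^+ 2 * Y * Pi.
    have Pi4 : Pi ^+ 4 != 0 by rewrite expf_neq0.
    apply: (mulIf Pi4); transitivity (u1 ^+ 2 * (S * 2)); last by rewrite e1; ring.
    by transitivity (S * (u1 ^+ 2 * 2)); [rewrite e2; ring | ring].
  apply: nS; rewrite (_ : S = - I * (u1 ^+ 2 * Y * Pi)).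
    apply: (primeMl hP); first by split; [in_field hK | in_Aint].
    by apply: (primeMl hP) => //; apply: (int_ringM hK) => //; exact: int_ringX.
  by rewrite -e3; transitivity (- I ^+ 2 * S); [rewrite I2; ring | ring].
have [h3|n3] := EM (pO `<=` ideal_exp OK P 3); last by exists 2%N.
have [h4|n4] := EM (pO `<=` ideal_exp OK P 4); last by exists 3%N.
by exists 4%N.
Qed.
End Eisenstein.

(** * Assembling the extensions *)

(** The parity of [t] follows from the conic, and [ep] is determined by the odd numbers [va],
    [x] and the parity of [y]. *)
Lemma mu_congruence (I s0 : algC) (va vb e f x y t s c1 m' : int) :
  let om := (s0 - 1) / 2 in let h := 1 + (1 + I) * (om + (c1%:~R - f%:~R * I)) in
  I ^+ 2 = -1 -> s0 ^+ 2 = e%:~R + 4 * f%:~R * I -> e = 1 - 4 * c1 ->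
  odd `|c1 + f| -> odd `|x| -> s = 1 \/ s = -1 ->
  s * t ^+ 2 = f * (x ^+ 2 - 4 * y ^+ 2) + e * x * y ->
  odd `|va| -> vb = 2 * m' -> odd `|m'| ->
  exists ep n0 n1 n2 n3 : int, (ep = 1 \/ ep = -1) /\
    (va%:~R + vb%:~R * I) * (2 * t%:~R * (1 + s%:~R * I) + (x%:~R + 2 * y%:~R * I) * s0) =
    ep%:~R * h ^+ 2 + 4 * ((n0%:~R + n1%:~R * I) + (n2%:~R + n3%:~R * I) * om).
Proof.
move=> om h I2 s02 ec1 ocf ox s1 st ova evb om'.
have oddE (z : int) : odd `|z| -> exists u, z = 1 + 2 * u.
  by move=> oz; exists ((z - 1) %/ 2)%Z; move: oz; clear; lia.
have [k ek] := oddE _ ocf; have [x1 ex] := oddE _ ox; have [v1 ev] := oddE _ ova.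
have [v2 ev2] := oddE _ om'.
have [ss es] : exists ss, s = 1 + 2 * ss by case: s1 => ->; [exists 0 | exists (-1)].
have [E [m [hE em]]] : exists E m : int, (E = 0 \/ E = 1) /\ v1 = 1 + x1 + y + E + 2 * m.
  exists ((v1 - 1 - x1 - y) %% 2)%Z, ((v1 - 1 - x1 - y) %/ 2)%Z; clear; split; lia.
have [T eT] : exists T, t ^+ 2 - t = 2 * T.
  have : (t %% 2 = 0 \/ t %% 2 = 1)%Z by clear; lia.
  pose u := (t %/ 2)%Z; have : t = 2 * u + (t %% 2)%Z by rewrite /u; clear; lia.
  move=> + [] h0; rewrite h0 => ->; [exists (2 * u ^+ 2 - u) | exists (2 * u ^+ 2 + u)]; ring.
pose t1 := - T - ss * t ^+ 2 + f * (2 * x1 + 2 * x1 ^+ 2 - 2 * y ^+ 2) + y * (x1 - 2 * c1 - 4 * c1 * x1).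
have et : t = f + y + 2 * t1.
  transitivity (t ^+ 2 - 2 * T); first by rewrite -eT; ring.
  transitivity (s * t ^+ 2 - 2 * ss * t ^+ 2 - 2 * T); first by rewrite es; ring.
  by rewrite st /t1 ex ec1; ring.
pose c2 := k - f.
have ec : c1 = 1 + f + 2 * c2 by rewrite /c2; move: ek; clear; lia.
clearbody t1 c2.
have om2 : om ^+ 2 = - om - (c1%:~R - f%:~R * I).
  rewrite /om expr_div_n; have -> : (s0 - 1) ^+ 2 = s0 ^+ 2 - 2 * s0 + 1 by ring.
  by rewrite s02 ec1 rmorphB rmorphM rmorph1 /=; field.
have es0 : s0 = 1 + 2 * om by rewrite /om; field.
exists (1 - 2 * E), (mod4_quot0 x1 y f t1 c2 m v2 ss E), (mod4_quot1 x1 y f t1 c2 m v2 ss E).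
exists (mod4_quot2 x1 y f t1 c2 m v2 ss E), (mod4_quot3 x1 y f t1 c2 m v2 ss E).
split; first by case: hE => ->; [left | right].
have := gauss_mod4 I2 x1 y t1 m v2 ss E (f := f) (c2 := c2) (om := om).
rewrite -ec -et -es -ex -em -ev => /(_ om2).
have evb2 : vb = 2 + 4 * v2 by rewrite evb ev2; ring.
by rewrite -es0 /h evb2 => <-.
Qed.

Lemma rational_sqr_int (z : algC) (n : int) : z \in Crat -> z ^+ 2 = n%:~R -> exists m : int, n = m ^+ 2.
Proof.
move=> Qz e; have iz : z \in Aint by apply: Aint_sqrt; rewrite e rpred_int.
have [m em] := Crat_Aint_int Qz iz; exists m.
by apply: (@intr_inj algC); rewrite -e em rmorphXn.
Qed.

(** A rational square root in a quadratic extension has no mixed term. *)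
Lemma quad_sqrt_mem E x y : subfield_set E -> E (x ^+ 2) -> E (y ^+ 2) -> quad E x y ->
  E y \/ E (x * y).
Proof.
move=> hE Ex Ey [u [v [Eu Ev ey]]].
have [v0|v0] := eqVneq v 0; first by left; rewrite ey v0 mul0r addr0.
have [u0|u0] := eqVneq u 0.
  by right; rewrite ey u0 (_ : _ * _ = v * x ^+ 2); [exact: sfM | ring].
have E2 : E 2 := sf_nat hE 2.
left; rewrite (_ : y = u + v * ((y ^+ 2 - u ^+ 2 - v ^+ 2 * x ^+ 2) / (2 * u * v))).
  by in_field hE.
by rewrite ey; field; rewrite u0 v0.
Qed.

Section Irrational.
Variables (p q : nat) (w I r : algC).
Hypotheses (pp : prime p) (pq : prime q) (npq : p != q).
Hypotheses (ww : w ^+ 2 = - (p * q)%:R) (I2 : I ^+ 2 = -1) (r2 : r ^+ 2 = p%:R).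
Local Notation k := (quad ratC w).

Let nonsquare (n l : nat) (z : algC) : logn l n = 1%N -> z \in Crat -> z ^+ 2 = n%:R -> False.
Proof.
move=> l1 Qz e; have [m em] := rational_sqr_int Qz (n := n%:Z) e.
have : n = (`|m| ^ 2)%N by rewrite -abszX -em.
by move=> en; move: l1; rewrite en lognX; clear; lia.
Qed.
Let negative (n : nat) (z : algC) : (0 < n)%N -> z \in Crat -> z ^+ 2 = - n%:R -> False.
Proof.
move=> n0 Qz e; have [m em] : exists m : int, - n%:Z = m ^+ 2.
  by apply: (rational_sqr_int Qz); rewrite e rmorphN.
by have := sqr_ge0 m; rewrite -em; move: n0; clear; lia.
Qed.
Let p0 := prime_gt0 pp.
Let q0 := prime_gt0 pq.
Let hk : subfield_set k.
Proof. by apply: quad_subfield; [exact: ratC_subfield | rewrite ww /ratC /= rpredN rpred_nat]. Qed.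
Let k2 n (z : algC) : z ^+ 2 = n%:~R -> k z -> z \in Crat \/ w * z \in Crat.
Proof.
move=> e kz; apply: (quad_sqrt_mem ratC_subfield) => //.
  by rewrite ww /ratC /= rpredN rpred_nat.
by rewrite e /ratC /= rpred_int.
Qed.
Let lp : logn p p = 1%N. Proof. by rewrite logn_prime // eqxx. Qed.
Let lpq : logn p (p * q) = 1%N.
Proof. by rewrite lognM // lp logn_prime // (negbTE npq). Qed.

Lemma I_notin_k : ~ k I.
Proof.
move=> /(@k2 (-1)) [|h|h]; first by rewrite I2.
  by apply: (negative (n := 1) _ h).
by apply: (nonsquare lpq h); rewrite exprMn ww I2; ring.
Qed.

Let Ir_notin : ~ k (I * r).
Proof.
have e : (I * r) ^+ 2 = - p%:R by rewrite exprMn I2 r2; ring.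
move=> /(@k2 (- p%:Z)) [|h|h]; first by rewrite e rmorphN.
  exact: (negative p0 h).
have pC : p%:R != 0 :> algC by rewrite pnatr_eq0 -lt0n.
have Q : w * (I * r) / p%:R \in Crat by rewrite rpred_div // rpred_nat.
have lq : logn q q = 1%N by rewrite logn_prime // eqxx.
apply: (nonsquare lq Q); rewrite expr_div_n exprMn e ww natrM; field; exact: pC.
Qed.

Lemma r_notin_kI : ~ quad k I r.
Proof.
move=> /(quad_sqrt_mem hk) [||h|h //]; rewrite ?I2 ?r2; [by in_field hk | by in_field hk|].
case: (@k2 p%:Z r r2 h) => h0; first exact: (nonsquare lp h0 r2).
have n0 : (0 < p * q * p)%N by rewrite !muln_gt0 p0 q0.
by apply: (negative n0 h0); rewrite exprMn ww r2 natrM; ring.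
Qed.

Lemma I_notin_kr : ~ quad k r I.
Proof.
move=> /(quad_sqrt_mem hk) [||h|h]; rewrite ?I2 ?r2; [by in_field hk | by in_field hk| exact: I_notin_k |].
by apply: Ir_notin; rewrite mulrC.
Qed.
End Irrational.

Lemma gauss_int_inj (x y x' y' : int) :
  x%:~R + y%:~R * 'i = x'%:~R + y'%:~R * 'i :> algC -> x = x' /\ y = y'.
Proof.
move=> e; have e1 : (x - x')%:~R = (y' - y)%:~R * 'i :> algC.
  apply/eqP; rewrite -subr_eq0; apply/eqP; move/eqP: e; rewrite -subr_eq0 => /eqP <-.
  by rewrite !rmorphB /=; ring.
have : (x - x') ^+ 2 + (y' - y) ^+ 2 = 0.
  apply: (@intr_inj algC); rewrite rmorphD !rmorphXn /= e1 exprMn sqrCi; ring.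
have h1 := sqr_ge0 (x - x'); have h2 := sqr_ge0 (y' - y).
move/eqP; rewrite paddr_eq0 // !sqrf_eq0 !subr_eq0 => /andP[/eqP -> /eqP ->].
by [].
Qed.

(** Writing [pi - z ^ 2 = rho * t], the imaginary part of [pi - z ^ 2] times [rho] conjugate
    shows that [d * (a * d - b * c)] is the square of [d * z1 - c * z2] modulo [q]. *)
Lemma gauss_symbol_residue (q : nat) (a b c d : int) : prime q -> q%:Z = c ^+ 2 + d ^+ 2 ->
  gauss_symbol (a%:~R + b%:~R * 'i) (c%:~R + d%:~R * 'i) = 1 ->
  nonres q (d * (a * d - b * c)) = false.
Proof.
move=> pq qcd; rewrite /gauss_symbol; case: asboolP => // _; case: asboolP => // -[_ [z1 [z2 ->]]].
move=> [_ [u [v ->]] e] _.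
have [e1 e2] : a - z1 ^+ 2 + z2 ^+ 2 = u * c - v * d /\ b - 2 * z1 * z2 = u * d + v * c.
  apply: gauss_int_inj; transitivity (a%:~R + b%:~R * 'i - (z1%:~R + z2%:~R * 'i) ^+ 2 : algC).
    transitivity (a%:~R + b%:~R * 'i - z1%:~R ^+ 2 - 2 * z1%:~R * z2%:~R * 'i - z2%:~R ^+ 2 * 'i ^+ 2 : algC).
      by rewrite sqrCi !(rmorphD, rmorphB, rmorphM, rmorphXn) /=; ring.
    by ring.
  rewrite e; transitivity (u%:~R * c%:~R + (u%:~R * d%:~R + v%:~R * c%:~R) * 'i + v%:~R * d%:~R * 'i ^+ 2 : algC).
    by ring.
  by rewrite sqrCi !(rmorphD, rmorphB, rmorphM) /=; ring.
apply: (nonres_false_intro (y := d * z1 - c * z2) pq); apply/dvdzP.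
exists (- (v * d + z2 ^+ 2)); rewrite qcd.
have -> : a = u * c - v * d + z1 ^+ 2 - z2 ^+ 2 by rewrite -e1; ring.
have -> : b = u * d + v * c + 2 * z1 * z2 by rewrite -e2; ring.
ring.
Qed.

Lemma legendre_nonres (p q : nat) : prime q -> legendre p%:Z q = -1 -> nonres q p.
Proof.
move=> pq; rewrite /legendre; case: ifP => // _; case: ifP => // /negbT/existsP nex _.
apply: contraT => /negbTE/(nonres_falseP pq) [y hy].
have q0 : q%:Z != 0 by rewrite -absz_gt0 /= prime_gt0.
have lt : (`|(y %% q)%Z|%N < q)%N.
  by rewrite -ltz_nat gez0_abs ?modz_ge0 // ltz_mod.
case: nex; exists (Ordinal lt); rewrite /= gez0_abs ?modz_ge0 //.
have -> : p%:Z - (y %% q)%Z ^+ 2 = - (y ^+ 2 - p%:Z) + (y %/ q)%Z * ((y + (y %% q)%Z)) * q%:Z.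
  have := divz_eq y q; move: (y %/ q)%Z (y %% q)%Z => Q r ->; ring.
by rewrite rpredD ?rpredN // dvdz_mull.
Qed.

Lemma odd_residue_prod (r r' k : int) :
    (r = 1 \/ r = 3 \/ r = 5 \/ r = 7) -> (r' = 1 \/ r' = 3 \/ r' = 5 \/ r' = 7) ->
    ((r == 3) || (r == 5)) (+) ((r' == 3) || (r' == 5)) ->
  exists j, 8 * k + r * r' = 8 * j + 3 \/ 8 * k + r * r' = 8 * j + 5.
Proof.
have w (n m : int) : n = 8 * m + 3 \/ n = 8 * m + 5 ->
    exists j, 8 * k + n = 8 * j + 3 \/ 8 * k + n = 8 * j + 5.
  by move=> [] ->; exists (k + m); [left | right]; ring.
by case=> [->|[->|[->|->]]]; case=> [->|[->|[->|->]]] // _;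
  first [apply: (w _ 0); by [left | right] | apply: (w _ 1); by [left | right]
       | apply: (w _ 2); by [left | right] | apply: (w _ 3); by [left | right]
       | apply: (w _ 4); by [left | right]].
Qed.

(** Since [2 * b * d] is divisible by 8, the product [(a - b) * (c - d)] is congruent modulo 8
    to the difference of the coordinates of [pi * rho], and [sg] normalizes the first of them
    modulo 4. *)
Lemma order_eight_parity (p q : nat) (a b c d : int) :
    (p %% 8 = 5)%N -> (q %% 8 = 5)%N -> p%:Z = a ^+ 2 + b ^+ 2 -> q%:Z = c ^+ 2 + d ^+ 2 ->
    odd `|a| -> odd `|c| ->
    jacobi 2 `|(a - b)%R| (+) jacobi 2 `|(c - d)%R| ->
  exists sg f c1 : int, [/\ sg = 1 \/ sg = -1, sg * (a * c - b * d) = 1 - 4 * c1,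
    sg * (a * d + b * c) = 4 * f & odd `|(c1 + f)%R|].
Proof.
move=> p5 q5 pab qcd oa oc hJ.
have [m [eb om]] := sum_two_sqr_mod8 p5 pab oa; have [n [ed on]] := sum_two_sqr_mod8 q5 qcd oc.
have [a1 ea] := odd_int oa; have [c0 ec] := odd_int oc.
have [m1 em] := odd_int om; have [n1 en] := odd_int on.
pose f0 := a1 * (2 * n1 + 1) + n1 + c0 * (2 * m1 + 1) + m1 + 1.
have ef : a * d + b * c = 4 * f0 by rewrite eb ed em en ea ec /f0; ring.
pose g := a1 * c0 * 2 + a1 + c0 - (4 * m1 * n1 + 2 * m1 + 2 * n1 + 1) * 2.
have ee : a * c - b * d = 2 * g + 1 by rewrite eb ed em en ea ec /g; ring.
have jac (x : int) : odd `|x| -> jacobi 2 `|x| = ((x %% 8)%Z == 3) || ((x %% 8)%Z == 5).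
  move=> ox; rewrite jacobi2 //; last by move: ox; case: `|x|%N.
  by move: ox; clear; lia.
have o1 : odd `|(a - b)%R| by move: oa; rewrite eb; clear; lia.
have o2 : odd `|(c - d)%R| by move: oc; rewrite ed; clear; lia.
rewrite !jac // in hJ.
have pr : exists k, (a - b) * (c - d) = 8 * k + 3 \/ (a - b) * (c - d) = 8 * k + 5.
  pose u := ((a - b) %/ 8)%Z; pose v := ((c - d) %/ 8)%Z.
  pose r := ((a - b) %% 8)%Z; pose r' := ((c - d) %% 8)%Z.
  have eu : a - b = u * 8 + r by exact: divz_eq.
  have ev : c - d = v * 8 + r' by exact: divz_eq.
  have hr : r = 1 \/ r = 3 \/ r = 5 \/ r = 7 by rewrite /r; move: o1; clear; lia.
  have hr' : r' = 1 \/ r' = 3 \/ r' = 5 \/ r' = 7 by rewrite /r'; move: o2; clear; lia.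
  have -> : (a - b) * (c - d) = 8 * (8 * u * v + u * r' + v * r) + r * r' by rewrite eu ev; ring.
  move: hJ; rewrite -/r -/r' => hJ.
  exact: odd_residue_prod.
have [k hk] := pr.
have e8 : (a - b) * (c - d) = 2 * g + 1 - 4 * f0 + 8 * ((2 * m1 + 1) * (2 * n1 + 1)).
  by rewrite -ee -ef eb ed em en; ring.
rewrite e8 in hk.
have [h1|h3] : (exists z, g = 2 * z) \/ (exists z, g = 2 * z + 1).
  by case: (int_parity g) => -[z [-> _]]; [left | right]; exists z.
- have [z ez] := h1; exists 1, f0, (- z); rewrite !mul1r; split=> //; first by left.
    by rewrite ee ez; ring.
  by move: hk; rewrite ez; set w := (2 * m1 + 1) * _; clear; lia.
- have [z ez] := h3; exists (-1), (- f0), (z + 1); rewrite !mulN1r; split; first by right.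
  + by rewrite ee ez; ring.
  + by rewrite ef; ring.
  by move: hk; rewrite ez; set w := (2 * m1 + 1) * _; clear; lia.
Qed.

Section MuExtensions.
Variables (p q : nat) (w s0 r nuK nuL : algC) (a b c d e f x y t s c1 sg : int).
Local Notation D := (p * q)%N.
Local Notation I := ('i : algC).
Local Notation al := (2 * t%:~R * (1 + s%:~R * I)).
Local Notation be := (x%:~R + 2 * y%:~R * I).
Local Notation mu := (al + be * s0).
Local Notation vp := (a%:~R + b%:~R * I).
Hypotheses (pp : prime p) (pq : prime q) (npq : p != q) (p8 : (p %% 8 = 5)%N) (q8 : (q %% 8 = 5)%N)
  (ww : w ^+ 2 = - D%:R).
Hypotheses (pab : p%:Z = a ^+ 2 + b ^+ 2) (qcd : q%:Z = c ^+ 2 + d ^+ 2) (oa : odd `|a|).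
Hypotheses (s1 : s = 1 \/ s = -1) (efD : e ^+ 2 + (4 * f) ^+ 2 = D%:Z)
  (st : s * t ^+ 2 = f * (x ^+ 2 - 4 * y ^+ 2) + e * x * y)
  (s02 : s0 ^+ 2 = e%:~R + 4 * f%:~R * I) (ec1 : e = 1 - 4 * c1) (ocf : odd `|(c1 + f)%R|)
  (ox : odd `|x|) (cxy : coprimez x (2 * y)) (sg1 : sg = 1 \/ sg = -1)
  (s0vr : s0 ^+ 2 = sg%:~R * vp * (c%:~R + d%:~R * I)).
Hypotheses (r2 : r ^+ 2 = p%:R) (nuK2 : nuK ^+ 2 = mu) (nuL2 : nuL ^+ 2 = vp * mu).
Local Notation k := (adjoin ratC [:: w]).
Local Notation E := (quad (quad (quad ratC w) I) s0).

Let I2 : I ^+ 2 = -1 := sqrCi algC.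
Let s12 : s ^+ 2 = 1. Proof. by case: s1 => ->. Qed.
Let sg2 : sg ^+ 2 = 1. Proof. by case: sg1 => ->. Qed.
Let p0 : (0 < p)%N := prime_gt0 pp.
Let D0 : (0 < D)%N. Proof. by rewrite muln_gt0 p0 prime_gt0. Qed.
Let D8 : (D %% 8 = 1)%N. Proof. by rewrite -modnMm p8 q8. Qed.
Let kq : k = quad ratC w.
Proof.
have hQ := ratC_subfield.
rewrite adjoin_quad_cons // subfield_adjoin_nil //; apply: quad_subfield => //.
by rewrite ww /ratC /= rpredN rpred_nat.
Qed.
Let hk : subfield_set (quad ratC w). Proof. by rewrite -kq; exact: adjoin_subfield. Qed.
Let kI2 : quad ratC w (I ^+ 2). Proof. by rewrite I2; in_field hk. Qed.
Let hF : subfield_set (quad (quad ratC w) I) := quad_subfield hk kI2.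
Let FI : quad (quad ratC w) I I. Proof. exact: (quad_gen _ hk). Qed.
Let Fs2 : quad (quad ratC w) I (s0 ^+ 2). Proof. by rewrite s02; in_field hF. Qed.
Let hE : subfield_set E := quad_subfield hF Fs2.
Let EI : E I. Proof. exact: (@quad_base _ s0 hF). Qed.
Let Es0 : E s0. Proof. exact: (quad_gen _ hF). Qed.
Let kE : quad ratC w `<=` E.
Proof. by move=> z kz; apply: (@quad_base _ s0 hF); exact: (@quad_base _ I hk). Qed.
Let iI : I \in Aint. Proof. by apply: Aint_sqrt; rewrite I2 rpredN rpred1. Qed.
Let is0 : s0 \in Aint. Proof. by apply: Aint_sqrt; rewrite s02; in_Aint. Qed.
Let Emu : E mu. Proof. by in_field hE. Qed.
Let imu : mu \in Aint. Proof. by in_Aint. Qed.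

(** Its product with its conjugate over [k (I)] is [- A' * be' ^ 2]. *)
Lemma mu_neq0 : mu != 0.
Proof.
have N0 : x ^+ 2 + 4 * y ^+ 2 != 0.
  have h1 := sqr_ge0 x; have h2 : 0 <= 4 * y ^+ 2 by rewrite mulr_ge0 // sqr_ge0.
  rewrite paddr_eq0 // negb_and sqrf_eq0; apply/orP; left.
  by apply: contraTneq ox => ->.
have b0 : x%:~R - 2 * y%:~R * I != 0.
  apply: contraNneq N0 => h; apply/eqP; apply: (@intr_inj algC).
  transitivity ((x%:~R - 2 * y%:~R * I) * be); last by rewrite h mul0r.
  transitivity (x%:~R ^+ 2 - 4 * y%:~R ^+ 2 * I ^+ 2 : algC); last by ring.
  by rewrite I2 !(rmorphD, rmorphM, rmorphXn) /=; ring.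
have A0 : (e%:~R - 4 * f%:~R * I) != 0.
  have DC : D%:R != 0 :> algC by rewrite pnatr_eq0 -lt0n.
  apply: contraNneq DC => h; apply/eqP; rewrite -[D%:R]/(D%:Z%:~R) -efD.
  transitivity ((e%:~R - 4 * f%:~R * I) * (e%:~R + 4 * f%:~R * I)); last by rewrite h mul0r.
  transitivity (e%:~R ^+ 2 - 16 * f%:~R ^+ 2 * I ^+ 2 : algC); last by ring.
  by rewrite I2 !(rmorphD, rmorphM, rmorphXn) /=; ring.
have h : mu * (al - be * s0) = - ((e%:~R - 4 * f%:~R * I) * (x%:~R - 2 * y%:~R * I) ^+ 2).
  transitivity (al ^+ 2 - (be * s0) ^+ 2); first by ring.
  by rewrite (mu_al_sqr I2 s12 st) (mu_b_sqr x y s02); ring.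
have : mu * (al - be * s0) != 0 by rewrite h oppr_eq0 mulf_neq0 // sqrf_eq0.
by rewrite mulf_eq0 negb_or => /andP[].
Qed.

(** The case [P = 1], [vp = 1] of the general construction. *)
Lemma mu_C8 : galois_extension k (adjoin k [:: 1; I; s0; nuK]) [set: 'Z_8]%G.
Proof.
apply: (mu_galois_C8 I2 ww s12 efD D0 st s02 (va := 1) (vb := 0) (p_ := 1)) => //.
- by rewrite nuK2 mul0r addr0 mul1r.
- by rewrite -sqrf_eq0 nuK2 mu_neq0.
- by rewrite expr1n.
- by rewrite kq; exact: sf1.
- by rewrite kq; exact: (I_notin_k pp pq npq ww I2).
Qed.

Lemma nuL_neq0 : nuL != 0.
Proof.
rewrite -sqrf_eq0 nuL2 mulf_neq0 ?mu_neq0 //.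
have pC : p%:R != 0 :> algC by rewrite pnatr_eq0 -lt0n.
apply: contraNneq pC => h; apply/eqP; rewrite -[p%:R]/(p%:Z%:~R) pab.
transitivity (vp * (a%:~R - b%:~R * I)); last by rewrite h mul0r.
transitivity (a%:~R ^+ 2 - b%:~R ^+ 2 * I ^+ 2 : algC); last by ring.
by rewrite I2 !(rmorphD, rmorphM, rmorphXn) /=; ring.
Qed.

Lemma mu_M42 : galois_extension k (adjoin k [:: r; I; s0; nuL]) 'Mod_(16%N)%G.
Proof.
have hq (z : algC) : quad ratC w (z ^+ 2) -> adjoin k [:: z] = quad (quad ratC w) z.
  by move=> kz; rewrite kq adjoin_quad_cons // subfield_adjoin_nil //; exact: quad_subfield.
apply: (mu_galois_M42 I2 ww s12 efD D0 st s02 nuL2 nuL_neq0 (esym pab) r2 p0).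
- by rewrite hq //; exact: (r_notin_kI pp pq ww I2 r2).
- by rewrite hq ?r2; [exact: (I_notin_kr pp pq npq ww I2 r2) | in_field hk].
Qed.

Local Notation om := ((s0 - 1) / 2).
Local Notation kp := (om + (c1%:~R - f%:~R * I)).
Local Notation h := (1 + (1 + I) * kp).
Let Eom : E om. Proof. by in_field hE. Qed.
Let iom : om \in Aint.
Proof.
apply: (Aint_quadratic (t := -1) (n := c1%:~R - f%:~R * I)); [by in_Aint | by in_Aint |].
have -> : om ^+ 2 = (s0 ^+ 2 - 2 * s0 + 1) / 4 by field.
by rewrite s02 ec1 rmorphB rmorphM rmorph1 /=; field.
Qed.
Let Ekp : E kp. Proof. by in_field hE. Qed.
Let ikp : kp \in Aint. Proof. by apply: rpredD => //; in_Aint. Qed.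
Let Eh : E h. Proof. by apply: (sfD hE); [exact: sf1 | apply: (sfM hE) => //; in_field hE]. Qed.
Let ih : h \in Aint. Proof. by apply: rpredD; [exact: rpred1 | apply: rpredM => //; in_Aint]. Qed.
Let comb (n0 n1 n2 n3 : int) : int_ring E ((n0%:~R + n1%:~R * I) + (n2%:~R + n3%:~R * I) * om).
Proof.
split; last by apply: rpredD; [in_Aint | apply: rpredM => //; in_Aint].
by apply: (sfD hE); [in_field hE | apply: (sfM hE) => //; in_field hE].
Qed.

(** As [k] is imaginary, it has no real place. *)
Lemma mu_unramified : unramified k (adjoin k [:: I; s0; r; nuL]).
Proof.
have [m' [eb om']] := sum_two_sqr_mod8 p8 pab oa.
have [ep [n0 [n1 [n2 [n3 [ep1 hmod]]]]]] := mu_congruence I2 s02 ec1 ocf ox s1 st oa eb om'.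
split; last first.
  move=> sigma /(_ w); rewrite kq => /(_ (quad_gen _ ratC_subfield)) /real_exprn_even_ge0 => /(_ 2 isT).
  by rewrite -rmorphXn /= ww rmorphN rmorph_nat oppr_ge0 lern0 => /eqP D00; move: D0; rewrite D00.
move=> P; have -> : adjoin k [:: I; s0; r; nuL] = quad (quad E r) nuL.
  have Er2 : E (r ^+ 2) by rewrite r2; in_field hE.
  have hM := quad_subfield hE Er2.
  have Mn2 : quad E r (nuL ^+ 2).
    by rewrite nuL2; apply: (@quad_base E r hE); apply: (sfM hE) => //; in_field hE.
  rewrite kq !adjoin_quad_cons // subfield_adjoin_nil //; exact: quad_subfield.
rewrite kq => hP.
have [Eeta ieta] := comb n0 n1 n2 n3.
have p4 : (p %% 4 = 1)%N by move: p8; clear; lia.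
have [epC [ep2 epC2]] : exists epC : algC, (epC = 1 \/ epC = I) /\ epC ^+ 2 = ep%:~R.
  case: ep1 => ->; first by exists 1; rewrite expr1n; split=> //; left.
  by exists I; rewrite I2; split=> //; right.
have epep : ep%:~R * ep%:~R = 1 :> algC by case: ep1 => ->; rewrite ?mulr1 // mulrNN mulr1.
apply: (mu_field_unramified pp pq npq p4 D8 ww I2 s12 efD st s02 ec1 cxy (esym pab) (esym qcd) sg2
  s0vr r2 nuL2 nuL_neq0 ep2 Eh ih (eta := ep%:~R * ((n0%:~R + n1%:~R * I) + (n2%:~R + n3%:~R * I) * om)) _ _ _ hP).
- by apply: rpredM => //; exact: rpred_int.
- rewrite epC2 nuL2 hmod; transitivity ((ep%:~R * ep%:~R) * h ^+ 2 + 4 * (ep%:~R * ((n0%:~R + n1%:~R * I) + (n2%:~R + n3%:~R * I) * om))).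
    by ring.
  by rewrite epep mul1r.
- by exists kp.
Qed.

(** From [(1 + 2 * I) * mu = ep * h ^ 2 + 4 * eta] and [(1 + 2 * I) * (1 - 2 * I) = 5], the
    number [ep * mu] is [(1 + 2 * I) * h ^ 2] modulo 4. *)
Lemma mu_ramified : ramified_above k (adjoin k [:: I; s0; nuK]) 2.
Proof.
have [ep [n0 [n1 [n2 [n3 [ep1 hmod]]]]]] :=
  mu_congruence (va := 1) (vb := 2) (m' := 1) I2 s02 ec1 ocf ox s1 st isT erefl isT.
have En2 : E (nuK ^+ 2) by rewrite nuK2.
have hK := quad_subfield hE En2.
have -> : adjoin k [:: I; s0; nuK] = quad E nuK.
  by rewrite kq !adjoin_quad_cons // subfield_adjoin_nil.
have [P [hP P2 mx]] := maximal_above_two hK.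
rewrite kq.
have EK : E `<=` quad E nuK := @quad_base E nuK hE.
have kK : quad ratC w `<=` quad E nuK by move=> z /kE /EK.
have [Pw lw] := base_loc_gen_two pp pq npq D8 ww hK kK hP P2.
have D4 : (D %% 4 = 1)%N by move: D8; clear; lia.
have kw : quad ratC w w by exact: (quad_gen _ ratC_subfield).
have s02' : s0 ^+ 2 = (1 - 4 * c1)%:~R + 4 * f%:~R * I by rewrite -ec1.
have lE := loc_gen_two_tower hK hP P2 hk kw EK ww D4 I2 s02' lw.
have [u [Ou eu]] : exists u, int_ring E u /\ 1 + w = (1 - I) * u.
  exists ((1 + w) * (1 + I) / 2); split; last first.
    transitivity ((1 + w) * (1 - I ^+ 2) / 2); last by field.
    by rewrite I2; field.
  split; first by have Ew := kE kw; in_field hE.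
  apply: Aint_sqrt; have -> : ((1 + w) * (1 + I) / 2) ^+ 2 = (1 + 2 * w + w ^+ 2) * (1 + 2 * I + I ^+ 2) / 4 by field.
  rewrite I2 ww; have -> : D = (2 * (D %/ 2) + 1)%N by move: D8; clear; lia.
  rewrite natrD natrM.
  rewrite (_ : _ / 4 = (w - (D %/ 2)%:R) * I); last by field.
  have iw : w \in Aint by apply: Aint_sqrt; rewrite ww rpredN rpred_nat.
  by in_Aint.
have lamE : loc_gen P E (1 - I).
  move=> z Pz Oz; have [S [Y [OS nS OY e1]]] := lE z Pz Oz.
  by exists S, (u * Y); split=> //; [exact: int_ringM | rewrite e1 eu mulrA].
have [epC [Eep epC2]] : exists epC : algC, (E epC /\ epC \in Aint /\ epC != 0) /\ epC ^+ 2 = ep%:~R.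
  case: ep1 => ->; first by exists 1; rewrite expr1n oner_eq0 rpred1; split=> //; split=> //; exact: sf1.
  by exists I; rewrite I2 iI -sqrf_eq0 I2 oppr_eq0 oner_eq0.
have [Eep' [iep ep0]] := Eep.
have epep : ep%:~R * ep%:~R = 1 :> algC by case: ep1 => ->; rewrite ?mulr1 // mulrNN mulr1.
have [Eeta ieta] := comb n0 n1 n2 n3.
set eta := (_ + _ + _ : algC) in hmod Eeta ieta.
pose z := ep%:~R * (eta * (1 - 2 * I) - mu - ep%:~R * I * h ^+ 2).
have Ez : E z.
  apply: (sfM hE); first exact: sf_int.
  apply: (sfB hE); last by apply: (sfM hE); [in_field hE | exact: sfX].
  by apply: (sfB hE) => //; apply: (sfM hE) => //; in_field hE.
have iz : z \in Aint.
  apply: rpredM; first exact: rpred_int.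
  apply: rpredB; last by apply: rpredM; [in_Aint | exact: rpredX].
  by apply: rpredB => //; apply: rpredM => //; in_Aint.
have nuz : (epC * nuK) ^+ 2 = (1 + 2 * I) * h ^+ 2 + 4 * z.
  have e5 : 5 * mu = (1 - 2 * I) * (ep%:~R * h ^+ 2 + 4 * eta).
    rewrite -hmod; transitivity ((1 - 4 * I ^+ 2) * mu); last by ring.
    by rewrite I2; ring.
  rewrite exprMn epC2 nuK2.
  transitivity (ep%:~R * (5 * mu) - 4 * ep%:~R * mu); first by ring.
  rewrite e5; transitivity ((ep%:~R * ep%:~R) * (1 - 2 * I) * h ^+ 2 + 4 * z + 4 * (ep%:~R * ep%:~R) * I * h ^+ 2).
    by rewrite /z; ring.
  by rewrite epep; ring.
have [n hn n1'] := eisen_ramified hE En2 I2 EI Eep' Eh ih Ez iz Ekp ikp erefl nuz hP P2 lamE mx kE hk.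
by exists P, n.
Qed.
End MuExtensions.

Local Close Scope classical_set_scope.

Lemma sqrt_sign (x y : algC) : x ^+ 2 = y ^+ 2 -> exists ep : int, ep ^+ 2 = 1 /\ x = ep%:~R * y.
Proof.
move/eqP; rewrite eqf_sqr => /orP[] /eqP ->; first by exists 1; rewrite mul1r.
by exists (-1); rewrite mulN1r.
Qed.

Lemma conjC_gauss (x y : int) : (x%:~R + y%:~R * 'i : algC)^* = x%:~R - y%:~R * 'i.
Proof. by rewrite rmorphD rmorphM /= conjCi !rmorph_int mulrN. Qed.

Unset Implicit Arguments.

Theorem proposition24 (p q : nat) (a b c d : int) :
  let k := adjoin ratC [:: sqrtC (- (p * q)%:R)] in
  let pi : algC := a%:~R + b%:~R * 'i in
  let rho : algC := c%:~R + d%:~R * 'i in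
  prime p -> prime q ->
  (p = 5 %[mod 8])%N -> (q = 5 %[mod 8])%N ->
  legendre p%:Z q = -1 ->
  two_class_group_isog k [set: 'Z_4 * 'Z_2]%G ->
  p%:Z = a ^+ 2 + b ^+ 2 -> q%:Z = c ^+ 2 + d ^+ 2 ->
  odd `|a|%N -> odd `|c|%N ->
  gauss_symbol pi rho = 1 ->
  exists alpha beta gamma : algC,
    [/\ gaussInt alpha, gaussInt beta & gaussInt gamma] /\
    (alpha, beta, gamma) <> (0, 0, 0) /\
    alpha ^+ 2 - pi * rho * beta ^+ 2 - pi^* * rho^* * gamma ^+ 2 = 0 /\
    let mu := alpha + beta * sqrtC (pi * rho) in
    let K := adjoin k [:: sqrtC (p * q)%:R; sqrtC (pi * rho); sqrtC mu] in
    let L := adjoin k [:: sqrtC p%:R; sqrtC q%:R; sqrtC (pi * rho);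
                          sqrtC (pi * mu)] in
    [/\ galois_extension k K [set: 'Z_8]%G, ramified_above k K 2,
        galois_extension k L 'Mod_(16%N)%G & unramified k L].
Proof.
set w := sqrtC (- _); move=> k pi rho pp pq p8 q8 leg hCl pab qcd oa oc gs.
have {}p8 : (p %% 8 = 5)%N by [].
have {}q8 : (q %% 8 = 5)%N by [].
have ww : w ^+ 2 = - (p * q)%:R by rewrite sqrtCK.
have hpq := legendre_nonres pq leg; have npq := p_neq_q pq hpq.
have hres := gauss_symbol_residue pq qcd gs.
have kq : k = quad ratC w.
  rewrite /k adjoin_quad_cons; [|exact: ratC_subfield]; apply: subfield_adjoin_nil.
  by apply: quad_subfield; [exact: ratC_subfield | rewrite ww /ratC /= rpredN rpred_nat].
rewrite kq in hCl.
have hJ := class_group_42_jacobi pp pq p8 q8 hpq pab qcd oa oc hres ww hCl.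
have [sg [f [c1 [sg1 ee ef ocf]]]] := order_eight_parity p8 q8 pab qcd oa oc hJ.
pose e := sg * (a * c - b * d).
have sg2 : sg ^+ 2 = 1 by case: sg1 => ->.
have efD : e ^+ 2 + (4 * f) ^+ 2 = (p * q)%N%:Z.
  by rewrite -ef /e !exprMn sg2 !mul1r (norm_product pab qcd).
have p4 : (p %% 4 = 1)%N by move: p8; clear; lia.
have q4 : (q %% 4 = 1)%N by move: q8; clear; lia.
have pf : ~~ (p%:Z %| 4 * f)%Z.
  by rewrite -ef; have := p_ndvd_f pp pq hpq pab qcd; case: sg1 => ->; rewrite ?mul1r ?mulN1r ?rpredN.
have qf : ~~ (q%:Z %| 4 * f)%Z.
  by rewrite -ef; have := q_ndvd_f pp pq hpq pab qcd; case: sg1 => ->; rewrite ?mul1r ?mulN1r ?rpredN.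
have rpf : nonres p (4 * f) = false.
  have h := nonres_p_f pp pq p8 q8 hpq pab qcd oc hres.
  have n := p_ndvd_f pp pq hpq pab qcd.
  by rewrite -ef; case: sg1 => ->; rewrite ?mul1r ?mulN1r ?nonresN.
have rqf : nonres q (4 * f) = false.
  have h := nonres_q_f pp pq q8 hpq pab qcd oc hres.
  have n := q_ndvd_f pp pq hpq pab qcd.
  by rewrite -ef; case: sg1 => ->; rewrite ?mul1r ?mulN1r ?nonresN.
have oe : odd `|e| by rewrite /e ee; clear; lia.
have [x [y [t [s [ox cxy s1 st]]]]] := conic_solution pp pq p4 q4 npq oe efD pf qf rpf rqf.
have I2 : 'i ^+ 2 = -1 :> algC := sqrCi algC.
(* [u0] and [ug] absorb the sign: [u0 ^ 2 = sg] and [ug ^ 2 = - sg]. *)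
have [u0 [ug [u02 ug2 u01 gu gug]]] : exists u0 ug : algC, [/\ u0 ^+ 2 = sg%:~R, ug ^+ 2 = - sg%:~R,
    u0 = 1 \/ u0 = 'i, gaussInt ((x%:~R + 2 * y%:~R * 'i) / u0) & gaussInt (ug * (x%:~R - 2 * y%:~R * 'i))].
  have gi (u v : int) z : z = u%:~R + v%:~R * 'i -> gaussInt z by move=> ->; exists u, v.
  case: sg1 => ->; [exists 1, 'i | exists 'i, 1]; rewrite ?expr1n ?I2; split=> //.
  - by left.
  - by rewrite divr1; apply: (gi x (2 * y)); rewrite rmorphM.
  - apply: (gi (2 * y) x); rewrite rmorphM /=.
    by transitivity (x%:~R * 'i - 2 * y%:~R * 'i ^+ 2 : algC); [ring | rewrite I2; ring].
  - by rewrite rmorphN opprK.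
  - by right.
  - rewrite invCi; apply: (gi (2 * y) (- x)); rewrite rmorphM rmorphN /=.
    by transitivity (- x%:~R * 'i - 2 * y%:~R * 'i ^+ 2 : algC); [ring | rewrite I2; ring].
  - by rewrite mul1r; apply: (gi x (- (2 * y))); rewrite rmorphN rmorphM /=; ring.
have u00 : u0 != 0 by rewrite -sqrf_eq0 u02; case: sg1 => ->; rewrite ?oppr_eq0 oner_eq0.
have sgC : sg%:~R * sg%:~R = 1 :> algC by rewrite -expr2 -rmorphXn /= sg2.
pose sA := sqrtC (pi * rho); pose s0 := sA / u0.
have prE : sg%:~R * (pi * rho) = e%:~R + 4 * f%:~R * 'i.
  have -> : 4 * f%:~R = (sg * (a * d + b * c))%:~R :> algC by rewrite ef rmorphM.
  rewrite /e /pi /rho !(rmorphM, rmorphD, rmorphB) /=.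
  transitivity (sg%:~R * (a%:~R * c%:~R + (a%:~R * d%:~R + b%:~R * c%:~R) * 'i + b%:~R * d%:~R * 'i ^+ 2) : algC).
    by ring.
  by rewrite I2; ring.
have sgV : sg%:~R^-1 = sg%:~R :> algC.
  by apply: (mulrI (x := sg%:~R)); rewrite ?unitfE ?divff // ?sgC //; case: sg1 => ->; rewrite ?oppr_eq0 oner_eq0.
have s0pr : s0 ^+ 2 = sg%:~R * (pi * rho) by rewrite /s0 expr_div_n u02 sgV sqrtCK mulrC.
have s02 : s0 ^+ 2 = e%:~R + 4 * f%:~R * 'i by rewrite s0pr prE.
have s0vr : s0 ^+ 2 = sg%:~R * pi * rho by rewrite s0pr mulrA.
pose al : algC := 2 * t%:~R * (1 + s%:~R * 'i); pose be : algC := x%:~R + 2 * y%:~R * 'i.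
pose be' : algC := x%:~R - 2 * y%:~R * 'i.
have s12 : s ^+ 2 = 1 by case: s1 => ->.
have conic := mu_al_sqr I2 s12 st.
have bar : sg%:~R * (pi^* * rho^*) = e%:~R - 4 * f%:~R * 'i.
  transitivity ((e%:~R + 4 * f%:~R * 'i : algC)^*).
    by rewrite -prE !rmorphM /= rmorph_int.
  by have := conjC_gauss e (4 * f); rewrite [(4 * f)%:~R]rmorphM.
exists al, (be / u0), (ug * be'); split.
  split=> //; exists (2 * t), (2 * t * s); rewrite /al !rmorphM /=; ring.
split.
  case=> _ /eqP; rewrite mulf_eq0 invr_eq0 (negbTE u00) orbF => /eqP be0 _.
  have e0 : x%:~R + (2 * y)%:~R * 'i = 0%:~R + 0%:~R * 'i :> algC.
    by rewrite mul0r addr0 rmorphM /=; exact: be0.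
  by have [x0 _] := gauss_int_inj e0; rewrite x0 in ox.
split.
  have -> : (be / u0) ^+ 2 = sg%:~R * be ^+ 2 by rewrite expr_div_n u02 sgV mulrC.
  have -> : (ug * be') ^+ 2 = - sg%:~R * be' ^+ 2 by rewrite [LHS]exprMn ug2.
  rewrite (_ : _ - _ = al ^+ 2 - (sg%:~R * (pi * rho)) * be ^+ 2 + (sg%:~R * (pi^* * rho^*)) * be' ^+ 2).
    by rewrite bar prE /al conic /be /be'; ring.
  by ring.
move=> mu K L.
have emu : mu = al + be * s0 by rewrite /mu /s0 /sA; field; exact: u00.
have r2 : sqrtC p%:R ^+ 2 = p%:R :> algC by rewrite sqrtCK.
have nuK2 : sqrtC mu ^+ 2 = al + be * s0 by rewrite sqrtCK.
have nuL2 : sqrtC (pi * mu) ^+ 2 = pi * (al + be * s0) by rewrite sqrtCK emu.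
have w0 : w != 0.
  by rewrite -sqrf_eq0 ww oppr_eq0 pnatr_eq0 -lt0n muln_gt0 !prime_gt0.
have r0 : sqrtC p%:R != 0 :> algC by rewrite -sqrf_eq0 r2 pnatr_eq0 -lt0n prime_gt0.
have Iw2 : ('i * w) ^+ 2 = (p * q)%:R by rewrite exprMn I2 ww mulN1r opprK.
have [ep [ep2 epE]] : exists ep : int, ep ^+ 2 = 1 /\ sqrtC (p * q)%:R = ep%:~R * ('i * w).
  by apply: sqrt_sign; rewrite sqrtCK Iw2.
have [ep' [ep2' epE']] : exists ep : int, ep ^+ 2 = 1 /\ sqrtC p%:R * sqrtC q%:R = ep%:~R * ('i * w).
  by apply: sqrt_sign; rewrite exprMn !sqrtCK -natrM Iw2.
have epI : 'i = ep%:~R * sqrtC (p * q)%:R / w.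
  by rewrite epE mulrA -expr2 -rmorphXn /= ep2 mul1r mulfK.
have epI' : 'i = ep'%:~R * (sqrtC p%:R * sqrtC q%:R) / w.
  by rewrite epE' mulrA -expr2 -rmorphXn /= ep2' mul1r mulfK.
have rqE : sqrtC q%:R = ep'%:~R * ('i * w) / sqrtC p%:R :> algC.
  by rewrite -epE' mulrC mulKf.
have sAE : sqrtC (pi * rho) = s0 * u0 by rewrite /s0 divfK.
have Fu0 (F : set algC) : subfield_set F -> F 'i -> F u0.
  by move=> hF FI; case: u01 => ->; [exact: sf1 | exact: FI].
have kw : k w by apply: adjoin_gen; rewrite inE.
have memw s' : adjoin k s' w by exact: adjoin_base.
have gen s' z : z \in s' -> adjoin k s' z by exact: adjoin_gen.
pose nuK := sqrtC mu; pose nuL := sqrtC (pi * mu).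
have KI : K 'i.
  have hK : subfield_set K := adjoin_subfield _ _.
  have h1 : K (sqrtC (p * q)%:R) by apply: gen; rewrite inE eqxx.
  have h2 : K w := memw _.
  by rewrite epI; in_field hK.
have Ks0 : K s0.
  have hK : subfield_set K := adjoin_subfield _ _.
  have h1 : K sA by apply: gen; rewrite !inE eqxx orbT.
  have h2 := Fu0 K hK KI.
  by rewrite /s0; in_field hK.
have LI : L 'i.
  have hL : subfield_set L := adjoin_subfield _ _.
  have h1 : L (sqrtC p%:R) by apply: gen; rewrite inE eqxx.
  have h2 : L (sqrtC q%:R) by apply: gen; rewrite !inE eqxx orbT.
  have h3 : L w := memw _.
  by rewrite epI'; in_field hL.
have Ls0 : L s0.
  have hL : subfield_set L := adjoin_subfield _ _.
  have h1 : L sA by apply: gen; rewrite !inE eqxx !orbT.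
  have h2 := Fu0 L hL LI.
  by rewrite /s0; in_field hL.
have adK s' : (forall z, z \in [:: 'i; s0; nuK] -> z \in s') ->
    (forall z, z \in s' -> z = 1 \/ z \in [:: 'i; s0; nuK]) -> K = adjoin k s'.
  move=> h1 h2; have hK : subfield_set K := adjoin_subfield _ _.
  have hs := adjoin_subfield k s'.
  have sI : adjoin k s' 'i by apply: gen; apply: h1; rewrite inE eqxx.
  have ss0 : adjoin k s' s0 by apply: gen; apply: h1; rewrite !inE eqxx orbT.
  apply: adjoin_eqP => z; last first.
    move/h2 => [->|]; first exact: (sf1 hK).
    rewrite !inE => /or3P[] /eqP -> //; apply: gen; by rewrite !inE eqxx !orbT.
  have hw := memw s'; have hu := Fu0 _ hs sI.
  rewrite !inE => /or3P[] /eqP ->.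
  - by rewrite epE; in_field hs.
  - by rewrite sAE; in_field hs.
  - by apply: gen; apply: h1; rewrite !inE eqxx !orbT.
have adL s' : (forall z, z \in [:: 'i; s0; sqrtC p%:R; nuL] -> z \in s') ->
    (forall z, z \in s' -> z \in [:: 'i; s0; sqrtC p%:R; nuL]) -> L = adjoin k s'.
  move=> h1 h2; have hs := adjoin_subfield k s'.
  have sI : adjoin k s' 'i by apply: gen; apply: h1; rewrite inE eqxx.
  have ss0 : adjoin k s' s0 by apply: gen; apply: h1; rewrite !inE eqxx orbT.
  have sr : adjoin k s' (sqrtC p%:R) by apply: gen; apply: h1; rewrite !inE eqxx !orbT.
  apply: adjoin_eqP => z; last first.
    move/h2; rewrite !inE => /or4P[] /eqP -> //; apply: gen; by rewrite !inE eqxx ?orbT.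
  have hw := memw s'; have hu := Fu0 _ hs sI.
  rewrite !inE => /or4P[] /eqP -> //.
  - by rewrite rqE; in_field hs.
  - by rewrite sAE; in_field hs.
  - by apply: gen; apply: h1; rewrite !inE eqxx !orbT.
split.
- rewrite (adK [:: 1; 'i; s0; nuK]).
  + exact: (mu_C8 pp pq npq ww s1 efD st s02 ox nuK2).
  + by move=> z; rewrite !inE => /or3P[] ->; rewrite ?orbT.
  + by move=> z; rewrite !inE => /or4P[] => [/eqP ->|->|->|->]; rewrite ?orbT; [left|right|right|right].
- rewrite (adK [:: 'i; s0; nuK]) //; last by right.
  exact: (mu_ramified pp pq npq p8 q8 ww s1 st s02 ee ocf ox nuK2).
- rewrite (adL [:: sqrtC p%:R; 'i; s0; nuL]).
  + exact: (mu_M42 pp pq npq ww pab s1 efD st s02 ox r2 nuL2).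
  + by move=> z; rewrite !inE => /or4P[] ->; rewrite ?orbT.
  + by move=> z; rewrite !inE => /or4P[] ->; rewrite ?orbT.
- rewrite (adL [:: 'i; s0; sqrtC p%:R; nuL]) //.
  exact: (mu_unramified pp pq npq p8 q8 ww pab qcd oa s1 efD st s02 ee ocf ox cxy sg1 s0vr r2 nuL2).
Qed.
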